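(* Let $\mathcal A$ be a cluster algebra of rank $n$ and suppose that every seed in $\mathcal A$ is uniquely defined by its cluster. Then two clusters of $\mathcal A$ are adjacent in the exchange graph of $\mathcal A$ if and only if they have exactly $n-1$ common cluster variables. In particular, for a skew-symmetrizable integer $n\times n$ matrix $B$ and $\mathcal A\in\mathfrak A(B)$, two clusters of $\mathcal A$ are adjacent in the exchange graph of $\mathcal A$ if and only if they have exactly $n-1$ common cluster variables, provided that one of the following conditions holds: (i) $\mathcal A$ is of geometric type; (ii) $\mathcal A$ is arbitrary and $B$ is nondegenerate (i.e. $\det B\ne0$).
   Context: A semifield $\mathcal P$ is a torsion-free multiplicative abelian group endowed with an additional operation $\oplus$ which is commutative, associative, and such that multiplication distributes over it. The ambient field $\mathcal F$ is the field of rational functions in $n$ independent variables with coefficients in the field of fractions of the integer group ring $\mathbb Z\mathcal P$. A square matrix $B$ is skew-symmetrizable if $DB$ is skew-symmetric for some diagonal matrix $D$ with positive diagonal entries. A seed is a triple $\Sigma=(\mathbf x,\mathbf y,B)$, where $\mathbf x=(x_1,\dots,x_n)$ (the cluster; its entries are the cluster variables) is a transcendence basis of $\mathcal F$ over the field of fractions of $\mathbb Z\mathcal P$, $\mathbf y=(y_1,\dots,y_n)$ (the coefficient tuple) is an $n$-tuple of elements of $\mathcal P$, and $B=(b_{ij})$ (the exchange matrix) is a skew-symmetrizable integer $n\times n$ matrix. The seed mutation in direction $k\in[1,n]$ takes $\Sigma$ to the adjacent seed $\Sigma'=(\mathbf x',\mathbf y',B')$ defined as follows. The cluster $\mathbf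 x'$ is obtained from $\mathbf x$ by replacing $x_k$ with $x_k'$ given by $$x_kx'_k=\frac{y_k}{y_k\oplus 1}\prod_{b_{ki}>0}x_i^{b_{ki}}+\frac{1}{y_k\oplus 1}\prod_{b_{ki}<0}x_i^{-b_{ki}}$$ (empty products equal $1$). The coefficients are $y'_k=y_k^{-1}$; for $j\ne k$, $y'_j=y_jy_k^{b_{jk}}(y_k\oplus1)^{-b_{jk}}$ if $b_{jk}>0$ and $y'_j=y_j(y_k\oplus1)^{-b_{jk}}$ if $b_{jk}\le 0$. The exchange matrix is $b'_{ij}=-b_{ij}$ if $i=k$ or $j=k$, and $b'_{ij}=b_{ij}+\frac{|b_{ik}|b_{kj}+b_{ik}|b_{kj}|}{2}$ otherwise. (This exchange matrix is the transpose of the one used by Fomin and Zelevinsky.) Two seeds are mutation equivalent if one is obtained from the other by a sequence of seed mutations. The cluster algebra $\mathcal A(\Sigma)$ of rank $n$ associated with an initial seed $\Sigma$ is the $\mathbb Z\mathcal P$-subalgebra of $\mathcal F$ generated by all cluster variables in all seeds mutation equivalent to $\Sigma$; these seeds (and their clusters) are the seeds (and clusters) of $\mathcal A(\Sigma)$. $\mathfrak A(B)$ denotes the family of all cluster algebras obtained by fixing the initial exchange matrix $B$ and varying the semifield $\mathcal P$, the initial coefficient tuple $\mathbf y$, and the initial cluster $\mathbf x$. $\mathcal A$ is of geometric type if $\mathcal P$ is a tropical semifield, i.e. the free multiplicative abelian group on finitely many generators $g_1,\dots,g_m$ with $\prod_{i=1}^m g_i^{a_i}\oplus\prod_{i=1}^m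 g_i^{b_i}=\prod_{i=1}^m g_i^{\min(a_i,b_i)}$. Let $\mathbb T_n$ be the $n$-regular tree whose edges are labeled by $1,\dots,n$ so that the $n$ edges at each vertex receive different labels; its vertices correspond to seeds of $\mathcal A$, with vertices joined by an edge labeled $k$ corresponding to seeds adjacent in direction $k$. Two seeds are equivalent if they differ by a permutation $\sigma\in S_n$ of the cluster variables together with the corresponding permutation of the coefficients $\mathbf y$ and of the rows and columns of the exchange matrix. The exchange graph of $\mathcal A$ is the quotient of $\mathbb T_n$ modulo this equivalence relation. ''Every seed in $\mathcal A$ is uniquely defined by its cluster'' means: if seeds $\Sigma_1,\Sigma_2$ of $\mathcal A$ have cluster variables related by $x_{i;\Sigma_2}=x_{\sigma(i);\Sigma_1}$ for some $\sigma\in S_n$ and all $i\in[1,n]$, then $y_{i;\Sigma_2}=y_{\sigma(i);\Sigma_1}$ and $b_{ij;\Sigma_2}=b_{\sigma(i)\sigma(j);\Sigma_1}$ for all $i,j\in[1,n]$. In that case the vertices of the exchange graph are identified with clusters considered up to permutation of their cluster variables (i.e. as unordered sets), and adjacency of clusters is understood via this identification. *)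

(* Defs.v *)
From HB Require Import structures.
From mathcomp Require Import all_boot all_order all_algebra fingroup perm.
From mathcomp Require Import generic_quotient fraction finmap.
From mathcomp Require Import boolp.
From mathcomp.multinomials Require monalg mpoly.

Set Implicit Arguments.
Unset Strict Implicit.
Unset Printing Implicit Defensive.

Import Order.TTheory GRing.Theory Num.Theory.
Local Open Scope quotient_scope.
Local Open Scope fset_scope.
Local Open Scope ring_scope.

HB.mixin Record Group_isSemifield P of monoid.Group P := {
  oplus : P -> P -> P;
  semifield_mulC : commutative (@monoid.mul P);
  semifield_torsion_free :
    forall (x : P) (k : nat), (0 < k)%N -> (x ^+ k = 1)%g -> x = 1%g;
  oplusC : commutative oplus;
  oplusA : associative oplus;
  mulg_oplusl : left_distributive (@monoid.mul P) oplus
}.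

#[short(type="semifieldType")]
HB.structure Definition Semifield := {P of Group_isSemifield P & monoid.Group P}.

Definition expgz (P : semifieldType) (x : P) (a : int) : P :=
  (match a with Posz k => x ^+ k | Negz k => x ^- k.+1 end)%g.

Definition tropical (P : semifieldType) : Prop :=
  exists (m : nat) (g : 'I_m -> P),
    let mon (a : {ffun 'I_m -> int}) := (\prod_(i < m) expgz (g i) (a i))%g in
    (forall p : P, exists! a, p = mon a) /\
    (forall a b, oplus (mon a) (mon b) = mon [ffun i => Num.min (a i) (b i)]).

(* Finitely supported maps P -> int.  The library's own product on malg is
   not available: it asks for a monoid of exponents in which x y = 1 forces
   x = y = 1.  The product below and its proofs follow monalg. *)
Definition group_ring (P : semifieldType) := monalg.malg P int.

Section GroupRing.
Variable P : semifieldType.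
Import monalg.
Local Notation ZP := (group_ring P).
Implicit Types (f g h : ZP) (p q : P).

HB.instance Definition _ := GRing.Zmodule.on ZP.

Definition gr_one : ZP := mkmalgU 1%g 1.

Definition gr_mul f g : ZP :=
  \sum_(p <- msupp f) \sum_(q <- msupp g)
     mkmalgU (p * q)%g (mcoeff p f * mcoeff q g).

Lemma gr_mulw (d1 d2 : {fset P}) f g :
  msupp f `<=` d1 -> msupp g `<=` d2 ->
  gr_mul f g = \sum_(p <- d1) \sum_(q <- d2)
     mkmalgU (p * q)%g (mcoeff p f * mcoeff q g).
Proof.
move=> le1 le2; rewrite /gr_mul (big_fset_incl _ le1) /=.
  apply/eq_bigr=> k1 _; apply/big_fset_incl => // k _ /mcoeff_outdom ->.
  by rewrite mulr0 monalgU0.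
move=> k _ /mcoeff_outdom g1k.
by rewrite big1 => // k' _; rewrite g1k mul0r monalgU0.
Qed.

Lemma gr_mulC : commutative gr_mul.
Proof.
move=> f g; rewrite /gr_mul exchange_big /=.
by apply: eq_bigr => p _; apply: eq_bigr => q _; rewrite semifield_mulC mulrC.
Qed.

Lemma gr_mulDl : left_distributive gr_mul +%R.
Proof.
move=> f1 f2 g.
rewrite [in RHS](gr_mulw (fsubsetUl _ (msupp f2)) (fsubset_refl _)).
rewrite [in RHS](gr_mulw (fsubsetUr (msupp f1) _) (fsubset_refl _)).
rewrite (gr_mulw (msuppD_le _ _) (fsubset_refl _)).
rewrite -big_split /=; apply/eq_bigr=> k1 _.
rewrite -big_split /=; apply/eq_bigr=> k2 _.
by rewrite mcoeffD mulrDl monalgUD.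
Qed.

Lemma gr_mulDr : right_distributive gr_mul +%R.
Proof. by move=> f g h; rewrite gr_mulC gr_mulDl !(gr_mulC f). Qed.

Lemma gr_mul0 f : gr_mul 0 f = 0.
Proof. by rewrite /gr_mul msupp0 big_seq_fset0. Qed.

Lemma gr_mulr0 f : gr_mul f 0 = 0.
Proof. by rewrite gr_mulC gr_mul0. Qed.

Lemma gr_mulUU c1 c2 p q :
  gr_mul (mkmalgU p c1) (mkmalgU q c2) = mkmalgU (p * q)%g (c1 * c2).
Proof. by rewrite (gr_mulw msuppU_le msuppU_le) !big_seq_fset1 !mcoeffUU. Qed.

Lemma gr_mul_suml (I : Type) (r : seq I) (F : I -> ZP) g :
  gr_mul (\sum_(i <- r) F i) g = \sum_(i <- r) gr_mul (F i) g.
Proof.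
exact: (big_morph (gr_mul^~ g) (fun _ _ => gr_mulDl _ _ _) (gr_mul0 _)).
Qed.

Lemma gr_mul_sumr (I : Type) (r : seq I) (F : I -> ZP) g :
  gr_mul g (\sum_(i <- r) F i) = \sum_(i <- r) gr_mul g (F i).
Proof.
exact: (big_morph (gr_mul g) (fun _ _ => gr_mulDr _ _ _) (gr_mulr0 _)).
Qed.

Lemma gr_mulA : associative gr_mul.
Proof.
move=> f g h; rewrite (monalgE f) [LHS]gr_mul_suml.
rewrite [X in _ = gr_mul X _]gr_mul_suml [RHS]gr_mul_suml.
apply: eq_bigr => p _; rewrite (monalgE g) [X in gr_mul _ X = _]gr_mul_suml.
rewrite [LHS]gr_mul_sumr [X in _ = gr_mul X _]gr_mul_sumr [RHS]gr_mul_suml.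
apply: eq_bigr => q _; rewrite (monalgE h) [X in gr_mul _ X = _]gr_mul_sumr.
rewrite [LHS]gr_mul_sumr [RHS]gr_mul_sumr.
apply: eq_bigr => r _.
by rewrite !gr_mulUU mulrA monoid.mulgA.
Qed.

Lemma gr_mul1 : left_id gr_one gr_mul.
Proof.
move=> f; rewrite {1}(monalgE f) gr_mul_sumr [RHS]monalgE.
by apply: eq_bigr => p _; rewrite gr_mulUU mul1r monoid.mul1g.
Qed.

Lemma gr_one_neq0 : gr_one != 0.
Proof. by rewrite monalgU_eq0 oner_eq0. Qed.

HB.instance Definition _ := GRing.Zmodule_isComNzRing.Build ZP
  gr_mulA gr_mulC gr_mul1 gr_mulDl gr_one_neq0.


(* A torsion-free abelian group can be ordered on any finite set of elements:
   C plays the role of a cone of nonnegative elements. *)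
Definition cone (C : P -> Prop) :=
  [/\ C 1%g, forall p q, C p -> C q -> C (p * q)%g
    & forall p, C p -> C p^-1%g -> p = 1%g].

Lemma coneX C p k : cone C -> C p -> C (p ^+ k)%g.
Proof.
case=> C1 CM _ Cp; elim: k => [|k IHk]; first by rewrite monoid.expg0.
by rewrite monoid.expgS; apply: CM.
Qed.

Lemma semifield_mulCA p q r : (p * (q * r) = q * (p * r))%g.
Proof. by rewrite !monoid.mulgA (semifield_mulC p). Qed.

Lemma cone_adjoin C p : cone C ->
    (forall k, (0 < k)%N -> ~ C (p ^+ k)^-1%g) ->
  cone (fun r => exists q k, C q /\ r = (q * p ^+ k)%g).
Proof.
move=> [C1 CM CV] Np; split.
- by exists 1%g, 0%N; rewrite monoid.expg0 monoid.mulg1.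
- move=> _ _ [q [k [Cq ->]]] [r [l [Cr ->]]].
  exists (q * r)%g, (k + l)%N; split; first exact: CM.
  by rewrite monoid.expgnDr -!monoid.mulgA (semifield_mulCA r).
move=> _ [q [k [Cq ->]]] [r [l [Cr /eqP]]].
rewrite monoid.invgM semifield_mulC => /eqP e.
have {}e : (p ^+ (k + l))^-1%g = (q * r)%g.
  apply: monoid.mulg1_eq; rewrite monoid.expgnDr.
  rewrite -monoid.mulgA (semifield_mulC (p ^+ l)%g) -[X in (_ * X)%g]monoid.mulgA -e.
  by rewrite monoid.mulVKg monoid.mulgV.
have kl0 : (k + l)%N = 0%N.
  apply/eqP; rewrite -leqn0 leqNgt; apply/negP => /Np; apply.
  by rewrite e; apply: CM.
move: kl0 e => /eqP; rewrite addn_eq0 => /andP[/eqP-> /eqP->].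
rewrite addn0 monoid.expg0 monoid.invg1 monoid.mulg1 => e.
by apply: CV => //; rewrite (monoid.mulg1_eq (esym e)).
Qed.

Lemma cone_total (s : seq P) :
  exists C, cone C /\ forall p, p \in s -> C p \/ C p^-1%g.
Proof.
elim: s => [|p s [C [coneC Cs]]].
  exists (fun q => q = 1%g); split=> //; split=> // _ _ -> ->.
  by rewrite monoid.mulg1.
have adj r : r = p \/ r = p^-1%g ->
    (forall k, (0 < k)%N -> ~ C (r ^+ k)^-1%g) ->
  exists D, cone D /\ forall q, q \in p :: s -> D q \/ D q^-1%g.
  move=> rp Nr; exists (fun r' => exists q k, C q /\ r' = (q * r ^+ k)%g).
  split=> [|q]; first exact: cone_adjoin.
  have inD q' : C q' -> exists q k, C q /\ q' = (q * r ^+ k)%g.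
    by exists q', 0%N; rewrite monoid.expg0 monoid.mulg1.
  have [C1 _ _] := coneC.
  have rD : exists q k, C q /\ r = (q * r ^+ k)%g.
    by exists 1%g, 1%N; rewrite monoid.expg1 monoid.mul1g.
  rewrite inE => /orP[/eqP ->|/Cs[/inD|/inD]]; [|by left|by right].
  by case: rp rD => ->; [left|right].
have [Np|/existsNP[k /not_implyP[k_gt0 /contrapT Ck]]] :=
    pselect (forall k, (0 < k)%N -> ~ C (p ^+ k)^-1%g).
  by apply: (adj p) => //; left.
have [Np|/existsNP[l /not_implyP[l_gt0 /contrapT Cl]]] :=
    pselect (forall k, (0 < k)%N -> ~ C (p^-1 ^+ k)^-1%g).
  by apply: (adj p^-1%g) => //; right.
have p1 : p = 1%g.
  apply: (@semifield_torsion_free _ _ (k * l)%N); first by rewrite muln_gt0 k_gt0.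
  have [_ _ CV] := coneC; apply: CV.
    rewrite mulnC monoid.expgnA; apply: coneX => //.
    by rewrite monoid.expVgn monoid.invgK in Cl.
  by rewrite monoid.expgnA -monoid.expVgn; apply: coneX.
exists C; split=> // q; rewrite inE => /orP[/eqP->|/Cs //].
by left; rewrite p1; case: coneC.
Qed.

Lemma cone_max C (s : seq P) p0 : cone C -> p0 \in s ->
    (forall p q, p \in s -> q \in s -> C (p / q)%g \/ C (p / q)^-1%g) ->
  exists2 p, p \in s & forall q, q \in s -> C (p / q)%g.
Proof.
move=> coneC; have [C1 CM CV] := coneC.
elim: s p0 => // p s IHs p0 _ tot.
have sub q : q \in s -> q \in p :: s by rewrite inE orbC => ->.
case: s IHs tot sub => [|p1 s] IHs tot sub.
  by exists p => [|q]; rewrite !inE // => /eqP->; rewrite monoid.mulgV.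
have [q r qs rs|m ms mP] := IHs p1 (mem_head _ _).
  by apply: tot; apply: sub.
have [Cpm|] := tot p m (mem_head _ _) (sub _ ms).
  exists p => [|q]; rewrite ?mem_head // inE => /orP[/eqP->|qs].
    by rewrite monoid.mulgV.
  by rewrite -(monoid.divgKA m); apply: CM => //; apply: mP.
rewrite monoid.invgF => Cmp; exists m => [|q]; first exact: sub.
by rewrite inE => /orP[/eqP->//|/mP].
Qed.

Lemma gr_integral f g : f * g = 0 -> (f == 0) || (g == 0).
Proof.
move=> fg0; apply/norP => -[f0 g0].
have nz (h : ZP) : h != 0 -> exists p, p \in msupp h.
  move=> h0; have [s0|//] := fset_0Vmem (msupp h); last by case=> p; exists p.
  by case/eqP: h0; rewrite (monalgE h) s0 big_seq_fset0.
have [p0 p0f] := nz _ f0; have [q0 q0g] := nz _ g0.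
pose quot (s : seq P) := [seq (p / q)%g | p <- s, q <- s].
have [C [coneC tot]] := cone_total (quot (msupp f) ++ quot (msupp g)).
have [|p pf pP] := cone_max coneC p0f.
  move=> p q pf qf; apply: tot; rewrite mem_cat; apply/orP; left.
  by apply/allpairsP; exists (p, q).
have [|q qg qP] := cone_max coneC q0g.
  move=> r r' rg r'g; apply: tot; rewrite mem_cat; apply/orP; right.
  by apply/allpairsP; exists (r, r').
have uniq_pq p' q' : p' \in msupp f -> q' \in msupp g ->
    (p' * q' = p * q)%g -> p' = p /\ q' = q.
  move=> p'f q'g e; have [_ _ CV] := coneC.
  have e' : ((p / p')^-1 = q / q')%g.
    rewrite monoid.invgF; apply: (@monoid.mulIg _ q').
    rewrite monoid.mulgVK (semifield_mulC p') -monoid.mulgA e.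
    exact: monoid.mulKg.
  have /monoid.divg1_eq pp' : (p / p' = 1)%g.
    by apply: CV; [exact: pP|rewrite e'; exact: qP].
  split=> //; move: e; rewrite -pp' => /monoid.mulgI; exact.
have : mcoeff (p * q)%g (f * g) = mcoeff p f * mcoeff q g.
  rewrite /GRing.mul /= /gr_mul raddf_sum (big_fsetD1 p) //= raddf_sum.
  rewrite (big_fsetD1 q) //= mcoeffUU !big1_fset ?addr0 //.
    move=> p'; rewrite !inE => /andP[p'p p'f] _.
    rewrite raddf_sum big1_fset // => q' q'g _; rewrite /= mcoeffU.
    by case: eqP => // /(uniq_pq _ _ p'f q'g)[/eqP]; rewrite (negPf p'p).
  move=> q'; rewrite !inE => /andP[q'q q'g] _; rewrite /= mcoeffU.
  by case: eqP => // /(uniq_pq _ _ pf q'g)[_ /eqP]; rewrite (negPf q'q).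
rewrite fg0 mcoeff0 => /esym/eqP.
by rewrite mulf_eq0 !mcoeff_eq0 pf qg.
Qed.

Definition gr_unit f : bool := `[< exists g, g * f == 1 >].

Definition gr_inv f : ZP :=
  if pselect (exists g, g * f == 1) is left e then xchoose e else f.

Lemma gr_mulVf f : gr_unit f -> gr_inv f * f = 1.
Proof.
by move=> /asboolP fu; rewrite /gr_inv; case: pselect => // e; exact/eqP/(xchooseP e).
Qed.

Lemma gr_unitP f g : g * f = 1 -> gr_unit f.
Proof. by move=> gf; apply/asboolP; exists g; apply/eqP. Qed.

Lemma gr_inv_out f : ~~ gr_unit f -> gr_inv f = f.
Proof. by move=> /asboolPn fN; rewrite /gr_inv; case: pselect. Qed.

HB.instance Definition _ := GRing.ComNzRing_hasMulInverse.Build ZP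
  gr_mulVf gr_unitP gr_inv_out.
HB.instance Definition _ := GRing.ComUnitRing_isIntegral.Build ZP gr_integral.
End GroupRing.

Section Ambient.
Variables (n : nat) (P : semifieldType).
Import mpoly.

Definition coef_field : fieldType := {fraction (group_ring P)}.

Definition ambient : fieldType := {fraction {mpoly coef_field[n]}}.

Definition of_coef (c : coef_field) : ambient := tofrac (mpolyC n c).

Definition of_semifield (p : P) : ambient :=
  of_coef (tofrac (monalg.mkmalgU p 1 : group_ring P)).

Implicit Type x : {ffun 'I_n -> ambient}.

Definition eval_at x (f : {mpoly coef_field[n]}) : ambient := mmap of_coef x f.

Definition algebraically_independent x : Prop :=
  forall f, eval_at x f = 0 -> f = 0.

Definition in_generated_field x (u : ambient) : Prop :=
  exists f g, eval_at x g != 0 /\ u = eval_at x f / eval_at x g.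

Definition transcendence_basis x : Prop :=
  algebraically_independent x /\
  forall u : ambient, exists q : {poly ambient},
    [/\ q != 0, forall i, in_generated_field x q`_i & root q u].

End Ambient.

(* As B is an integer matrix, clearing denominators shows that it does not
   matter whether D is rational or integral; a real D gives nothing more, since
   the ratios d i / d j are rational along each connected component of B. *)
Definition skew_symmetrizable n (B : 'M[int]_n) : Prop :=
  exists d : 'rV[rat]_n, (forall i, 0 < d 0 i) /\
    let DB := diag_mx d *m map_mx intr B in DB^T = - DB.

Record seed (n : nat) (P : semifieldType) := Seed {
  cluster : {ffun 'I_n -> ambient n P};
  coefficients : {ffun 'I_n -> P};
  exchange_matrix : 'M[int]_n
}.

Section Seeds.
Variables (n : nat) (P : semifieldType).
Implicit Types (S : seed n P) (k : 'I_n).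

(* [seed] only carries the data, so that mutation is a total function; the
   conditions below are imposed on the initial seed and are inherited by all
   of its mutations. *)
Definition is_seed S : Prop :=
  transcendence_basis (cluster S) /\ skew_symmetrizable (exchange_matrix S).

Definition mutate_cluster S k : {ffun 'I_n -> ambient n P} :=
  let x := cluster S in let B := exchange_matrix S in
  let yk := coefficients S k in
  [ffun i => if i == k then
     (of_semifield n (yk / oplus yk 1)%g * \prod_(j < n | 0 < B k j) x j ^ B k j
      + of_semifield n (oplus yk 1)^-1%g
          * \prod_(j < n | B k j < 0) x j ^ (- B k j)) / x k
   else x i].

Definition mutate_coefficients S k : {ffun 'I_n -> P} :=
  let y := coefficients S in let B := exchange_matrix S in
  let yk1 := oplus (y k) 1%g in
  [ffun j => (if j == k then (y k)^-1
    else if (0 < B j k)%R then y j * expgz (y k) (B j k) * expgz yk1 (- B j k)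
    else y j * expgz yk1 (- B j k))%g].

(* The integer division below is exact.  The exchange matrix is the transpose of
   the one of Fomin and Zelevinsky. *)
Definition mutate_matrix (B : 'M[int]_n) k : 'M[int]_n :=
  \matrix_(i, j) if (i == k) || (j == k) then - B i j
    else B i j + ((`|B i k| * B k j + B i k * `|B k j|) %/ 2)%Z.

Definition mutate S k : seed n P :=
  Seed (mutate_cluster S k) (mutate_coefficients S k)
       (mutate_matrix (exchange_matrix S) k).

Definition mutation_equivalent S S' : Prop :=
  exists ks : seq 'I_n, S' = foldl mutate S ks.

Definition related_by (s : 'S_n) S1 S2 : Prop :=
  [/\ forall i, cluster S2 i = cluster S1 (s i),
      forall i, coefficients S2 i = coefficients S1 (s i)
    & forall i j, exchange_matrix S2 i j = exchange_matrix S1 (s i) (s j)].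

Definition seed_equivalent S1 S2 : Prop := exists s : 'S_n, related_by s S1 S2.

Definition unordered_cluster S : {fset ambient n P} :=
  [fset cluster S i | i in 'I_n].

Lemma seed_equivalent_refl S : seed_equivalent S S.
Proof. by exists 1%g; split=> *; rewrite !perm1. Qed.

Lemma seed_equivalent_sym S1 S2 : seed_equivalent S1 S2 -> seed_equivalent S2 S1.
Proof.
by move=> [s [ex ey eB]]; exists s^-1%g; split=> *; rewrite ?ex ?ey ?eB !permKV.
Qed.

Lemma seed_equivalent_trans S1 S2 S3 :
  seed_equivalent S1 S2 -> seed_equivalent S2 S3 -> seed_equivalent S1 S3.
Proof.
move=> [s [ex ey eB]] [t [fx fy fB]]; exists (t * s)%g.
by split=> *; rewrite ?fx ?fy ?fB ?ex ?ey ?eB !permM.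
Qed.

Lemma unordered_cluster_equivalent S1 S2 :
  seed_equivalent S1 S2 -> unordered_cluster S1 = unordered_cluster S2.
Proof.
move=> [s [ex _ _]]; apply/fsetP => u; apply/imfsetP/imfsetP => -[i _ ->].
  by exists (s^-1 i)%g; rewrite // ex permKV.
by exists (s i); rewrite // ex.
Qed.

End Seeds.

(* The n-regular tree with edges labelled by 'I_n, rooted at [::]: the vertex
   w is the endpoint of the non-backtracking path from the root whose
   successive labels are the letters of w. *)
Definition regular_tree (n : nat) : Type :=
  {w : seq 'I_n | sorted (fun i j => i != j) w}.

HB.instance Definition _ n := Choice.on (regular_tree n).

Definition tree_edge n (k : 'I_n) (v w : regular_tree n) : Prop :=
  val w = rcons (val v) k \/ val v = rcons (val w) k.

Section ExchangeGraph.
Variables (n : nat) (P : semifieldType) (S : seed n P).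
Implicit Types (v w : regular_tree n) (C : {fset ambient n P}).

Definition seed_at v : seed n P := foldl (@mutate n P) S (val v).

Definition vertex_equiv v w : bool := `[< seed_equivalent (seed_at v) (seed_at w) >].

Lemma vertex_equiv_refl : reflexive vertex_equiv.
Proof. by move=> v; apply/asboolP/seed_equivalent_refl. Qed.

Lemma vertex_equiv_sym : symmetric vertex_equiv.
Proof. by move=> v w; apply: asbool_equiv_eq; split; apply: seed_equivalent_sym. Qed.

Lemma vertex_equiv_trans : transitive vertex_equiv.
Proof.
move=> w v u /asboolP vw /asboolP wu.
by apply/asboolP/(seed_equivalent_trans vw).
Qed.

Canonical vertex_equivRel :=
  EquivRel vertex_equiv vertex_equiv_refl vertex_equiv_sym vertex_equiv_trans.

Definition exchange_graph : Type := {eq_quot vertex_equivRel}.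

HB.instance Definition _ := Choice.on exchange_graph.
HB.instance Definition _ := EqQuotient.on exchange_graph.

Definition adjacent (a b : exchange_graph) : Prop :=
  exists k v w, [/\ a = \pi v, b = \pi w & tree_edge k v w].

Definition vertex_cluster (a : exchange_graph) : {fset ambient n P} :=
  unordered_cluster (seed_at (repr a)).

Lemma vertex_cluster_pi v : vertex_cluster (\pi v) = unordered_cluster (seed_at v).
Proof.
apply: unordered_cluster_equivalent; apply/asboolP.
by rewrite -/(vertex_equiv _ _); apply/eqmodP; rewrite reprK.
Qed.

(* A cluster algebra is given by its initial seed S, on which its seeds,
   clusters and exchange graph depend. *)
Definition is_cluster C : Prop :=
  exists S', mutation_equivalent S S' /\ C = unordered_cluster S'.

Definition clusters_adjacent C C' : Prop :=
  exists a b, [/\ vertex_cluster a = C, vertex_cluster b = C' & adjacent a b].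

Definition seeds_defined_by_clusters : Prop :=
  forall S1 S2 (s : 'S_n), mutation_equivalent S S1 -> mutation_equivalent S S2 ->
    (forall i, cluster S2 i = cluster S1 (s i)) -> related_by s S1 S2.

End ExchangeGraph.

(* Main.v *)
Require Import Defs.
From HB Require Import structures.
From mathcomp Require Import all_boot all_order all_algebra fingroup perm.
From mathcomp Require Import generic_quotient fraction finmap.
From mathcomp Require Import boolp ring zify.
From mathcomp.multinomials Require monalg mpoly.

(** If two clusters are adjacent, the variable of one that is replaced in the
    other is really a new one: the product of the two is a binomial in the
    remaining variables, while the square of a variable is of degree 2 in it. So
    the clusters share all variables but one.

    The converse rests on [shared_variables]. Let [x] and [x'] be clusters with
    [x'_l = x_l] for all [l != i], and let [z_i] be the variable exchanged with
    [x_i] in direction [i]; then [x'_i] is [x_i] or [z_i]. Indeed, by the Laurent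
    phenomenon, [x'_i] and the variable exchanged with it from [x'] are Laurent
    polynomials in [x]. Their product is a binomial in the shared variables, of
    degree 0 in [x_i]; as factors of a homogeneous Laurent polynomial are
    homogeneous, [x'_i = x_i^m E] where [E] is a Laurent polynomial in the shared
    variables. In the same way [x_i = x'_i^m' E'], which forces [m m' = 1].
    - If [m = 1], then [E] is invertible, that is, a monomial up to sign, with a
      coefficient in the semifield. Every cluster variable is a quotient of
      subtraction-free expressions, and these can be evaluated in the semifield
      itself, at the point where the variables of [x] are 1. The exchange
      relations are normalized so that all cluster variables take the value 1;
      this shows that the sign is positive and the coefficient 1 (section
      SubtractionFree). If [E] contained a negative power of a variable [x_j],
      then [x'_i] could not be a Laurent polynomial in the cluster obtained from
      [x] by exchanging [x_j], where [x_j] is a binomial, not invertible, divided by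
      a variable ([laurent_exponent_ge0]); positive powers are excluded by
      symmetry. Hence [x'_i = x_i].
    - If [m = -1], the same applies to [x'] and the neighbour of [x] in direction
      [i], which shares the same variables with [x']. So [x'_i = z_i], or both
      [x_i x'_i] and [z_i x'_i] are of degree 0 in [x_i]; the latter contradicts
      that [x_i z_i] is of degree 0 too.

    The Laurent phenomenon ([laurent_phenomenon]) is proved for a universal seed,
    whose variables and coefficients are independent, by induction on the number
    of mutations, along the lines of Fomin and Zelevinsky: one expansion
    shows that only powers of the first exchange binomial can be denominators, and
    another one, in the cluster reached by mutating at [i], [j] and [i], that
    nothing becomes infinite where this binomial vanishes. Instead of coprimality
    of polynomials, places are used to express that quantities are finite and not
    zero somewhere. Specialization, which is another place, extends the result to
    all seeds.

    It remains to pass from indexed families to sets of variables, and from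
    sequences of mutations to vertices of the regular tree. *)

Set Implicit Arguments.
Unset Strict Implicit.
Unset Printing Implicit Defensive.

Import Order.TTheory GRing.Theory Num.Theory.
Local Open Scope quotient_scope.
Local Open Scope fset_scope.
Local Open Scope ring_scope.

(** * Group rings *)

Section GroupRingMaps.
Import monalg.

Record character (P : semifieldType) (R : comNzRingType) := Character {
  char_fun :> P -> R;
  char1 : char_fun 1%g = 1;
  charM : forall p q, char_fun (p * q)%g = char_fun p * char_fun q }.

Definition mon (P : semifieldType) (p : P) : group_ring P := mkmalgU p 1.

Definition gmap (P : semifieldType) (R : comNzRingType) (phi : character P R)
    (f : group_ring P) : R :=
  \sum_(p <- msupp f) (mcoeff p f)%:~R * phi p.

Variables (P : semifieldType) (R : comNzRingType) (phi : character P R).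
Implicit Types (f g : group_ring P) (p q : P).

Lemma gmapw (d : {fset P}) f : msupp f `<=` d ->
  gmap phi f = \sum_(p <- d) (mcoeff p f)%:~R * phi p.
Proof.
move=> le; rewrite /gmap; apply: big_fset_incl => // p _ /mcoeff_outdom ->.
by rewrite mul0r.
Qed.

Lemma gmapU p c : gmap phi (mkmalgU p c) = c%:~R * phi p.
Proof. by rewrite (gmapw msuppU_le) big_seq_fset1 mcoeffUU. Qed.

Lemma gmap_is_additive : zmod_morphism (gmap phi).
Proof.
move=> f g; have le1 : msupp (f - g) `<=` msupp f `|` msupp g by apply: msuppB_le.
rewrite (gmapw le1) (gmapw (fsubsetUl _ (msupp g))) (gmapw (fsubsetUr (msupp f) _)).
by rewrite -sumrB; apply: eq_bigr => p _; rewrite mcoeffB rmorphB mulrBl.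
Qed.

HB.instance Definition _ :=
  GRing.isZmodMorphism.Build (group_ring P) R (gmap phi) gmap_is_additive.

Lemma gmap_is_monoid_morphism : monoid_morphism (gmap phi).
Proof.
split=> [|f g]; first by rewrite gmapU char1 mulr1.
rewrite {1}/GRing.mul /= /gr_mul raddf_sum /= [RHS]mulr_suml.
apply: eq_bigr => p _; rewrite raddf_sum /= mulr_sumr; apply: eq_bigr => q _.
by rewrite gmapU charM rmorphM; ring.
Qed.

HB.instance Definition _ :=
  GRing.isMonoidMorphism.Build (group_ring P) R (gmap phi) gmap_is_monoid_morphism.

Lemma gmap0 : gmap phi 0 = 0. Proof. exact: raddf0. Qed.

Lemma gmap_mon p : gmap phi (mon p) = phi p.
Proof. by rewrite gmapU mul1r. Qed.

End GroupRingMaps.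

Section GroupRing.
Import monalg.
Variable P : semifieldType.
Implicit Types (f g : group_ring P) (p q : P).

Lemma mon1 : mon (1%g : P) = 1. Proof. by []. Qed.

Lemma monM p q : mon (p * q)%g = mon p * mon q.
Proof. by rewrite /mon [RHS]gr_mulUU mulr1. Qed.

Lemma mon_inj : injective (@mon P).
Proof.
move=> p q /(congr1 (mcoeff p)); rewrite mcoeffUU mcoeffU.
by case: eqP => // _ /eqP; rewrite oner_eq0.
Qed.

Lemma mon_unit p : mon p \is a GRing.unit.
Proof.
by apply/unitrPr; exists (mon p^-1%g); rewrite -monM monoid.mulgV.
Qed.

Lemma mon_neq0 p : mon p != 0.
Proof. by rewrite /mon monalgU_eq0 oner_eq0. Qed.

Lemma mkmalgU_mon p (c : int) : mkmalgU p c = c%:~R * mon p.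
Proof.
rewrite /mon; case: c => k; rewrite ?NegzE ?mulrNz -?pmulrn ?mulNr mulr_natl.
  by rewrite -monalgUMn natz.
by rewrite -monalgUMn natz monalgUN.
Qed.

(** Every element is an integral combination of group elements. *)
Lemma group_ring_ind (Q : group_ring P -> Prop) :
    Q 0 -> (forall f g, Q f -> Q g -> Q (f + g)) ->
    (forall f, Q f -> Q (- f)) -> (forall p, Q (mon p)) ->
  forall f, Q f.
Proof.
move=> Q0 QD QN Qm f; rewrite (monalgE f).
apply: (big_ind Q) => // p _; rewrite mkmalgU_mon.
have Qn k : Q (k%:R * mon p).
  by elim: k => [|k IH]; rewrite ?mul0r // mulrS mulrDl mul1r; apply: QD.
case: (mcoeff p f) => k; first exact: Qn.
by rewrite NegzE mulrNz mulNr; apply/QN/Qn.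
Qed.

Lemma mcoeff_sum (I : Type) (r : seq I) (F : I -> group_ring P) p :
  mcoeff p (\sum_(i <- r) F i) = \sum_(i <- r) mcoeff p (F i).
Proof. by elim/big_rec2: _ => [|i u v _ <-]; rewrite ?mcoeff0 ?mcoeffD. Qed.

Definition one_char : character P int := @Character P int (fun _ => 1) erefl (fun _ _ => erefl).

Definition aug : group_ring P -> int := gmap one_char.
HB.instance Definition _ := GRing.RMorphism.on aug.

Lemma aug_mon p : aug (mon p) = 1. Proof. exact: gmap_mon. Qed.

Lemma aug0 : aug 0 = 0. Proof. exact: rmorph0. Qed.
Lemma aug1 : aug 1 = 1. Proof. exact: rmorph1. Qed.
Lemma augD : {morph aug : f g / f + g}. Proof. exact: rmorphD. Qed.
Lemma augM : {morph aug : f g / f * g}. Proof. exact: rmorphM. Qed.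

Lemma msupp_mon p : msupp (mon p) = [fset p].
Proof. by rewrite /mon msuppU oner_eq0. Qed.

Lemma msupp_neq0 f : f != 0 -> exists p, p \in msupp f.
Proof.
move=> f0; have [s0|//] := fset_0Vmem (msupp f); last by case=> p; exists p.
by case/eqP: f0; rewrite (monalgE f) s0 big_seq_fset0.
Qed.

Definition total_on (C : P -> Prop) f :=
  forall p q, p \in msupp f -> q \in msupp f -> C (p / q)%g \/ C (p / q)^-1%g.

(** The product of the two extremal elements arises from no other pair of
    elements of the supports, so that its coefficient cannot cancel. *)
Lemma extremal_product C f g : cone C -> total_on C f -> total_on C g ->
    f != 0 -> g != 0 ->
  exists p q, [/\ p \in msupp f, q \in msupp g, (p * q)%g \in msupp (f * g),
    forall p', p' \in msupp f -> C (p / p')%g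
    & forall q', q' \in msupp g -> C (q / q')%g].
Proof.
move=> coneC tf tg /msupp_neq0[p0 p0f] /msupp_neq0[q0 q0g].
have [p pf pP] := cone_max coneC p0f tf; have [q qg qP] := cone_max coneC q0g tg.
exists p, q; split=> //; have [_ _ CV] := coneC.
have uniq_pq p' q' : p' \in msupp f -> q' \in msupp g ->
    (p' * q' = p * q)%g -> p' = p /\ q' = q.
  move=> p'f q'g e.
  have e' : ((p / p')^-1 = q / q')%g.
    rewrite monoid.invgF; apply: (@monoid.mulIg _ q').
    by rewrite monoid.mulgVK (semifield_mulC p') -monoid.mulgA e monoid.mulKg.
  have /monoid.divg1_eq pp' : (p / p' = 1)%g.
    by apply: CV; [exact: pP|rewrite e'; exact: qP].
  by split=> //; move: e; rewrite -pp' => /monoid.mulgI.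
rewrite -mcoeff_neq0 {1}/GRing.mul /= (gr_mulw (fsubset_refl _) (fsubset_refl _)).
rewrite (big_fsetD1 p) //= (big_fsetD1 q) //= !raddfD /= mcoeffUU.
rewrite raddf_sum big1_fset => [|q']; last first.
  rewrite !inE => /andP[q'q q'g] _; rewrite /= mcoeffU.
  by case: eqP => // /(uniq_pq _ _ pf q'g)[_ /eqP]; rewrite (negPf q'q).
rewrite raddf_sum big1_fset ?addr0 ?mulf_eq0 => [|p'].
  by rewrite negb_or !mcoeff_neq0 pf.
rewrite !inE => /andP[p'p p'f] _.
rewrite raddf_sum big1_fset // => q' q'g _; rewrite /= mcoeffU.
by case: eqP => // /(uniq_pq _ _ p'f q'g)[/eqP]; rewrite (negPf p'p).
Qed.

Lemma total_cone f g : exists C, [/\ cone C, total_on C f & total_on C g].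
Proof.
pose quot (s : seq P) := [seq (p / q)%g | p <- s, q <- s].
have [C [coneC tot]] := cone_total (quot (msupp f) ++ quot (msupp g)).
exists C; split=> // p q pf qf; apply: tot; rewrite mem_cat; apply/orP.
  by left; apply/allpairsP; exists (p, q).
by right; apply/allpairsP; exists (p, q).
Qed.

(** Products of extremal elements survive in [f * g = 1], for an order and for
    the opposite one. Hence the greatest and the least element of the support
    of [f] coincide, and the augmentation shows that the coefficient is
    invertible. *)
Lemma group_ring_unit f g : f * g = 1 ->
  exists p, f = mon p \/ f = - mon p.
Proof.
move=> fg1; have f0 : f != 0.
  by apply: contra_eq_neq fg1 => ->; rewrite mul0r eq_sym oner_eq0.
have g0 : g != 0 by apply: contra_eq_neq fg1 => ->; rewrite mulr0 eq_sym oner_eq0.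
have [C [coneC tf tg]] := total_cone f g; have [C1 CM CV] := coneC.
have coneC' : cone (fun p => C p^-1%g).
  split=> [|p q Cp Cq|p Cp Cp']; first by rewrite monoid.invg1.
    by rewrite monoid.invgM; apply: CM.
  by rewrite monoid.invgK in Cp'; apply: CV.
have tot' h : total_on C h -> total_on (fun p => C p^-1%g) h.
  by move=> th p q ph qh; case: (th p q ph qh); [right; rewrite monoid.invgK|left].
have [p [q [pf qg pq pP qP]]] := extremal_product coneC tf tg f0 g0.
have [r [s [rf sg rs rP sP]]] := extremal_product coneC' (tot' _ tf) (tot' _ tg) f0 g0.
have one u : u \in msupp (f * g) -> u = 1%g.
  by rewrite fg1 -mon1 msupp_mon inE => /eqP.
have e1 := one _ pq; have e2 := one _ rs.
have pr : p = r.
  apply/monoid.divg1_eq/CV; first exact: pP.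
  have -> : ((p / r)^-1 = q / s)%g; last exact: qP.
  rewrite monoid.invgF; apply: (@monoid.mulIg _ s).
  rewrite monoid.mulgVK (semifield_mulC r) -monoid.mulgA e2 monoid.mulg1.
  by rewrite (monoid.mulg1_eq e1).
have sing u : u \in msupp f -> u = p.
  move=> uf; apply/esym/monoid.divg1_eq/CV; first exact: pP.
  by rewrite pr; apply: rP.
have mf : msupp f = [fset p].
  by apply/fsetP => u; rewrite inE; apply/idP/eqP => [/sing|->].
have ff : f = (mcoeff p f)%:~R * mon p.
  by rewrite {1}(monalgE f) mf big_seq_fset1 mkmalgU_mon.
have : aug f * aug g = 1 by rewrite -rmorphM fg1 rmorph1.
rewrite ff rmorphM rmorph_int /= aug_mon mulr1 intz => cg1.
have /eqP : (`|mcoeff p f| * `|aug g|)%N = 1%N by rewrite -abszM cg1.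
rewrite muln_eq1 => /andP[/eqP c1 _].
have [c|c] : mcoeff p f = 1 \/ mcoeff p f = -1 by lia.
  by exists p; left; rewrite c mulr1z mul1r.
by exists p; right; rewrite c mulrN1z mulN1r.
Qed.

(** The grading is refined by a total order on the supports, whose extremal
    elements are of highest degree and cannot cancel in the product. *)
Lemma top_degree (delta : P -> int) f g :
    (forall p q, delta (p * q)%g = delta p + delta q) -> f != 0 -> g != 0 ->
  exists p q, [/\ p \in msupp f, q \in msupp g, (p * q)%g \in msupp (f * g),
    forall p', p' \in msupp f -> delta p' <= delta p
    & forall q', q' \in msupp g -> delta q' <= delta q].
Proof.
move=> dM f0 g0; have [C [coneC tf tg]] := total_cone f g.
have [C1 CM CV] := coneC.
have d1 : delta 1%g = 0.
  by apply: (@addrI _ (delta 1%g)); rewrite -dM monoid.mul1g addr0.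
have dV p : delta p^-1%g = - delta p.
  by apply/eqP; rewrite -subr_eq0 opprK -dM monoid.mulVg d1.
pose D p := (0 < delta p) \/ (delta p = 0 /\ C p).
have coneD : cone D.
  split=> [|p q Dp Dq|p Dp Dp']; first by right.
    rewrite /D dM; case: Dp => [dp|[dp Cp]]; case: Dq => [dq|[dq Cq]].
    - by left; apply: addr_gt0.
    - by left; rewrite dq addr0.
    - by left; rewrite dp add0r.
    - by right; rewrite dp dq; split=> //; apply: CM.
  rewrite /D dV in Dp'; case: Dp Dp' => [dp|[dp Cp]] [dq|[dq Cq]]; last exact: CV.
  - by move: dp; rewrite -oppr_lt0 ltNge ltW.
  - by move: dq dp => /eqP; rewrite oppr_eq0 => /eqP->; rewrite ltxx.
  - by move: dq; rewrite dp oppr0 ltxx.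
have totD h : total_on C h -> total_on D h.
  move=> th p q ph qh; rewrite /D dV.
  have [dp|dp|dp] := ltgtP (delta (p / q)%g) 0.
  - by right; left; rewrite oppr_gt0.
  - by left; left.
  - by rewrite dp oppr0; case: (th p q ph qh) => ?; [left|right]; right.
have leD p q : D (p / q)%g -> delta q <= delta p.
  by case=> [|[]]; rewrite dM dV; [rewrite subr_gt0 => /ltW|move/subr0_eq->].
have [p [q [pf qg pq pP qP]]] := extremal_product coneD (totD _ tf) (totD _ tg) f0 g0.
by exists p, q; split=> // r ?; apply: leD; [apply: pP|apply: qP].
Qed.

(** Both the highest and the lowest degrees of two factors of an element of
    degree 0 add up to 0, which leaves no room between them. *)
Lemma homogeneous_factor (delta : P -> int) f g :
    (forall p q, delta (p * q)%g = delta p + delta q) -> f * g != 0 ->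
    (forall p, p \in msupp (f * g) -> delta p = 0) ->
  exists m, forall p, p \in msupp f -> delta p = m.
Proof.
move=> dM; rewrite mulf_eq0 negb_or => /andP[f0 g0] d0.
have [p [q [pf qg /d0 pq pP qP]]] := top_degree dM f0 g0.
have dM' u v : (- delta (u * v)%g) = - delta u + - delta v by rewrite dM opprD.
have [r [s [rf sg /d0 rs rP sP]]] := @top_degree (fun u => - delta u) _ _ dM' f0 g0.
exists (delta p) => u uf; move: (pP u uf) (rP u uf) (qP s sg).
move: pq rs; rewrite !dM; lia.
Qed.

End GroupRing.

Section GroupRingComposition.
Import monalg.
Variables (P Q : semifieldType) (R : comNzRingType).

Lemma eq_gmap (phi psi : character P R) f : phi =1 psi -> gmap phi f = gmap psi f.
Proof. by move=> e; apply: eq_bigr => p _; rewrite e. Qed.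

Definition mon_char : character P (group_ring P) :=
  Character (@mon1 P) (@monM P).

Lemma gmap_id f : gmap mon_char f = f.
Proof.
by rewrite [RHS]monalgE; apply: eq_bigr => p _; rewrite mkmalgU_mon.
Qed.

Variables (phi : character P (group_ring Q)) (psi : character Q R).

Lemma comp_char1 : gmap psi (phi 1%g) = 1. Proof. by rewrite char1 rmorph1. Qed.

Lemma comp_charM p q : gmap psi (phi (p * q)%g) = gmap psi (phi p) * gmap psi (phi q).
Proof. by rewrite charM rmorphM. Qed.

Definition comp_char : character P R := Character comp_char1 comp_charM.

Lemma gmap_comp f : gmap psi (gmap phi f) = gmap comp_char f.
Proof.
by rewrite {2}/gmap raddf_sum; apply: eq_bigr => p _; rewrite /= rmorphM /= rmorph_int.
Qed.

End GroupRingComposition.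

(** * Laurent monomials *)

(** Serves both as the group of exponents of Laurent monomials and as the group
    of coefficients of the universal seed. *)
Definition trop (n : nat) := {ffun 'I_n -> int}.

HB.instance Definition _ n := Choice.on (trop n).

Section Trop.
Variable n : nat.
Implicit Types a b c : trop n.

Definition trop_one : trop n := [ffun _ => 0].
Definition trop_inv a : trop n := [ffun i => - a i].
Definition trop_mul a b : trop n := [ffun i => a i + b i].
Definition trop_min a b : trop n := [ffun i => Num.min (a i) (b i)].

Lemma trop_mulA : associative trop_mul.
Proof. by move=> a b c; apply/ffunP => i; rewrite !ffunE addrA. Qed.
Lemma trop_mulC : commutative trop_mul.
Proof. by move=> a b; apply/ffunP => i; rewrite !ffunE addrC. Qed.
Lemma trop_mul1 : left_id trop_one trop_mul.
Proof. by move=> a; apply/ffunP => i; rewrite !ffunE add0r. Qed.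
Lemma trop_mulr1 : right_id trop_one trop_mul.
Proof. by move=> a; rewrite trop_mulC trop_mul1. Qed.
Lemma trop_mulV : left_inverse trop_one trop_inv trop_mul.
Proof. by move=> a; apply/ffunP => i; rewrite !ffunE addNr. Qed.
Lemma trop_mulrV : right_inverse trop_one trop_inv trop_mul.
Proof. by move=> a; rewrite trop_mulC trop_mulV. Qed.

HB.instance Definition _ := monoid.isGroup.Build (trop n)
  trop_mulA trop_mul1 trop_mulr1 trop_mulV trop_mulrV.

Lemma tropE : ((1%g : trop n) = trop_one) *
  (forall a b, (a * b)%g = trop_mul a b) * (forall a, (a^-1)%g = trop_inv a).
Proof. by []. Qed.

Lemma trop_expE a k i : (a ^+ k)%g i = a i *+ k.
Proof.
elim: k => [|k IH]; first by rewrite monoid.expg0 tropE ffunE.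
by rewrite monoid.expgS tropE ffunE IH mulrS.
Qed.

Lemma trop_torsion_free a k : (0 < k)%N -> (a ^+ k = 1)%g -> a = 1%g.
Proof.
move=> k0 ak; apply/ffunP => i; have := trop_expE a k i.
by rewrite ak tropE !ffunE => /esym/eqP; rewrite mulrn_eq0 gtn_eqF //= => /eqP.
Qed.

Lemma trop_minC : commutative trop_min.
Proof. by move=> a b; apply/ffunP => i; rewrite !ffunE minC. Qed.
Lemma trop_minA : associative trop_min.
Proof. by move=> a b c; apply/ffunP => i; rewrite !ffunE minA. Qed.
Lemma trop_minM : left_distributive (@monoid.mul (trop n)) trop_min.
Proof.
by move=> a b c; apply/ffunP => i; rewrite !tropE !ffunE addr_minl.
Qed.

HB.instance Definition _ := Group_isSemifield.Build (trop n)
  trop_mulC trop_torsion_free trop_minC trop_minA trop_minM.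

Definition trop_unit (i : 'I_n) : trop n := [ffun j => (j == i)%:Z].

End Trop.

Definition lmon (P : semifieldType) (n : nat) := (P * trop n)%type.

HB.instance Definition _ P n := Choice.on (lmon P n).

Section LaurentMonomials.
Variables (P : semifieldType) (n : nat).
Local Notation G := (lmon P n).
Implicit Types g h : G.

Definition lmon_one : G := (1, 1)%g.
Definition lmon_inv g : G := (g.1^-1, g.2^-1)%g.
Definition lmon_mul g h : G := (g.1 * h.1, g.2 * h.2)%g.
(** Group rings are formed over semifields, so that the group of Laurent
    monomials has to be one. *)
Definition lmon_oplus g h : G := (oplus g.1 h.1, oplus g.2 h.2).

Lemma lmon_mulA : associative lmon_mul.
Proof. by move=> f g h; rewrite /lmon_mul !monoid.mulgA. Qed.
Lemma lmon_mulC : commutative lmon_mul.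
Proof. by move=> f g; congr pair; apply: semifield_mulC. Qed.
Lemma lmon_mul1 : left_id lmon_one lmon_mul.
Proof. by case=> p a; rewrite /lmon_mul /= !monoid.mul1g. Qed.
Lemma lmon_mulr1 : right_id lmon_one lmon_mul.
Proof. by case=> p a; rewrite /lmon_mul /= !monoid.mulg1. Qed.
Lemma lmon_mulV : left_inverse lmon_one lmon_inv lmon_mul.
Proof. by case=> p a; rewrite /lmon_mul /= !monoid.mulVg. Qed.
Lemma lmon_mulrV : right_inverse lmon_one lmon_inv lmon_mul.
Proof. by case=> p a; rewrite /lmon_mul /= !monoid.mulgV. Qed.

HB.instance Definition _ := monoid.isGroup.Build G
  lmon_mulA lmon_mul1 lmon_mulr1 lmon_mulV lmon_mulrV.

Lemma lmon_expE g k : (g ^+ k)%g = (g.1 ^+ k, g.2 ^+ k)%g.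
Proof. by elim: k => [|k IH] //; rewrite !monoid.expgS IH. Qed.

Lemma lmon_torsion_free g k : (0 < k)%N -> (g ^+ k = 1)%g -> g = 1%g.
Proof.
move=> k0; case: g => p a; rewrite lmon_expE => -[].
by do 2 move=> /(@semifield_torsion_free _ _ _ k0) ->.
Qed.

Lemma lmon_oplusC : commutative lmon_oplus.
Proof. by move=> g h; congr pair; apply: oplusC. Qed.
Lemma lmon_oplusA : associative lmon_oplus.
Proof. by move=> f g h; congr pair; apply: oplusA. Qed.
Lemma lmon_oplusM : left_distributive (@monoid.mul G) lmon_oplus.
Proof. by move=> f g h; congr pair; apply: mulg_oplusl. Qed.

HB.instance Definition _ := Group_isSemifield.Build G
  lmon_mulC lmon_torsion_free lmon_oplusC lmon_oplusA lmon_oplusM.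

End LaurentMonomials.

(** The coefficient and the exponents of a Laurent monomial are all that is used
    of the group of Laurent monomials. *)
Record laurent_group (P : semifieldType) (n : nat) := LaurentGroup {
  lgroup :> semifieldType;
  lmk : P -> trop n -> lgroup;
  lcoef : lgroup -> P;
  lexp : lgroup -> trop n;
  lmkK : forall g, lmk (lcoef g) (lexp g) = g;
  lcoef_mk : forall p a, lcoef (lmk p a) = p;
  lexp_mk : forall p a, lexp (lmk p a) = a;
  lmkM : forall p q a b, lmk (p * q)%g (a * b)%g = (lmk p a * lmk q b)%g }.

Definition lmon_group P n : laurent_group P n.
Proof.
refine (@LaurentGroup P n (lmon P n) (fun p a => (p, a)) fst snd _ _ _ _) => //.
by case.
Defined.

Section LaurentGroup.
Variables (P : semifieldType) (n : nat) (G : laurent_group P n).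
Implicit Types g h : G.

Lemma lcoefM g h : lcoef (g * h)%g = (lcoef g * lcoef h)%g.
Proof. by rewrite -{1}(lmkK g) -{1}(lmkK h) -lmkM lcoef_mk. Qed.

Lemma lexpM g h : lexp (g * h)%g = (lexp g * lexp h)%g.
Proof. by rewrite -{1}(lmkK g) -{1}(lmkK h) -lmkM lexp_mk. Qed.

Lemma lcoef1 : lcoef (1%g : G) = 1%g.
Proof.
by apply: (@monoid.mulgI _ (lcoef (1%g : G))); rewrite -lcoefM !monoid.mulg1.
Qed.

Lemma lexp1 : lexp (1%g : G) = 1%g.
Proof.
by apply: (@monoid.mulgI _ (lexp (1%g : G))); rewrite -lexpM !monoid.mulg1.
Qed.

Lemma lmk1 : lmk G 1%g 1%g = 1%g.
Proof. by rewrite -lcoef1 -lexp1 lmkK. Qed.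

Lemma lmkV p a : (lmk G p a)^-1%g = lmk G p^-1%g a^-1%g.
Proof. by apply: monoid.mulg1_eq; rewrite -lmkM !monoid.mulgV lmk1. Qed.

Definition lX (i : 'I_n) : G := lmk G 1%g (trop_unit i).

End LaurentGroup.

Section Evaluation.
Variables (n : nat) (R : comUnitRingType).
Implicit Types (x : 'I_n -> R) (a b : trop n).

(** Replacing the non-units by 1 makes evaluation of Laurent polynomials total. *)
Definition unit_or_1 (v : R) := if v \is a GRing.unit then v else 1.

Lemma unit_or_1_unit v : unit_or_1 v \is a GRing.unit.
Proof. by rewrite /unit_or_1; case: ifP => // _; apply: unitr1. Qed.

Lemma unit_or_1_id v : v \is a GRing.unit -> unit_or_1 v = v.
Proof. by rewrite /unit_or_1 => ->. Qed.

Definition zprod x (a : 'I_n -> int) : R := \prod_(i < n) x i ^ a i.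

Lemma zprodD x a b : (forall i, x i \is a GRing.unit) ->
  zprod x (fun i => a i + b i) = zprod x a * zprod x b.
Proof.
by move=> ux; rewrite -big_split; apply: eq_bigr => i _; rewrite exprzDr.
Qed.

Definition trop_fun x a : R := zprod (fun i => unit_or_1 (x i)) a.

Lemma trop_fun1 x : trop_fun x 1%g = 1.
Proof. by rewrite /trop_fun /zprod big1 // => i _; rewrite tropE ffunE expr0z. Qed.

Lemma trop_funM x a b : trop_fun x (a * b)%g = trop_fun x a * trop_fun x b.
Proof.
rewrite -zprodD => [|i]; last exact: unit_or_1_unit.
by apply: eq_bigr => i _; rewrite tropE ffunE.
Qed.

Definition trop_char x : character (trop n) R :=
  Character (trop_fun1 x) (trop_funM x).

Variables (P : semifieldType) (G : laurent_group P n) (chi : character P R).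

Definition lmon_fun x (g : G) : R := chi (lcoef g) * trop_char x (lexp g).

Lemma lmon_fun1 x : lmon_fun x 1%g = 1.
Proof. by rewrite /lmon_fun lcoef1 lexp1 !char1 mulr1. Qed.

Lemma lmon_funM x g h : lmon_fun x (g * h)%g = lmon_fun x g * lmon_fun x h.
Proof. by rewrite /lmon_fun lcoefM lexpM !charM mulrACA. Qed.

Definition lmon_char x : character G R :=
  Character (lmon_fun1 x) (lmon_funM x).

Lemma trop_char_unit x i : x i \is a GRing.unit -> trop_char x (trop_unit i) = x i.
Proof.
move=> ux; rewrite /= /trop_fun /zprod (bigD1 i) //= ffunE eqxx expr1z big1 ?mulr1.
  exact: unit_or_1_id.
by move=> j ji; rewrite ffunE (negPf ji) expr0z.
Qed.

Lemma trop_charD1 x i a : (forall l, x l \is a GRing.unit) ->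
  trop_char x a = x i ^ a i * \prod_(l < n | l != i) x l ^ a l.
Proof.
move=> ux; rewrite /= /trop_fun /zprod (bigD1 i) //= unit_or_1_id //.
by congr (_ * _); apply: eq_bigr => l _; rewrite unit_or_1_id.
Qed.

Lemma eval_lX x i : x i \is a GRing.unit -> gmap (lmon_char x) (mon (lX G i)) = x i.
Proof.
by move=> ux; rewrite gmap_mon /= /lmon_fun lcoef_mk lexp_mk char1 mul1r trop_char_unit.
Qed.

Lemma eval_lcoef x p : gmap (lmon_char x) (mon (lmk G p 1%g)) = chi p.
Proof. by rewrite gmap_mon /= /lmon_fun lcoef_mk lexp_mk [trop_char x _]char1 mulr1. Qed.

End Evaluation.

Section FieldProducts.
Variables (n : nat) (F : fieldType).
Implicit Types (x : 'I_n -> F) (a b : 'I_n -> int).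

Lemma eq_zprod x x' a b : (forall i, b i != 0 -> x i = x' i) ->
  (forall i, a i = b i) -> zprod x a = zprod x' b.
Proof.
move=> ex ea; apply: eq_bigr => i _; rewrite ea.
by have [->|/ex->//] := eqVneq (b i) 0; rewrite !expr0z.
Qed.

Lemma zprod_neq0 x a : (forall i, x i != 0) -> zprod x a != 0.
Proof. by move=> x0; apply/prodf_neq0 => i _; rewrite expfz_eq0 negb_and x0 orbT. Qed.

Lemma zprodDf x a b : (forall i, x i != 0) ->
  zprod x (fun i => a i + b i) = zprod x a * zprod x b.
Proof.
move=> x0; rewrite -big_split; apply: eq_bigr => i _; exact: expfzDr.
Qed.

Lemma zprodN x a : zprod x (fun i => - a i) = (zprod x a)^-1.
Proof. by rewrite -prodfV; apply: eq_bigr => i _; rewrite invr_expz. Qed.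

Lemma zprodZ x a (c : int) : zprod x (fun i => c * a i) = zprod x a ^ c.
Proof.
have F0 : {morph (fun v : F => v ^ c) : u v / u * v} by move=> u v; apply: expfzMl.
rewrite (big_morph (fun v : F => v ^ c) F0 (exp1rz _ _)).
by apply: eq_bigr => i _; rewrite mulrC exprz_exp.
Qed.

Lemma zprodM x x' a : zprod (fun i => x i * x' i) a = zprod x a * zprod x' a.
Proof. by rewrite -big_split; apply: eq_bigr => i _; rewrite expfzMl. Qed.

Lemma zprod_unitv x i : zprod x (trop_unit i) = x i.
Proof.
rewrite /zprod (bigD1 i) //= ffunE eqxx expr1z big1 ?mulr1 // => j ji.
by rewrite ffunE (negPf ji) expr0z.
Qed.

Lemma trop_charE x (a : trop n) : (forall i, x i != 0) ->
  trop_char x a = zprod x a.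
Proof. by move=> x0; apply: eq_zprod => // i _; rewrite unit_or_1_id ?unitfE. Qed.

End FieldProducts.

(** * Exchange matrices *)

Definition pospart (a : int) : int := Num.max a 0.

Lemma pospartB a : pospart a - pospart (- a) = a.
Proof. by rewrite /pospart; lia. Qed.

Lemma pospart_id a : 0 <= a -> pospart a = a.
Proof. by rewrite /pospart; lia. Qed.

Lemma pospart_le0 a : a <= 0 -> pospart a = 0.
Proof. by rewrite /pospart; lia. Qed.

Section ExchangeMatrices.
Variable n : nat.
Implicit Types (B : 'M[int]_n) (i j k : 'I_n).

(** Products of powers call for a rule without absolute values and without
    division. *)
Lemma mutate_matrixE B k i j : i != k -> j != k ->
  mutate_matrix B k i j =
    B i j + pospart (B i k) * pospart (B k j) - pospart (- B i k) * pospart (- B k j).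
Proof.
move=> /negPf ik /negPf jk; rewrite mxE ik jk /= -addrA; congr (_ + _).
move: (B i k) (B k j) => a b; apply: (@mulIf _ 2) => //.
rewrite divzK; first by rewrite /pospart; case: (ltP a 0) => ?; case: (ltP b 0) => ?; nia.
apply/dvdzP; exists (pospart a * pospart b - pospart (- a) * pospart (- b)).
by rewrite /pospart; case: (ltP a 0) => ?; case: (ltP b 0) => ?; nia.
Qed.

Lemma mutate_matrixNl B k j : mutate_matrix B k k j = - B k j.
Proof. by rewrite mxE eqxx. Qed.

Lemma mutate_matrixNr B k i : mutate_matrix B k i k = - B i k.
Proof. by rewrite mxE eqxx orbT. Qed.

Lemma mutate_matrixK B k : mutate_matrix (mutate_matrix B k) k = B.
Proof.
apply/matrixP => i j; have [->|ik] := eqVneq i k.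
  by rewrite !mutate_matrixNl opprK.
have [->|jk] := eqVneq j k; first by rewrite !mutate_matrixNr opprK.
rewrite mutate_matrixE // mutate_matrixNl mutate_matrixNr mutate_matrixE //.
by rewrite !opprK; ring.
Qed.

Definition skew_by (d : 'I_n -> rat) B :=
  (forall i, 0 < d i) /\ forall i j, d i * (B i j)%:~R = - (d j * (B j i)%:~R).

(** Passing from an entry to the transposed one exchanges, up to the factors
    [d], its positive and its negative part, and so the two terms that
    [mutate_matrixE] adds. *)
Lemma skew_by_mutate d B k : skew_by d B -> skew_by d (mutate_matrix B k).
Proof.
move=> [d0 dB]; split=> // i j.
have [->|ik] := eqVneq i k.
  by rewrite mutate_matrixNl mutate_matrixNr !rmorphN /= !mulrN dB.
have [->|jk] := eqVneq j k.
  by rewrite mutate_matrixNl mutate_matrixNr !rmorphN /= !mulrN dB.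
rewrite !mutate_matrixE // !(rmorphB, rmorphD, rmorphM) /=.
have ppd u v a b : 0 < u -> 0 < v -> u * a%:~R = - (v * b%:~R) ->
    u * (pospart a)%:~R = v * (pospart (- b))%:~R :> rat.
  move=> u0 v0 e; rewrite /pospart; have [a0|a0] := ltP a 0.
    rewrite mulr0; have [b0|b0] := ltP (- b) 0; rewrite ?mulr0 //.
    have : u * a%:~R < 0 by rewrite pmulr_rlt0 // ltrz0.
    by rewrite e oppr_lt0 pmulr_rgt0 // ltr0z; move: b0; lia.
  rewrite e; have [b0|b0] := ltP (- b) 0; last by rewrite rmorphN mulrN.
  have : 0 <= u * a%:~R by rewrite pmulr_rge0 // ler0z.
  by rewrite e oppr_ge0 pmulr_rle0 // lerz0; move: b0; lia.
have e1 := ppd _ _ _ _ (d0 i) (d0 k) (dB i k).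
have e2 := ppd _ _ _ _ (d0 k) (d0 j) (dB k j).
have dB' u v : d u * (- B u v)%:~R = - (d v * (- B v u)%:~R).
  by rewrite !rmorphN /= !mulrN dB.
have e3 := ppd _ _ _ _ (d0 i) (d0 k) (dB' i k).
have e4 := ppd _ _ _ _ (d0 k) (d0 j) (dB' k j).
rewrite !opprK in e3 e4.
rewrite mulrBr mulrDr dB !mulrA e1 e3 (mulrAC (d k) (pospart (- B k i))%:~R).
rewrite (mulrAC (d k) (pospart (B k i))%:~R) e2 e4; ring.
Qed.

Lemma skew_by_ii d B i : skew_by d B -> B i i = 0.
Proof.
move=> [d0 dB]; have /eqP := dB i i; rewrite -subr_eq0 opprK -mulr2n mulrn_eq0 /=.
by rewrite mulf_eq0 gt_eqF //= intr_eq0 => /eqP.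
Qed.

Lemma skew_by_gt0 d B i j : skew_by d B -> (0 < B i j) = (B j i < 0).
Proof.
move=> [d0 dB]; rewrite -(ltr0z rat) -(pmulr_rgt0 _ (d0 i)) dB oppr_gt0.
by rewrite pmulr_rlt0 // ltrz0.
Qed.

Lemma skew_by_eq0 d B i j : skew_by d B -> (B i j == 0) = (B j i == 0).
Proof.
move=> sB; have := skew_by_gt0 i j sB; have := skew_by_gt0 j i sB.
lia.
Qed.

End ExchangeMatrices.

(** * Seeds in a field *)

Record gseed (n : nat) (F : fieldType) := GSeed {
  gx : {ffun 'I_n -> F};
  gy : {ffun 'I_n -> F};
  gB : 'M[int]_n }.

Section FieldSeeds.
Variables (n : nat) (F : fieldType).
Implicit Types (s : gseed n F) (i j k : 'I_n) (c : F).

Definition pos_monomial s k : F := zprod (gx s) (fun l => pospart (gB s k l)).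
Definition neg_monomial s k : F := zprod (gx s) (fun l => pospart (- gB s k l)).

(** The normalizing factor [c] is arbitrary. The mutations of a cluster algebra
    are those where [c] is the inverse of [oplus y_k 1]; the universal seed is
    mutated with [c = 1]. *)
Definition gmut k c s : gseed n F := GSeed
  [ffun i => if i == k
             then c * (gy s k * pos_monomial s k + neg_monomial s k) / gx s k
             else gx s i]
  [ffun j => if j == k then (gy s k)^-1
             else gy s j * gy s k ^ pospart (gB s j k) * c ^ gB s j k]
  (mutate_matrix (gB s) k).

(** The quotient of the two terms of the exchange relation; Fomin and
    Zelevinsky write it as y with a hat. *)
Definition hat s j : F := gy s j * zprod (gx s) (gB s j).

Definition regular s := (forall i, gx s i != 0) /\ (forall i, gy s i != 0).

Lemma pos_monomialE s k : regular s -> gy s k * pos_monomial s k = neg_monomial s k * hat s k.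
Proof.
move=> [x0 y0]; rewrite mulrCA; congr (_ * _); rewrite -zprodDf //.
by apply: eq_zprod => // l; rewrite -{3}(pospartB (gB s k l)) addrC subrK.
Qed.

Lemma gmut_x k c s : regular s ->
  gx (gmut k c s) k = c * neg_monomial s k * (1 + hat s k) / gx s k.
Proof. by move=> rs; rewrite ffunE eqxx pos_monomialE //; ring. Qed.

Lemma gmut_xN i k c s : i != k -> gx (gmut k c s) i = gx s i.
Proof. by rewrite ffunE => /negPf->. Qed.

Lemma neg_monomial_neq0 s k : regular s -> neg_monomial s k != 0.
Proof. by case=> x0 _; apply: zprod_neq0. Qed.

Lemma gmut_regular k c s : regular s -> c != 0 -> 1 + hat s k != 0 ->
  regular (gmut k c s).
Proof.
move=> rs c0 h0; have [x0 y0] := rs; split=> i; have [->|ik] := eqVneq i k.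
- by rewrite gmut_x // !mulf_neq0 ?invr_eq0 ?neg_monomial_neq0.
- by rewrite gmut_xN.
- by rewrite ffunE eqxx invr_eq0.
- by rewrite ffunE (negPf ik) !mulf_neq0 // expfz_neq0.
Qed.

Lemma zprod_gmut k c s (a : 'I_n -> int) : gx s k != 0 ->
  zprod (gx (gmut k c s)) a = zprod (gx s) a * (gx (gmut k c s) k / gx s k) ^ a k.
Proof.
move=> xk; rewrite /zprod (bigD1 k) // [in RHS](bigD1 k) //=.
rewrite (eq_bigr (fun i => gx s i ^ a i)) => [|i ik]; last by rewrite gmut_xN.
move: (gx (gmut k c s) k) => v.
rewrite expfzMl exprz_inv [RHS]mulrC -mulrA (mulrA (gx s k ^ _)).
rewrite -expfzDr // addNr expr0z mul1r.
by [].
Qed.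

(** The factor [c] enters through the coefficient of [j] with exponent [gB s j
    k], and through the new variable with the opposite exponent: the quantities
    [hat] do not depend on normalization. *)
Lemma gmut_hat k c s j : regular s -> c != 0 -> 1 + hat s k != 0 -> gB s k k = 0 ->
  hat (gmut k c s) j =
    if j == k then (hat s k)^-1
    else hat s j * hat s k ^ pospart (gB s j k) * (1 + hat s k) ^ (- gB s j k).
Proof.
move=> rs c0 h0 Bkk; have [x0 y0] := rs; rewrite {1}/hat zprod_gmut //.
have [->|jk] := eqVneq j k.
  rewrite /= mutate_matrixNl Bkk oppr0 expr0z mulr1 ffunE eqxx /hat invfM -zprodN.
  by congr (_ * _); apply: eq_zprod => // l; rewrite mutate_matrixNl.
rewrite [gB _]/= mutate_matrixNr gmut_x // ffunE (negPf jk).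
set b := gB s j k; set h := 1 + hat s k; set u := gx s k.
have u0 : u != 0 by apply: x0.
have -> : zprod (gx s) (mutate_matrix (gB s) k j) =
    zprod (gx s) (gB s j) *
      (pos_monomial s k ^ pospart b * neg_monomial s k ^ (- pospart (- b)))
      * (u ^ (-2)) ^ b.
  have -> : (u ^ (-2)) ^ b = zprod (gx s) (fun l => -2 * b * (l == k)%:Z).
    rewrite /zprod (bigD1 k) //= eqxx mulr1 exprz_exp big1 ?mulr1 // => i /negPf->.
    by rewrite mulr0 expr0z.
  rewrite -!zprodZ -!zprodDf //; apply: eq_zprod => // l.
  have [->|lk] := eqVneq l k.
    by rewrite mutate_matrixNr Bkk /pospart -/b; lia.
  by rewrite mutate_matrixE // -/b mulr0 addr0; ring.
have -> : c * neg_monomial s k * h / u / u = c * neg_monomial s k * h * u ^ (-2).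
  by rewrite -!mulrA -invfM.
rewrite -[hat s j]/(gy s j * zprod (gx s) (gB s j)); have N0 := neg_monomial_neq0 k rs.
set w := c * neg_monomial s k * h * u ^ (-2); rewrite -(exprz_inv w) -(exprz_inv h).
have u2 : u ^ (-2) != 0 by rewrite expfz_neq0.
have [b0|b0] := leP 0 b.
  rewrite (pospart_id b0) (pospart_le0 (_ : - b <= 0)) ?oppr_le0 // oppr0 expr0z mulr1.
  rewrite [LHS](_ : _ = gy s j * zprod (gx s) (gB s j) *
    ((gy s k * pos_monomial s k) * c * u ^ (-2) * w^-1) ^ b).
    rewrite pos_monomialE // -[RHS]mulrA -expfzMl; congr (_ * _ ^ _).
    by rewrite /w; move: (u ^ (-2)) u2 => t t0; field; rewrite c0 N0 h0 t0.
  rewrite (expfzMl (gy s k * pos_monomial s k * c * u ^ (-2))).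
  rewrite (expfzMl (gy s k * pos_monomial s k * c)).
  rewrite (expfzMl (gy s k * pos_monomial s k)) (expfzMl (gy s k)).
  by move: (gy s k ^ b) (pos_monomial s k ^ b) (w^-1 ^ b) ((u ^ (-2)) ^ b) => ? ? ? ?; ring.
rewrite (pospart_le0 (ltW b0)) (pospart_id (_ : 0 <= - b)); last by rewrite oppr_ge0 ltW.
rewrite !expr0z opprK !mul1r !mulr1.
rewrite [LHS](_ : _ = gy s j * zprod (gx s) (gB s j) *
    (neg_monomial s k * c * u ^ (-2) * w^-1) ^ b).
  congr (_ * _ ^ _).
  by rewrite /w; move: (u ^ (-2)) u2 => t t0; field; rewrite c0 N0 h0 t0.
rewrite (expfzMl (neg_monomial s k * c * u ^ (-2))).
rewrite (expfzMl (neg_monomial s k * c)) (expfzMl (neg_monomial s k)).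
by move: (neg_monomial s k ^ b) (w^-1 ^ b) ((u ^ (-2)) ^ b) => ? ? ?; ring.
Qed.

(** The way back inverts the coefficient and exchanges the two monomials, which
    costs a factor [y_k]; this is why it has another normalizing factor. *)
Lemma gmutK k c s : regular s -> c != 0 -> 1 + hat s k != 0 -> gB s k k = 0 ->
  gmut k (c * gy s k) (gmut k c s) = s.
Proof.
move=> rs c0 h0 Bkk; have rs' := gmut_regular rs c0 h0.
have [x0 y0] := rs; have [x0' y0'] := rs'.
case: s rs c0 h0 Bkk rs' x0 y0 x0' y0' => x y B; set s := GSeed _ _ _.
move=> rs c0 h0 Bkk rs' x0 y0 x0' y0'; rewrite {1}/gmut.
congr GSeed; last exact: mutate_matrixK.
  apply/ffunP => i; rewrite ffunE; have [->|ik] := eqVneq i k; last first.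
    by rewrite gmut_xN.
  rewrite [pos_monomial _ _](_ : _ = neg_monomial s k); last first.
    apply: eq_zprod => l; last by rewrite /= mutate_matrixNl.
    by rewrite /=; have [->|lk _] := eqVneq l k; [rewrite Bkk|rewrite ffunE (negPf lk)].
  rewrite [neg_monomial (gmut _ _ _) _](_ : _ = pos_monomial s k); last first.
    apply: eq_zprod => l; last by rewrite /= mutate_matrixNl opprK.
    by rewrite /=; have [->|lk _] := eqVneq l k; [rewrite Bkk|rewrite ffunE (negPf lk)].
  rewrite gmut_x // ffunE eqxx /=.
  have -> : x k = gx s k by [].
  have e := pos_monomialE k rs; rewrite -[y k]/(gy s k).
  rewrite (_ : pos_monomial s k = neg_monomial s k * hat s k / gy s k).
    by field; rewrite (neg_monomial_neq0 k rs) h0 c0 x0 y0.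
  by rewrite -e mulrC mulKf.
apply/ffunP => j; rewrite ffunE; have [->|jk] := eqVneq j k.
  by rewrite ffunE eqxx invrK.
rewrite ffunE (negPf jk) /= ffunE eqxx mutate_matrixNr /= exprz_inv.
rewrite -/s; set b := B j k; rewrite -[y k]/(gy s k).
rewrite expfzMl mulrACA -!mulrA; set yk := gy s k.
rewrite [X in _ * X](_ : _ = (c ^ b * c ^ (- b)) *
  (yk ^ pospart b * (yk ^ (- pospart (- b)) * yk ^ (- b)))).
  by rewrite -!expfzDr ?y0 // addrN expr0z mul1r addrA pospartB addrN expr0z mulr1.
by rewrite mulrCA -!mulrA; congr (_ * _); rewrite mulrCA.
Qed.

End FieldSeeds.

(** * Laurent elements and places *)

Section Paths.
Variables (n : nat) (F : fieldType).
Implicit Types (s : gseed n F) (ks : seq ('I_n * F)) (U : F -> Prop).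

Definition gpath s ks : gseed n F := foldl (fun s' kc => gmut kc.1 kc.2 s') s ks.

Fixpoint nzpath s ks : Prop :=
  (forall i, gx s i != 0) /\
  (if ks is kc :: ks' then nzpath (gmut kc.1 kc.2 s) ks' else True).

Definition subgroup U :=
  [/\ U 1, forall u v, U u -> U v -> U (u * v), forall u, U u -> U u^-1
    & forall u, U u -> u != 0].

(** The subring generated by [U], the variables and their inverses, in a form
    that reduces properties to the generators. *)
Inductive laurent U (x : 'I_n -> F) : F -> Prop :=
  | LaurentU u of U u : laurent U x u
  | LaurentX i : laurent U x (x i)
  | LaurentV i : laurent U x (x i)^-1
  | Laurent0 : laurent U x 0
  | LaurentD u v of laurent U x u & laurent U x v : laurent U x (u + v)
  | LaurentN u of laurent U x u : laurent U x (- u)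
  | LaurentM u v of laurent U x u & laurent U x v : laurent U x (u * v).

Variables (U : F -> Prop) (sU : subgroup U).

Lemma subgroupX u (a : int) : U u -> U (u ^ a).
Proof.
have [U1 UM UV _] := sU => Uu.
have UX k : U (u ^+ k) by elim: k => [|k IH]; rewrite ?expr0 ?exprS //; apply: UM.
by case: a => k; [exact: UX|rewrite NegzE -invr_expz; apply/UV/UX].
Qed.

Lemma subgroup_zprod (x : 'I_n -> F) a : (forall i, U (x i)) -> U (zprod x a).
Proof.
by have [U1 UM _ _] := sU => Ux; apply: (big_ind U) => // i _; apply: subgroupX.
Qed.

Lemma subgroup_gmut s k c : (forall j, U (gy s j)) -> U c ->
  forall j, U (gy (gmut k c s) j).
Proof.
have [U1 UM UV _] := sU => Uy Uc j; rewrite ffunE; case: eqP => _; first exact: UV.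
by apply: (UM); [apply: (UM) => //|]; apply: subgroupX.
Qed.

Lemma laurentX x u (a : int) :
  laurent U x u -> laurent U x u^-1 -> laurent U x (u ^ a).
Proof.
move=> Lu LV; have L1 : laurent U x 1 by apply: LaurentU; case: sU.
have LX v k : laurent U x v -> laurent U x (v ^+ k).
  by move=> Lv; elim: k => [|k IH]; rewrite ?expr0 ?exprS //; apply: LaurentM.
by case: a => k; [exact: LX|rewrite NegzE -exprz_inv; apply: LX].
Qed.

Lemma laurent_zprod x a : laurent U x (zprod x a).
Proof.
apply: (big_ind (laurent U x)); first by apply: LaurentU; case: sU.
  by move=> *; apply: LaurentM.
by move=> i _; apply: laurentX; [apply: LaurentX|apply: LaurentV].
Qed.

Lemma hat_neq0_of_gmut s k c : regular s -> gx (gmut k c s) k != 0 ->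
  1 + hat s k != 0.
Proof. by move=> rs; rewrite gmut_x // !mulf_eq0 !negb_or => /andP[/andP[_ ->]]. Qed.

End Paths.

Lemma laurent_sub n (F : fieldType) (U Q : F -> Prop) (x : 'I_n -> F) u :
    (forall v, U v -> Q v) -> (forall i, Q (x i)) -> (forall i, Q (x i)^-1) ->
    Q 0 -> (forall v w, Q v -> Q w -> Q (v + w)) -> (forall v, Q v -> Q (- v)) ->
    (forall v w, Q v -> Q w -> Q (v * w)) ->
  laurent U x u -> Q u.
Proof. by move=> HU HX HV H0 HD HN HM; elim=> *; eauto. Qed.

Section Places.
Variables (F1 F2 : fieldType) (R : F1 -> F2 -> Prop).

(** [R u r] reads: [u] is finite at the place, with value [r]. As a relation, a
    place need not decide which elements are finite; the last condition makes
    elements with a nonzero value invertible. *)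
Definition place :=
  [/\ R 1 1, forall u v r t, R u r -> R v t -> R (u + v) (r + t),
      forall u v r t, R u r -> R v t -> R (u * v) (r * t),
      forall u r, R u r -> r != 0 -> R u^-1 r^-1
    & forall r, R 0 r -> r = 0].

Hypothesis plR : place.

Lemma place_neq0 u r : R u r -> r != 0 -> u != 0.
Proof.
by have [_ _ _ _ R0] := plR => Rur; apply: contra_neq => u0; apply: R0; rewrite -u0.
Qed.

Lemma place_exprz u r (a : int) : R u r -> r != 0 -> R (u ^ a) (r ^ a).
Proof.
have [R1 RD RM RV _] := plR => Rur r0.
have RX k : R (u ^+ k) (r ^+ k).
  by elim: k => [|k IH]; rewrite ?expr0 ?exprS //; apply: RM.
case: a => k; first exact: RX.
by rewrite NegzE -!invr_expz; apply: RV; rewrite ?expf_neq0 //; apply: RX.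
Qed.

Lemma place_zprod n (x : 'I_n -> F1) (y : 'I_n -> F2) a :
    (forall i, a i != 0 -> R (x i) (y i)) -> (forall i, y i != 0) ->
  R (zprod x a) (zprod y a).
Proof.
have [R1 RD RM RV _] := plR => Rxy y0.
apply: (big_ind2 R) => // [u r v t|i _]; first exact: RM.
have [->|ai] := eqVneq (a i) 0; rewrite ?expr0z //.
by apply: place_exprz => //; apply: Rxy.
Qed.

Variables (n : nat) (U : F2 -> Prop) (sU : subgroup U).

(** Mutations with different normalizing factors, all in [U], are compared: the
    quantities [hat] do not see these factors, and the cluster variables see
    them only up to [U]. *)
Definition related_seeds (s1 : gseed n F1) (s2 : gseed n F2) :=
  [/\ gB s1 = gB s2, exists2 p : 'I_n -> F2, (forall i, U (p i)) &
        (forall i, R (gx s1 i) (p i * gx s2 i))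
    & forall j, R (hat s1 j) (hat s2 j)].

Lemma hat_neq0 (F : fieldType) (s : gseed n F) j : regular s -> hat s j != 0.
Proof. by case=> x0 y0; rewrite mulf_neq0 ?zprod_neq0. Qed.

Lemma related_regular s1 s2 : related_seeds s1 s2 -> regular s2 -> regular s1.
Proof.
move=> [_ [p Up Rx] Rh] rs2; have [_ _ _ U0] := sU; split=> i.
  by apply: (place_neq0 (Rx i)); case: rs2 => x0 _; apply: mulf_neq0; [apply: U0|].
have := place_neq0 (Rh i) (hat_neq0 i rs2).
by rewrite mulf_eq0 negb_or => /andP[].
Qed.

Lemma related_gmut s1 s2 k c : related_seeds s1 s2 -> regular s2 -> U c ->
    gB s2 k k = 0 -> 1 + hat s2 k != 0 ->
  related_seeds (gmut k 1 s1) (gmut k c s2).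
Proof.
move=> rel rs2 Uc Bkk h0; have rs1 := related_regular rel rs2.
have [eB [p Up Rx] Rh] := rel; have [R1 RD RM RV _] := plR.
have [U1 UM UV U0] := sU; have [x0 y0] := rs2.
have Rh1 : R (1 + hat s1 k) (1 + hat s2 k) by apply: RD.
have h10 : 1 + hat s1 k != 0 by apply: place_neq0 h0.
have px0 i : p i * gx s2 i != 0 by apply: mulf_neq0; [apply: U0|].
split=> /=; first by rewrite eB.
  exists (fun i => if i == k then zprod p (fun l => pospart (- gB s2 k l)) / (p k * c) else p i).
    move=> i; case: eqP => _ //; apply: (UM); first exact: subgroup_zprod.
    exact/UV/UM.
  move=> i; case: eqP => [->|/eqP ik]; last first.
    by move: (Rx i); rewrite !ffunE (negPf ik).
  rewrite -[X in R X _]/(gx (gmut k 1 s1) k).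
  rewrite -[X in R _ (_ * X)]/(gx (gmut k c s2) k) !gmut_x // mul1r.
  have -> : zprod p (fun l => pospart (- gB s2 k l)) / (p k * c) *
      (c * neg_monomial s2 k * (1 + hat s2 k) / gx s2 k) =
    zprod (fun l => p l * gx s2 l) (fun l => pospart (- gB s2 k l)) * (1 + hat s2 k)
      / (p k * gx s2 k).
    by rewrite zprodM -/(neg_monomial s2 k); field; rewrite x0 !U0.
  apply: (RM); last by apply: RV.
  apply: (RM) => //.
  by rewrite /neg_monomial eB; apply: place_zprod => // i _; apply: Rx.
have Bkk1 : gB s1 k k = 0 by rewrite eB.
move=> j; rewrite (gmut_hat j rs1 (oner_neq0 _) h10 Bkk1).
rewrite (gmut_hat j rs2 (U0 _ Uc) h0 Bkk) eB; case: (j == k).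
  by apply: RV; rewrite ?hat_neq0.
apply: (RM); last exact: place_exprz.
by apply: (RM) => //; apply: place_exprz => //; apply: hat_neq0.
Qed.

Lemma related_gpath d s1 s2 ks : related_seeds s1 s2 -> skew_by d (gB s2) ->
    nzpath s2 ks -> (forall j, U (gy s2 j)) -> (forall kc, kc \in ks -> U kc.2) ->
  related_seeds (gpath s1 [seq (kc.1, 1) | kc <- ks]) (gpath s2 ks).
Proof.
have [U1 UM UV U0] := sU.
elim: ks s1 s2 => [|[k c] ks IH] s1 s2 rel sk //= [x0 nz] Uy Uc.
have rs : regular s2 by split=> // i; apply: U0.
have Uc' : U c by apply: (Uc (k, c)); rewrite mem_head.
have h0 : 1 + hat s2 k != 0.
  by apply: (@hat_neq0_of_gmut _ _ _ _ c); rewrite //; case: ks nz {IH Uc} => /= [|? ?] [].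
apply: IH => //.
- by apply: related_gmut => //; apply: skew_by_ii sk.
- exact: skew_by_mutate.
- exact: subgroup_gmut.
- by move=> kc kcs; apply: Uc; rewrite inE kcs orbT.
Qed.

End Places.

Section PlaceOfMorphism.
Variables (A : idomainType) (F : fieldType) (sigma : {rmorphism A -> F}).

(** The localization of [A] at the kernel of [sigma], with its residue map. *)
Definition local_place (u : {fraction A}) (r : F) :=
  exists h g, [/\ sigma g != 0, u = tofrac h / tofrac g & r = sigma h / sigma g].

Lemma sigma_neq0 g : sigma g != 0 -> tofrac g != 0.
Proof.
move=> sg; rewrite tofrac_eq0.
by apply: contra_neq sg => ->; rewrite rmorph0.
Qed.

Lemma local_place_tofrac f : local_place (tofrac f) (sigma f).
Proof. by exists f, 1; rewrite !rmorph1 oner_eq0 !divr1. Qed.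

Lemma local_placeE f r : local_place (tofrac f) r -> r = sigma f.
Proof.
move=> [h [g [sg e ->]]]; have g0 := sigma_neq0 sg.
have : tofrac (f * g) = tofrac h by rewrite tofracM e divfK.
by move/eqP; rewrite tofrac_eq => /eqP <-; rewrite rmorphM mulfK.
Qed.

Lemma local_place_place : place local_place.
Proof.
split.
- by have := local_place_tofrac 1; rewrite !rmorph1.
- move=> _ _ _ _ [h [g [sg -> ->]]] [h' [g' [sg' -> ->]]].
  exists (h * g' + h' * g), (g * g').
  have g0 := sigma_neq0 sg; have g'0 := sigma_neq0 sg'.
  split; first by rewrite (rmorphM sigma); apply: mulf_neq0.
    by rewrite tofracD !tofracM; apply: addf_div.
  by rewrite (rmorphD sigma) !(rmorphM sigma); apply: addf_div.
- move=> _ _ _ _ [h [g [sg -> ->]]] [h' [g' [sg' -> ->]]].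
  exists (h * h'), (g * g').
  split; first by rewrite (rmorphM sigma); apply: mulf_neq0.
    by rewrite !tofracM mulf_div.
  by rewrite !(rmorphM sigma) mulf_div.
- move=> _ _ [h [g [sg -> ->]]]; rewrite mulf_eq0 negb_or => /andP[sh _].
  by exists g, h; split; rewrite ?invf_div.
- by move=> r; rewrite -tofrac0 => /local_placeE ->; rewrite rmorph0.
Qed.

End PlaceOfMorphism.

Definition unit_path n (F : fieldType) (ks : seq 'I_n) : seq ('I_n * F) :=
  [seq (k, 1) | k <- ks].

(** * Positivity *)

Section PositiveSeeds.
Variables (F : fieldType) (Pos : F -> Prop).

(** Subtraction-free expressions stay in such a set, which is how cluster
    variables are known not to vanish. *)
Definition positive :=
  [/\ Pos 1, forall u v, Pos u -> Pos v -> Pos (u + v),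
      forall u v, Pos u -> Pos v -> Pos (u * v), forall u, Pos u -> Pos u^-1
    & forall u, Pos u -> u != 0].

Hypothesis posP : positive.

Let Pos1 : Pos 1. Proof. by case: posP. Qed.
Let PosD u v : Pos u -> Pos v -> Pos (u + v). Proof. by case: posP => ? H *; apply: H. Qed.
Let PosM u v : Pos u -> Pos v -> Pos (u * v). Proof. by case: posP => ? ? H *; apply: H. Qed.
Let PosV u : Pos u -> Pos u^-1. Proof. by case: posP => ? ? ? H *; apply: H. Qed.
Let Pos_neq0 u : Pos u -> u != 0. Proof. by case: posP => ? ? ? ? H *; apply: H. Qed.

Lemma PosXz u (a : int) : Pos u -> Pos (u ^ a).
Proof.
move=> Pu; have PX k : Pos (u ^+ k).
  by elim: k => [|k IH]; rewrite ?exprS; [apply: Pos1|apply: PosM].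
by case: a => k; [apply: PX|rewrite NegzE -invr_expz; apply/PosV/PX].
Qed.

Lemma Pos_nat m : Pos m.+1%:R.
Proof. by elim: m => [|m IH]; [apply: Pos1|rewrite mulrS; apply: PosD => //; apply: Pos1]. Qed.

Lemma Pos_zprod n (x : 'I_n -> F) a : (forall i, Pos (x i)) -> Pos (zprod x a).
Proof.
by move=> Px; apply: (big_ind Pos) => [||i _]; [apply: Pos1|apply: PosM|apply: PosXz].
Qed.

Variable n : nat.
Implicit Types s : gseed n F.

Definition Pos_seed (s : gseed n F) := (forall i, Pos (gx s i)) /\ (forall i, Pos (gy s i)).

Lemma Pos_gmut s k c : Pos_seed s -> Pos c -> Pos_seed (gmut k c s).
Proof.
move=> [Px Py] Pc; split=> i; rewrite ffunE; case: eqP => _ //.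
- apply: PosM; last exact: PosV; apply: PosM => //.
  apply: PosD; last exact: Pos_zprod.
  by apply: PosM => //; apply: Pos_zprod.
- exact: PosV.
- by apply: PosM; [apply: PosM => //|]; apply: PosXz.
Qed.

Lemma Pos_regular s : Pos_seed s -> regular s.
Proof. by move=> [Px Py]; split=> i; apply: Pos_neq0. Qed.

Lemma Pos_hat s j : Pos_seed s -> Pos (hat s j).
Proof. by move=> [Px Py]; apply: PosM => //; apply: Pos_zprod. Qed.

Lemma Pos_hat1 s j : Pos_seed s -> 1 + hat s j != 0.
Proof. by move=> Ps; apply/Pos_neq0/PosD; [apply: Pos1|apply: Pos_hat]. Qed.

Lemma Pos_nzpath s ks : Pos_seed s -> nzpath s (unit_path F ks).
Proof.
elim: ks s => [|k ks IH] s Ps; have [x0 _] := Pos_regular Ps; first by split.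
split; first exact: x0.
by apply: IH; apply: Pos_gmut => //; apply: Pos1.
Qed.

End PositiveSeeds.

(** * Positive fractions *)

Section Positivity.
Variable P : semifieldType.
Local Notation A := (group_ring P).
Local Notation F := ({fraction A}).
Implicit Types (u v : F) (g h : P).

Lemma tofrac_monM g h : tofrac (mon (g * h)%g) = tofrac (mon g) * tofrac (mon h).
Proof. by rewrite monM tofracM. Qed.

Lemma tofrac_monV g : tofrac (mon g^-1%g) = (tofrac (mon g))^-1.
Proof.
apply: (@mulfI _ (tofrac (mon g))); first by rewrite tofrac_eq0 mon_neq0.
by rewrite divff ?tofrac_eq0 ?mon_neq0 // -tofrac_monM monoid.mulgV -tofrac1.
Qed.

Lemma tofrac_mon_neq0 g : tofrac (mon g) != 0.
Proof. by rewrite tofrac_eq0 mon_neq0. Qed.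

(** Asking for positive augmentations instead of positive coefficients gives
    more fractions, but suffices for closure under sums, products and inverses,
    and excludes 0. *)
Definition Pos (u : F) := exists f g : A, [/\ 0 < aug f, 0 < aug g & u = tofrac f / tofrac g].

Lemma aug_neq0 (f : A) : 0 < aug f -> tofrac f != 0.
Proof. by rewrite tofrac_eq0; apply: contraTneq => ->; rewrite aug0 ltxx. Qed.

Lemma Pos_neq0 u : Pos u -> u != 0.
Proof.
by move=> [f [g [f0 g0 ->]]]; rewrite mulf_neq0 ?invr_eq0 ?aug_neq0.
Qed.

Lemma Pos_mon g : Pos (tofrac (mon g)).
Proof. by exists (mon g), 1; rewrite aug_mon aug1 tofrac1 divr1. Qed.

Lemma Pos1 : Pos 1.
Proof. by rewrite -tofrac1 -mon1; apply: Pos_mon. Qed.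

Lemma PosM u v : Pos u -> Pos v -> Pos (u * v).
Proof.
move=> [f [g [f0 g0 ->]]] [f' [g' [f'0 g'0 ->]]]; exists (f * f'), (g * g').
by split; [rewrite augM mulr_gt0|rewrite augM mulr_gt0|rewrite !tofracM mulf_div].
Qed.

Lemma PosD u v : Pos u -> Pos v -> Pos (u + v).
Proof.
move=> [f [g [f0 g0 ->]]] [f' [g' [f'0 g'0 ->]]]; exists (f * g' + f' * g), (g * g').
split; first by rewrite augD !augM addr_gt0 // mulr_gt0.
  by rewrite augM mulr_gt0.
by rewrite tofracD !tofracM; apply: addf_div; apply: aug_neq0.
Qed.

Lemma PosV u : Pos u -> Pos u^-1.
Proof. by move=> [f [g [f0 g0 ->]]]; exists g, f; rewrite invf_div. Qed.

Lemma Pos_positive : positive Pos.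
Proof.
by split; [apply: Pos1|apply: PosD|apply: PosM|apply: PosV|apply: Pos_neq0].
Qed.

End Positivity.

(** * The universal seed *)

Section UniversalSeed.
Variables (n : nat) (G : laurent_group (trop n) n).
Local Notation A := (group_ring G).
Local Notation F := ({fraction A}).
Implicit Types (i j k l : 'I_n) (B : 'M[int]_n).

Definition mY i : G := lmk G (trop_unit i) 1%g.
Definition uX i : F := tofrac (mon (lX G i)).
Definition uY i : F := tofrac (mon (mY i)).

(** All variables and all coefficients are independent, so that every other
    seed is a specialization of this one. *)
Definition useed B : gseed n F := GSeed [ffun i => uX i] [ffun i => uY i] B.

Lemma eval_mY (R : comUnitRingType) (y x : 'I_n -> R) i :
  y i \is a GRing.unit -> gmap (lmon_char G (trop_char y) x) (mon (mY i)) = y i.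
Proof. by move=> uy; rewrite eval_lcoef trop_char_unit. Qed.

Lemma uX_neq0 i : uX i != 0. Proof. exact: tofrac_mon_neq0. Qed.
Lemma uY_neq0 i : uY i != 0. Proof. exact: tofrac_mon_neq0. Qed.

Lemma useed_regular B : regular (useed B).
Proof. by split=> i; rewrite ffunE; [apply: uX_neq0|apply: uY_neq0]. Qed.

Definition universally_laurent B ks :=
  forall l, exists f, gx (gpath (useed B) (unit_path F ks)) l = tofrac f.

(** Sending the variables and coefficients of the universal seed to those of
    [s] defines a place. Mutations correspond at this place as long as no
    cluster variable vanishes, and Laurent expansions are defined there. *)
Lemma laurent_specialization (K : fieldType) (U : K -> Prop) (s : gseed n K) d
    (ks : seq ('I_n * K)) :
    universally_laurent (gB s) (unzip1 ks) -> subgroup U -> skew_by d (gB s) ->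
    (forall j, U (gy s j)) -> (forall kc, kc \in ks -> U kc.2) -> nzpath s ks ->
  forall l, laurent U (gx s) (gx (gpath s ks) l).
Proof.
move=> uni sU sk Uy Uc nz l; have [U1 UM UV U0] := sU.
have x0 i : gx s i != 0 by case: ks nz {uni Uc} => [|? ?] [].
pose sigma := gmap (lmon_char G (trop_char (gy s)) (gx s)).
have sX i : sigma (mon (lX G i)) = gx s i by rewrite /sigma eval_lX ?unitfE.
have sY i : sigma (mon (mY i)) = gy s i by rewrite /sigma eval_mY ?unitfE ?U0.
have plR := local_place_place sigma.
have rel : related_seeds (local_place sigma) U (useed (gB s)) s.
  split=> //; first exists (fun=> 1) => // i.
    by rewrite ffunE mul1r -sX; apply: local_place_tofrac.
  move=> j; have [_ _ RM _ _] := plR; apply: (RM).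
    by rewrite ffunE -sY; apply: local_place_tofrac.
  by apply: place_zprod => // i _; rewrite ffunE -sX; apply: local_place_tofrac.
have [_ [p Up Rx] _] := related_gpath plR sU rel sk nz Uy Uc.
have [f ef] := uni l; move: (Rx l).
rewrite [[seq _ | _ <- _]](_ : _ = unit_path F (unzip1 ks)); last first.
  by rewrite /unit_path -map_comp.
rewrite ef => pl; have e : p l * gx (gpath s ks) l = sigma f := local_placeE pl.
have -> : gx (gpath s ks) l = (p l)^-1 * sigma f by rewrite -e mulKf ?U0.
apply: LaurentM; first exact/LaurentU/UV.
elim/group_ring_ind: f {ef e pl} => [|f g Lf Lg|f Lf|g].
- by rewrite /sigma rmorph0; apply: Laurent0.
- by rewrite /sigma rmorphD; apply: LaurentD.
- by rewrite /sigma rmorphN; apply: LaurentN.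
rewrite /sigma gmap_mon; apply: LaurentM.
  apply: LaurentU; rewrite [trop_char _ _]trop_charE.
    exact: subgroup_zprod.
  by move=> i; apply: U0.
by rewrite [trop_char _ _]trop_charE //; apply: laurent_zprod.
Qed.

Lemma Pos_useed B : Pos_seed (@Pos _) (useed B).
Proof. by split=> i; rewrite ffunE; apply: Pos_mon. Qed.

(** ** The subgroup of coefficient monomials *)

Definition Ymon (u : F) := exists b : trop n, u = tofrac (mon (lmk G b 1%g)).

Lemma Ymon_subgroup : subgroup Ymon.
Proof.
split.
- by exists 1%g; rewrite lmk1 -tofrac1.
- move=> _ _ [b ->] [c ->]; exists (b * c)%g.
  by rewrite -tofrac_monM -lmkM monoid.mul1g.
- move=> _ [b ->]; exists b^-1%g.
  by rewrite -tofrac_monV lmkV monoid.invg1.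
- by move=> _ [b ->]; apply: tofrac_mon_neq0.
Qed.

Lemma Ymon_uY i : Ymon (uY i).
Proof. by exists (trop_unit i). Qed.

End UniversalSeed.

(** * Three mutations at a place *)

Section ThreeMutations.
Variables (n : nat) (F : fieldType) (Pos : F -> Prop) (R : F -> F -> Prop).
Hypotheses (posP : positive Pos) (plR : place R).
Variables (s0 : gseed n F) (d : 'I_n -> rat) (i j : 'I_n).
Hypotheses (sk : skew_by d (gB s0)) (Ps0 : Pos_seed Pos s0) (ij : i != j).
Hypothesis Rx : forall l, R (gx s0 l) (gx s0 l).
Hypothesis Ry : forall l, l != i -> R (gy s0 l) (gy s0 l).
Hypothesis Rh : R (hat s0 i) (-1).

Local Notation s1 := (gmut i 1 s0).
Local Notation s2 := (gmut j 1 s1).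
Local Notation s3 := (gmut i 1 s2).
Local Notation B := (gB s0).

Let Pos1 : Pos 1. Proof. by case: posP. Qed.
Let PosD u v : Pos u -> Pos v -> Pos (u + v). Proof. by case: posP => ? H *; apply: H. Qed.
Let PosM u v : Pos u -> Pos v -> Pos (u * v). Proof. by case: posP => ? ? H *; apply: H. Qed.
Let PosV u : Pos u -> Pos u^-1. Proof. by case: posP => ? ? ? H *; apply: H. Qed.
Let Pos0 u : Pos u -> u != 0. Proof. by case: posP => ? ? ? ? H *; apply: H. Qed.
Let R1 : R 1 1. Proof. by case: plR. Qed.
Let RD u v r t : R u r -> R v t -> R (u + v) (r + t).
Proof. by case: plR => ? H *; apply: H. Qed.
Let RM u v r t : R u r -> R v t -> R (u * v) (r * t).
Proof. by case: plR => ? ? H *; apply: H. Qed.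
Let RV u r : R u r -> r != 0 -> R u^-1 r^-1.
Proof. by case: plR => ? ? ? H *; apply: H. Qed.

Let Ps1 : Pos_seed Pos s1. Proof. exact: Pos_gmut. Qed.
Let Ps2 : Pos_seed Pos s2. Proof. exact: Pos_gmut. Qed.
Let rs0 : regular s0. Proof. exact: (Pos_regular posP). Qed.
Let rs1 : regular s1. Proof. exact: (Pos_regular posP). Qed.
Let rs2 : regular s2. Proof. exact: (Pos_regular posP). Qed.
Let sk1 : skew_by d (gB s1). Proof. exact: skew_by_mutate. Qed.
Let sk2 : skew_by d (gB s2). Proof. exact: skew_by_mutate. Qed.
Let x0 l : gx s0 l != 0. Proof. by case: rs0. Qed.
Let y0 l : gy s0 l != 0. Proof. by case: rs0. Qed.
Let ji : j != i. Proof. by rewrite eq_sym. Qed.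
Let N1 : -1 != 0 :> F. Proof. by rewrite oppr_eq0 oner_eq0. Qed.

Let R_X (a : 'I_n -> int) : R (zprod (gx s0) a) (zprod (gx s0) a).
Proof. by apply: place_zprod. Qed.

Let R_h1 : R (1 + hat s0 i) 0.
Proof. by rewrite -(addrN 1); apply: RD. Qed.

Lemma R_new_variable : R (gx s1 i) 0.
Proof.
rewrite gmut_x // mul1r -(mul0r (gx s0 i)^-1); apply: RM; last exact: RV.
by rewrite -(mulr0 (neg_monomial s0 i)); apply: RM; [exact: R_X|exact: R_h1].
Qed.

Lemma R_coef : exists2 v, v != 0 & R (gy s0 i) v.
Proof.
exists (-1 / zprod (gx s0) (B i)); first by rewrite mulf_neq0 ?invr_eq0 ?zprod_neq0.
rewrite -[gy s0 i](mulfK (zprod_neq0 (B i) x0)); apply: RM => //.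
by apply: RV; rewrite ?zprod_neq0.
Qed.

Lemma R_exp0 v (e : int) : R v 0 -> 0 < e -> R (v ^ e) 0.
Proof.
case: e => // -[|k] // Rv _; rewrite -[X in R _ X](mul0r (0 ^+ k)).
rewrite /exprz exprS; apply: RM => //.
by elim: k => [|k IH]; rewrite ?expr0 ?exprS //; apply: RM.
Qed.

(** The first mutation makes the variable of [i] vanish at the place. If it
    occurs in the exchange relation in direction [j], it does in one of the two
    terms only, and the other is not 0 at the place. If it does not occur, the
    whole relation is a positive element fixed by the place. *)
Lemma R_second_variable : exists2 r, r != 0 & R (gx s2 j) r.
Proof.
have [v v0 Rv] := R_coef.
have Rw : R (gx s1 i / gx s0 i) 0.
  by rewrite -(mul0r (gx s0 i)^-1); apply: RM; [exact: R_new_variable|exact: RV].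
have eP : pos_monomial s1 j = zprod (gx s0) (fun l => pospart (gB s1 j l)) *
    (gx s1 i / gx s0 i) ^ pospart (- B j i).
  by rewrite /pos_monomial zprod_gmut // mutate_matrixNr.
have eN : neg_monomial s1 j = zprod (gx s0) (fun l => pospart (- gB s1 j l)) *
    (gx s1 i / gx s0 i) ^ pospart (B j i).
  by rewrite /neg_monomial zprod_gmut // mutate_matrixNr opprK.
set zP := zprod _ _ in eP; set zN := zprod _ _ in eN.
have zP0 : zP != 0 by apply: zprod_neq0.
have zN0 : zN != 0 by apply: zprod_neq0.
have ey : gy s1 j = gy s0 j * gy s0 i ^ pospart (B j i).
  by rewrite ffunE (negPf ji) exp1rz mulr1.
have Rxj : R (gx s1 j)^-1 (gx s0 j)^-1 by rewrite gmut_xN //; apply: RV.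
have Ryj : R (gy s1 j) (gy s0 j * v ^ pospart (B j i)).
  by rewrite ey; apply: RM; [exact: Ry|exact: place_exprz].
have yj0 : gy s0 j * v ^ pospart (B j i) != 0 by rewrite mulf_neq0 ?expfz_neq0.
suff [r r0 Rr] : exists2 r, r != 0 & R (gy s1 j * pos_monomial s1 j + neg_monomial s1 j) r.
  exists (r / gx s0 j); first by rewrite mulf_neq0 ?invr_eq0.
  by rewrite ffunE eqxx mul1r; apply: RM.
have [g0|g0|g0] := ltgtP (B j i) 0.
- have {}eN : neg_monomial s1 j = zN by rewrite eN (pospart_le0 (ltW g0)) expr0z mulr1.
  exists zN => //; rewrite -(add0r zN) -(mulr0 (gy s0 j * v ^ pospart (B j i))) eN.
  apply: RD; last exact: R_X; apply: RM => //.
  rewrite eP -(mulr0 zP); apply: RM; first exact: R_X.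
  by apply: R_exp0 => //; rewrite pospart_id oppr_gte0 // ltW.
- have {}eP : pos_monomial s1 j = zP.
    by rewrite eP (@pospart_le0 (- B j i)) ?oppr_le0 1?ltW // expr0z mulr1.
  exists (gy s0 j * v ^ pospart (B j i) * zP); rewrite ?eP; first by rewrite mulf_neq0.
  rewrite -[X in R _ X]addr0; apply: RD; first by apply: RM => //; exact: R_X.
  rewrite eN -(mulr0 zN); apply: RM; first exact: R_X.
  by apply: R_exp0 => //; rewrite pospart_id // ltW.
exists (gy s0 j * zP + zN).
  case: Ps0 => Px Py; apply: Pos0; apply: PosD; last exact: Pos_zprod.
  by apply: PosM => //; exact: Pos_zprod.
rewrite eP eN ey g0 oppr0 pospart_id // !expr0z !mulr1.
by apply: RD; [apply: RM; [exact: Ry|exact: R_X]|exact: R_X].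
Qed.

Lemma one_plus_exp (g : F) m : exists q,
  (1 + g) ^+ m.+1 - 1 = g * q /\ (R g 0 -> R q m.+1%:R).
Proof.
exists (\sum_(k < m.+1) (1 + g) ^+ k); split.
  by rewrite subrX1 addrC addKr.
move=> Rg; have Rg1 : R (1 + g) 1 by rewrite -[X in R _ X]addr0; apply: RD.
have RX k : R ((1 + g) ^+ k) 1.
  elim: k => [|k IH]; rewrite ?expr0 // exprS -[X in R _ X]mulr1; exact: RM.
elim: m => [|m IH]; first by rewrite big_ord1 expr0.
by rewrite big_ord_recr -natr1; apply: RD.
Qed.

(** The third exchange divides by [t = gx s1 i], which vanishes at the place.
    Now [1 + hat s0 i] is a unit multiple of [t], and either [hat s1 j] or its
    inverse is a multiple of [t] when the directions interact; so [1 + hat s2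
    i] is a multiple of [t] too. Up to units, the quotient takes a positive
    value, hence not 0. *)
Lemma R_third_variable : exists2 r, r != 0 & R (gx s3 i) r.
Proof.
have [r2 r20 Rr2] := R_second_variable; have Px := proj1 Ps0.
have h10 := Pos_hat1 posP i Ps0; have h11 := Pos_hat1 posP j Ps1.
have h12 := Pos_hat1 posP i Ps2.
set h := hat s0 i; set t := gx s1 i.
have t0 : t != 0 by case: rs1 => x10 _; apply: x10.
pose kap := gx s0 i / neg_monomial s0 i.
have Pk : Pos kap by apply: PosM; [exact: Px|apply: PosV; apply: (Pos_zprod posP)].
have Rk : R kap kap by apply: RM => //; apply: RV; [exact: R_X|exact: neg_monomial_neq0].
have ekap : 1 + h = kap * t.
  by rewrite /t gmut_x // mul1r /kap -/h; field; rewrite neg_monomial_neq0 // x0.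
have h0 : h != 0 by apply: hat_neq0.
have RVh : R h^-1 (-1) by rewrite -[X in R _ X]invrN1; apply: RV.
suff [r r0 Rr] : exists2 r, r != 0 & R ((1 + hat s2 i) / t) r.
  have ex : gx s2 i = t by rewrite gmut_xN.
  rewrite gmut_x // mul1r ex -mulrA.
  pose x2 l := if l == i then 1 else if l == j then r2 else gx s0 l.
  have x20 l : x2 l != 0 by rewrite /x2; case: (l == i); [apply: oner_neq0|case: (l == j)].
  exists (zprod x2 (fun l => pospart (- gB s2 i l)) * r).
    by rewrite mulf_neq0 ?zprod_neq0.
  apply: RM => //; apply: place_zprod => // l.
  rewrite /x2; have [->|li] := eqVneq l i; first by rewrite (skew_by_ii _ sk2).
  by have [->//|lj _] := eqVneq l j; rewrite !gmut_xN.
have Bii : B i i = 0 by apply: skew_by_ii sk.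
have Bjj1 : gB s1 j j = 0 by apply: skew_by_ii sk1.
have eh1i : hat s1 i = h^-1 by rewrite (gmut_hat _ _ (oner_neq0 _)) // eqxx.
have eg : hat s1 j = hat s0 j * h ^ pospart (B j i) * (1 + h) ^ (- B j i).
  by rewrite (gmut_hat _ _ (oner_neq0 _)) // (negPf ji).
have eh2 : hat s2 i = h^-1 * hat s1 j ^ pospart (- B i j) * (1 + hat s1 j) ^ (B i j).
  by rewrite (gmut_hat _ _ (oner_neq0 _)) // (negPf ij) eh1i /= mutate_matrixNl opprK.
have Rhj : R (hat s0 j) (hat s0 j) by apply: RM; [exact: Ry|exact: R_X].
have Phj : Pos (hat s0 j) by apply: Pos_hat.
have Pm m : Pos m.+1%:R by apply: Pos_nat.
have RX0 T k : R T 0 -> R (T ^+ k.+1) 0.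
  by move=> RT; apply: (@R_exp0 T k.+1).
(* In both interacting cases the quotient has this shape up to units. Its value
   is [kap + u * m.+1%:R], or [kap] if a factor [T] is left. *)
have lin u T q m k : Pos u -> R u u -> R T 0 -> R q m.+1%:R ->
    exists2 r, r != 0 & R (kap + u * T ^+ k * q) r.
  move=> Pu Ru RT Rq; case: k => [|k].
    exists (kap + u * 1 * m.+1%:R); first by apply/Pos0/PosD/PosM => //; rewrite mulr1.
    by apply: RD => //; apply: RM => //; apply: RM.
  exists (kap + u * 0 * m.+1%:R); first by rewrite mulr0 mul0r addr0 Pos0.
  by apply: RD => //; apply: RM => //; apply: RM => //; apply: RX0.
have Rt : R t 0 by apply: R_new_variable.
have PkX k : Pos (kap ^+ k.+1) /\ R (kap ^+ k.+1) (kap ^+ k.+1).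
  by elim: k => [//|k [IH1 IH2]]; rewrite exprS; split; [apply: PosM|apply: RM].
have [g0|g0|g0] := ltgtP (B j i) 0.
- have bpos : 0 < B i j by rewrite (skew_by_gt0 _ _ sk).
  case eb: (B i j) bpos => [[|m]|] // _.
  case ec: (- B j i) (g0) => [[|k]|] //; rewrite -?oppr_gt0 ec // => _.
  set g := hat s1 j in eg eh2.
  have eg1 : g = hat s0 j * kap ^+ k.+1 * t ^+ k * t.
    by rewrite eg (pospart_le0 (ltW g0)) expr0z mulr1 ec ekap /exprz exprMn (exprSr t) !mulrA.
  have [q [eq Rq]] := one_plus_exp g m.
  have [Pkk Rkk] := PkX k.
  have Rg : R g 0.
    rewrite eg1 -mulrA -exprSr -(mulr0 (hat s0 j * kap ^+ k.+1)).
    by apply: RM; [apply: RM|apply: RX0].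
  have [r r0 Rr] := lin (hat s0 j * kap ^+ k.+1) t q m k (PosM Phj Pkk) (RM Rhj Rkk) Rt (Rq Rg).
  exists (-1 * r); first by rewrite mulf_neq0.
  have -> : (1 + hat s2 i) / t =
      h^-1 * (kap + hat s0 j * kap ^+ k.+1 * t ^+ k * q); last exact: RM.
  rewrite eh2 eb pospart_le0 ?oppr_le0 // expr0z mulr1 /exprz.
  have -> : (1 + g) ^+ m.+1 = 1 + g * q by rewrite -eq [RHS]addrC subrK.
  rewrite eg1; apply: (mulIf t0); rewrite divfK //; apply: (mulfI h0).
  rewrite mulrDr mulr1 !mulrA divff // !mul1r addrA (addrC h) ekap.
  by ring.
- have bneg : B i j < 0 by rewrite -(skew_by_gt0 _ _ sk).
  case eb: (- B i j) (bneg) => [[|m]|] //; rewrite -?oppr_gt0 eb // => _.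
  case ec: (B j i) (g0) => [[|k]|] // _.
  set g := hat s1 j in eg eh2.
  have g_neq0 : g != 0 by apply: hat_neq0.
  have [Pkk Rkk] := PkX k.
  pose u := (hat s0 j)^-1 * kap ^+ k.+1; pose T := h^-1 * t.
  have Pu : Pos u by apply: PosM => //; apply: PosV.
  have Ru : R u u by apply: RM => //; apply: RV => //; apply: Pos0.
  have RT : R T 0 by rewrite -(mulr0 (-1)); apply: RM.
  have eg1 : g^-1 = u * T ^+ k * T.
    have -> : g = hat s0 j * h ^+ k.+1 / (kap * t) ^+ k.+1.
      by rewrite eg ec pospart_id // ekap -invr_expz.
    have gen (a b c e : F) k' :
        (a * b ^+ k' / (c * e) ^+ k')^-1 = a^-1 * c ^+ k' * (b^-1 * e) ^+ k'.
      by rewrite !exprMn exprVn !invfM !invrK mulrACA.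
    by rewrite -[RHS]mulrA -exprSr; apply: gen.
  have [q [eq Rq]] := one_plus_exp g^-1 m.
  have Rg : R g^-1 0.
    by rewrite eg1 -mulrA -exprSr -(mulr0 u); apply: RM => //; apply: RX0.
  have [r r0 Rr] := lin u T q m k Pu Ru RT (Rq Rg).
  have eh2' : hat s2 i = h^-1 * ((1 + g^-1) ^+ m.+1)^-1.
    have eb' : B i j = - Posz m.+1 by rewrite -eb opprK.
    rewrite eh2 eb eb' pospart_id // -invr_expz.
    have -> : 1 + g^-1 = (1 + g) / g by field.
    have gen (a b : F) k' : b ^+ k' / a ^+ k' = ((a / b) ^+ k')^-1.
      by rewrite exprMn exprVn invfM invrK mulrC.
    by rewrite -mulrA gen.
  have W0 : (1 + g^-1) ^+ m.+1 != 0.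
    rewrite expf_neq0 // (_ : 1 + g^-1 = (1 + g) / g); last by field.
    by rewrite mulf_neq0 ?invr_eq0.
  have R1g : R ((1 + g^-1) ^+ m.+1) 1.
    rewrite -[X in R _ X]addr0 -[X in R X _](subrK 1) addrC; apply: RD => //.
    by rewrite eq -(mul0r m.+1%:R); apply: RM => //; apply: Rq.
  exists (-1 * 1^-1 * r); first by rewrite invr1 mulr1 mulf_neq0.
  have -> : (1 + hat s2 i) / t = hat s2 i * (kap + u * T ^+ k * q).
    have hT : h * T = t by rewrite /T mulVKf.
    apply: (mulIf t0); rewrite divfK // -[RHS]mulrA.
    have -> : (kap + u * T ^+ k * q) * t = 1 + h * (1 + g^-1) ^+ m.+1.
      have -> : (1 + g^-1) ^+ m.+1 = 1 + u * T ^+ k * T * q.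
        by rewrite -eg1 -eq [RHS]addrC subrK.
      have gen (a b c e v : F) : 1 + v * (1 + a * b * c * e) = (1 + v) + a * b * (v * c) * e.
        by ring.
      by rewrite gen ekap hT; ring.
    have gen (a b : F) : a != 0 -> b != 0 -> 1 + a^-1 * b^-1 = a^-1 * b^-1 * (1 + a * b).
      by move=> a0 b0; field; rewrite a0 b0.
    by rewrite eh2'; apply: gen.
  rewrite eh2'; apply: (RM) => //; apply: (RM) => //; apply: RV => //.
  exact: oner_neq0.
have b0 : B i j = 0 by apply/eqP; rewrite (skew_by_eq0 _ _ sk) g0.
exists (kap * -1); first by rewrite mulf_neq0 // Pos0.
rewrite eh2 b0 oppr0 pospart_id // !expr0z !mulr1.
have gen (a b c : F) : b != 0 -> c != 0 -> 1 + c = a * b -> (1 + c^-1) / b = a * c^-1.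
  move=> bn0 cn0 e; have -> : 1 + c^-1 = (1 + c) / c by field.
  by rewrite e; field; rewrite bn0 cn0.
by rewrite (gen _ _ _ t0 h0 ekap); apply: RM.
Qed.

End ThreeMutations.

(** * The Laurent phenomenon *)

Section TropInduction.
Variable n : nat.

Lemma trop_ind (Q : trop n -> Prop) : Q 1%g ->
    (forall a b, Q a -> Q b -> Q (a * b)%g) -> (forall a, Q a -> Q a^-1%g) ->
    (forall i, Q (trop_unit i)) ->
  forall a, Q a.
Proof.
move=> Q1 QM QV Qu a; pose s i (z : int) : trop n := [ffun j => (j == i)%:Z * z].
have Qs i z : Q (s i z).
  have Qn k : Q (s i k%:Z).
    elim: k => [|k IH].
      rewrite (_ : s i _ = 1%g) //; apply/ffunP => j; rewrite tropE !ffunE; lia.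
    rewrite (_ : s i _ = trop_unit i * s i k%:Z)%g; first exact: QM.
    by apply/ffunP => j; rewrite tropE !ffunE; lia.
  case: z => k; first exact: Qn.
  rewrite (_ : s i _ = (s i k.+1%:Z)^-1)%g; first exact: QV.
  by apply/ffunP => j; rewrite tropE !ffunE; lia.
rewrite (_ : a = \big[@monoid.mul (trop n)/1%g]_(i < n) s i (a i)); last first.
  apply/ffunP => j; rewrite (big_morph (fun b : trop n => b j) (id1 := 0) (op1 := +%R)).
  - rewrite (bigD1 j) //= ffunE eqxx mul1r big1 ?addr0 // => i ij.
    by rewrite ffunE eq_sym (negPf ij) mul0r.
  - by move=> b c; rewrite tropE ffunE.
  by rewrite tropE ffunE.
by apply: (big_ind Q).
Qed.

Lemma char_ext (R : comNzRingType) (phi psi : character (trop n) R) :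
  (forall i, phi (trop_unit i) = psi (trop_unit i)) -> forall a, phi a = psi a.
Proof.
move=> e; elim/trop_ind => [|a b ea eb|a ea|//]; rewrite ?char1 ?charM ?ea ?eb //.
have pV : phi a * phi a^-1%g = 1 by rewrite -charM monoid.mulgV char1.
have qV : psi a * psi a^-1%g = 1 by rewrite -charM monoid.mulgV char1.
by rewrite -[LHS]mul1r -qV -ea mulrAC pV mul1r.
Qed.

End TropInduction.

Section PowerDenominators.
Variables (A : idomainType) (d : A).
Implicit Types u v : {fraction A}.

Definition power_denom u := exists a f, u * tofrac d ^+ a = tofrac f.

Lemma power_denom_tofrac f : power_denom (tofrac f).
Proof. by exists 0%N, f; rewrite expr0 mulr1. Qed.

Lemma power_denomD u v : power_denom u -> power_denom v -> power_denom (u + v).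
Proof.
move=> [a [f ef]] [b [g eg]]; exists (a + b)%N, (f * d ^+ b + g * d ^+ a).
rewrite tofracD !tofracM !tofracXn -ef -eg exprD.
by move: (tofrac d ^+ a) (tofrac d ^+ b) => da db; ring.
Qed.

Lemma power_denomN u : power_denom u -> power_denom (- u).
Proof. by move=> [a [f ef]]; exists a, (- f); rewrite mulNr ef tofracN. Qed.

Lemma power_denomM u v : power_denom u -> power_denom v -> power_denom (u * v).
Proof.
move=> [a [f ef]] [b [g eg]]; exists (a + b)%N, (f * g).
by rewrite tofracM -ef -eg exprD mulrACA.
Qed.

Lemma power_denomV : d != 0 -> power_denom (tofrac d)^-1.
Proof. by move=> d0; exists 1%N, 1; rewrite expr1 mulVf ?tofrac_eq0 // tofrac1. Qed.

End PowerDenominators.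

Section CommonDenominator.
Variables (A : idomainType) (d : A) (sigma : {rmorphism A -> A}).
Hypotheses (d0 : d != 0) (sigma_d : sigma d = 0).
Hypothesis sigma_div : forall f, exists q, f = sigma f + d * q.

(** Let [u * d ^ (a + 1) = f] and [u = h / g] with [g] invertible at the place
    where [d] vanishes. Then [d] divides [f * g] but not [g]; as it generates
    the prime kernel of [sigma], it divides [f], and the denominator loses one
    factor [d]. *)
Lemma no_denominator (u : {fraction A}) r :
    local_place (@tofrac A \o sigma) u r -> power_denom d u ->
  exists f, u = tofrac f.
Proof.
move=> Rur [a [f]]; case: Rur => [h [g [sg eu _]]]; have g0 := sigma_neq0 sg.
have sg0 : sigma g != 0 by move: sg; rewrite /= tofrac_eq0.
elim: a f => [|a IH] f; first by rewrite expr0 mulr1; exists f.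
move=> e; have {}e1 : f * g = h * d ^+ a.+1.
  apply/eqP; rewrite -tofrac_eq !tofracM tofracXn -e eu mulrAC; apply/eqP.
  by rewrite divfK.
have sf : sigma f = 0.
  have /eqP : sigma (f * g) = 0.
    by rewrite e1 rmorphM rmorphXn /= sigma_d exprS mul0r mulr0.
  by rewrite rmorphM mulf_eq0 (negPf sg0) orbF => /eqP.
have [q eq] := sigma_div f; apply: (IH q).
have td0 : tofrac d != 0 by rewrite tofrac_eq0.
by apply: (mulIf td0); rewrite -mulrA -exprSr e eq sf add0r tofracM mulrC.
Qed.

End CommonDenominator.

Lemma unit_exprz_sub (R : comUnitRingType) (u v : R) (z : int) :
    u \is a GRing.unit -> v \is a GRing.unit ->
  exists q, u ^ z = v ^ z + (u - v) * q.
Proof.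
move=> uu uv; have nat_case k : exists q, u ^+ k = v ^+ k + (u - v) * q.
  by exists (\sum_(i < k) u ^+ (k.-1 - i) * v ^+ i); rewrite -subrXX [RHS]addrC subrK.
case: z => k; first exact: nat_case.
have [q e] := nat_case k.+1; exists (- (q / u ^+ k.+1 / v ^+ k.+1)).
rewrite !NegzE -!invr_expz -!exprnP.
have U : u ^+ k.+1 \is a GRing.unit by rewrite unitrX.
have V : v ^+ k.+1 \is a GRing.unit by rewrite unitrX.
have e' : (u - v) * q = u ^+ k.+1 - v ^+ k.+1 by rewrite e [RHS]addrC addKr.
rewrite mulrN !mulrA e' (mulrBl (_^-1)) mulrV // mulrBl mul1r mulrAC mulrV //.
by rewrite mul1r opprB addrC subrK.
Qed.

(** A difference of powers is divisible by the difference of the bases. *)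
Lemma trop_char_change n (R : comUnitRingType) (x y : 'I_n -> R) i a :
    (forall l, x l \is a GRing.unit) -> (forall l, y l \is a GRing.unit) ->
    (forall l, l != i -> x l = y l) ->
  exists q, trop_char x a = trop_char y a + (x i - y i) * q.
Proof.
move=> ux uy exy; have [q e] := unit_exprz_sub (a i) (ux i) (uy i).
exists (q * \prod_(l < n | l != i) y l ^ a l).
rewrite (trop_charD1 i a ux) (trop_charD1 i a uy) e mulrA -mulrDl; congr (_ * _).
by apply: eq_bigr => l /exy->.
Qed.

Lemma add_mulr_common (R : comPzRingType) (u v c q w : R) : u = v + c * q ->
  u * w = v * w + c * (q * w).
Proof. by move=> ->; rewrite mulrDl mulrA. Qed.

Section UniversalPlace.
Variables (n : nat) (G : laurent_group (trop n) n).
Local Notation A := (group_ring G).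
Local Notation F := ({fraction A}).
Variables (B : 'M[int]_n) (i : 'I_n).

Lemma mX_char_subproof (a b : trop n) :
  mon (lmk G 1%g (a * b)%g) = mon (lmk G 1%g a) * mon (lmk G 1%g b).
Proof. by rewrite -monM -lmkM monoid.mul1g. Qed.

Definition mX_char : character (trop n) A :=
  Character (congr1 (@mon G) (lmk1 G)) mX_char_subproof.

Lemma mY_char_subproof (a b : trop n) :
  mon (lmk G (a * b)%g 1%g) = mon (lmk G a 1%g) * mon (lmk G b 1%g).
Proof. by rewrite -monM -lmkM monoid.mul1g. Qed.

Definition mY_char : character (trop n) A :=
  Character (congr1 (@mon G) (lmk1 G)) mY_char_subproof.

Lemma mX_charE a : trop_char (fun l => mon (lX G l)) a = mX_char a.
Proof.
by apply: char_ext => l; rewrite trop_char_unit //; apply: mon_unit.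
Qed.

Lemma mY_charE a : trop_char (fun l => mon (mY G l)) a = mY_char a.
Proof.
by apply: char_ext => l; rewrite trop_char_unit //; apply: mon_unit.
Qed.

Lemma mon_split (g : G) : mon g = mY_char (lcoef g) * mX_char (lexp g).
Proof. by rewrite -monM -lmkM monoid.mulg1 monoid.mul1g lmkK. Qed.

Lemma zprod_uX (a : 'I_n -> int) :
  zprod (@uX n G) a = tofrac (mX_char [ffun l => a l]).
Proof.
pose phi : character (trop n) F := @Character _ _ (fun a => tofrac (mX_char a))
  (etrans (congr1 _ (char1 mX_char)) (rmorph1 _))
  (fun a b => etrans (congr1 _ (charM mX_char a b)) (tofracM _ _)).
transitivity (trop_char (@uX n G) [ffun l => a l]).
  rewrite trop_charE; last exact: (@uX_neq0 n G).
  by apply: eq_zprod => // l; rewrite ffunE.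
apply: (@char_ext _ _ _ phi) => l; rewrite trop_char_unit //.
by rewrite unitfE; apply: (@uX_neq0 n G).
Qed.

(** The value of the coefficient [Y_i] that makes the exchange relation in
    direction [i] vanish. *)
Definition root_i : A := - mX_char [ffun l => - B i l].

Lemma root_i_unit : root_i \is a GRing.unit.
Proof. by rewrite unitrN; apply: mon_unit. Qed.

Definition sigmaY l : A := if l == i then root_i else mon (mY G l).

Lemma sigmaY_i : sigmaY i = root_i.
Proof. by rewrite /sigmaY eqxx. Qed.

Lemma sigmaY_neq l : l != i -> sigmaY l = mon (mY G l).
Proof. by move=> /negPf li; rewrite /sigmaY li. Qed.

Lemma sigmaY_unit l : sigmaY l \is a GRing.unit.
Proof. by rewrite /sigmaY; case: eqP => _; [apply: root_i_unit|apply: mon_unit]. Qed.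

(** The retraction onto the Laurent polynomials without [Y_i] that replaces
    [Y_i] by the root of the exchange relation; its kernel is generated by
    [denom]. *)
Definition sigma : {rmorphism A -> A} :=
  gmap (lmon_char G (trop_char sigmaY) (fun l => mon (lX G l))).

Definition denom : A := mon (mY G i) - root_i.

Lemma sigma_mon g : sigma (mon g) = trop_char sigmaY (lcoef g) * mX_char (lexp g).
Proof. by apply: (etrans (gmap_mon _ g)); congr (_ * _); apply: mX_charE. Qed.

Lemma sigma_X l : sigma (mon (lX G l)) = mon (lX G l).
Proof. by apply: eval_lX; apply: mon_unit. Qed.

Lemma sigma_Y l : sigma (mon (mY G l)) = sigmaY l.
Proof. by apply: eval_mY; apply: sigmaY_unit. Qed.

Lemma sigma_Yi : sigma (mon (mY G i)) = root_i.
Proof. by rewrite sigma_Y sigmaY_i. Qed.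

Lemma sigma_mX_char a : sigma (mX_char a) = mX_char a.
Proof. by rewrite sigma_mon lcoef_mk lexp_mk char1 mul1r. Qed.

Lemma sigma_denom : sigma denom = 0.
Proof.
by rewrite rmorphB sigma_Yi rmorphN sigma_mX_char subrr.
Qed.

Lemma denom_neq0 : denom != 0.
Proof.
have e : aug denom = 2 by rewrite /denom /root_i opprK augD !aug_mon.
by apply/eqP => d0; move: e; rewrite d0 aug0.
Qed.

Lemma sigma_division f : exists q, f = sigma f + denom * q.
Proof.
elim/group_ring_ind: f => [|f g [q eq] [r er]|f [q eq]|g].
- by exists 0; rewrite rmorph0 mulr0 addr0.
- by exists (q + r); rewrite rmorphD {1}eq {1}er mulrDr addrACA.
- by exists (- q); rewrite rmorphN {1}eq mulrN opprD.
have umY l : mon (mY G l) \is a GRing.unit by apply: mon_unit.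
have off l : l != i -> mon (mY G l) = sigmaY l by move=> li; rewrite sigmaY_neq.
have [q eq] := trop_char_change (lcoef g) umY sigmaY_unit off.
exists (q * mX_char (lexp g)); rewrite sigma_mon mon_split -mY_charE.
by rewrite sigmaY_i in eq; exact: add_mulr_common eq.
Qed.

Local Notation R := (local_place (@tofrac A \o sigma)).

Lemma R_uX l : R (uX G l) (uX G l).
Proof.
rewrite [X in R _ X](_ : _ = (@tofrac A \o sigma) (mon (lX G l))).
  exact: local_place_tofrac.
by rewrite /= sigma_X.
Qed.

Lemma R_uY l : l != i -> R (uY G l) (uY G l).
Proof.
move=> li; rewrite [X in R _ X](_ : _ = (@tofrac A \o sigma) (mon (mY G l))).
  exact: local_place_tofrac.
by rewrite /= sigma_Y sigmaY_neq.
Qed.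

Lemma hat_useed : hat (useed G B) i = tofrac (mon (mY G i) * mX_char [ffun l => B i l]).
Proof.
rewrite /hat ffunE tofracM -zprod_uX; congr (_ * _).
by apply: eq_zprod => // l _; rewrite ffunE.
Qed.

Lemma root_hat : root_i * mX_char [ffun l => B i l] = -1.
Proof.
rewrite mulNr -charM; congr (- _); rewrite -[RHS](char1 mX_char); congr (mX_char _).
by apply/ffunP => l; rewrite !tropE !ffunE addNr.
Qed.

Lemma R_hat : R (hat (useed G B) i) (-1).
Proof.
rewrite hat_useed [X in R _ X](_ : _ = (@tofrac A \o sigma)
  (mon (mY G i) * mX_char [ffun l => B i l])).
  exact: local_place_tofrac.
by rewrite /= rmorphM sigma_Yi sigma_mX_char root_hat rmorphN1.
Qed.

Lemma first_variable : exists a,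
  gx (gmut i 1 (useed G B)) i = tofrac (mX_char a) * tofrac denom.
Proof.
have rs := useed_regular G B.
exists [ffun l => pospart (- B i l) + (- (trop_unit i : trop n) l) + B i l].
rewrite gmut_x // mul1r -zprod_uX.
have x0 l : uX G l != 0 :> F := @uX_neq0 n G l.
rewrite (zprodDf (fun l => pospart (- B i l) + - (trop_unit i : trop n) l)) // zprodDf // zprodN.
rewrite zprod_unitv.
have -> : 1 + hat (useed G B) i = zprod (@uX n G) (B i) * tofrac denom.
  rewrite hat_useed zprod_uX -tofracM -[X in X + _]tofrac1 -tofracD.
  by rewrite mulrBr [_ * root_i]mulrC root_hat opprK addrC mulrC.
have -> : neg_monomial (useed G B) i = zprod (@uX n G) (fun l => pospart (- B i l)).
  by apply: eq_zprod => // l _; rewrite ffunE.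
have gen (K : fieldType) (a b c e : K) : a * (b * e) / c = a / c * b * e.
  by rewrite mulrA mulrAC [a * b / c]mulrAC.
by rewrite [gx _ i]ffunE; apply: gen.
Qed.

End UniversalPlace.

Section LaurentPhenomenon.
Variables (n : nat) (G : laurent_group (trop n) n).
Local Notation A := (group_ring G).
Local Notation F := ({fraction A}).
Implicit Types (B : 'M[int]_n) (i j k l : 'I_n) (ks : seq 'I_n).

Lemma unzip1_unit_path (K : fieldType) ks : unzip1 (unit_path K ks) = ks.
Proof. by rewrite /unzip1 -map_comp map_id. Qed.

Lemma gmut_scale (K : fieldType) (s : gseed n K) k c :
  gx (gmut k c s) k = c * gx (gmut k 1 s) k.
Proof. by rewrite !ffunE eqxx mul1r mulrA. Qed.

Section AbstractField.
Variables (K : fieldType) (Pos U : K -> Prop) (s : gseed n K) (d : 'I_n -> rat).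
Hypotheses (pP : positive Pos) (sU : subgroup U) (sk : skew_by d (gB s)).
Hypotheses (Ps : Pos_seed Pos s) (Uy : forall j, U (gy s j)).

Let U1 : U 1. Proof. by case: sU. Qed.

Lemma laurent_unit_path ks : universally_laurent G (gB s) ks ->
  forall l, laurent U (gx s) (gx (gpath s (unit_path K ks)) l).
Proof.
move=> uni; apply: (laurent_specialization (G := G) _ sU sk Uy).
- by rewrite unzip1_unit_path.
- by move=> _ /mapP[k _ ->].
- exact: (Pos_nzpath pP).
Qed.

(** Starting at the neighbour of [s] in direction [i], the first step of the
    path leads to [s]: this turns expansions in the cluster of [s] along [ks]
    into expansions in the neighbouring cluster. *)
Lemma laurent_neighbour_path i ks :
    universally_laurent G (mutate_matrix (gB s) i) (i :: ks) ->
  forall l, laurent U (gx (gmut i 1 s)) (gx (gpath s (unit_path K ks)) l).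
Proof.
move=> uni l; have P1 : Pos 1 by case: pP.
have Ps' : Pos_seed Pos (gmut i 1 s) by apply: Pos_gmut.
have e : gmut i (1 * gy s i) (gmut i 1 s) = s.
  apply: gmutK; [exact: (Pos_regular pP Ps)|exact: oner_neq0|exact: (Pos_hat1 pP i Ps)|].
  exact: skew_by_ii sk.
pose path := (i, 1 * gy s i) :: unit_path K ks.
have -> : gpath s (unit_path K ks) = gpath (gmut i 1 s) path by rewrite /path /= e.
apply: (laurent_specialization (G := G) (d := d)) => //.
- by rewrite /= -/(unzip1 _) unzip1_unit_path.
- exact: skew_by_mutate.
- by apply: subgroup_gmut.
- by move=> kc; rewrite inE => /orP[/eqP->|/mapP[k _ ->] //]; rewrite mul1r; apply: Uy.
- split; first by case: (Pos_regular pP Ps').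
  by rewrite [gmut _ _ _]e; apply: (Pos_nzpath pP).
Qed.

End AbstractField.

Lemma laurent_tofrac (x : 'I_n -> F) u :
    (forall l, exists2 f, x l = tofrac f & exists g, (x l)^-1 = tofrac g) ->
  laurent (@Ymon n G) x u -> exists f, u = tofrac f.
Proof.
move=> hx; apply: (@laurent_sub _ _ _ (fun v => exists f, v = tofrac f)) =>
  [_ [b ->]|l|l||_ _ [f ->] [g ->]|_ [f ->]|_ _ [f ->] [g ->]].
- by eexists.
- by have [f -> _] := hx l; exists f.
- by have [_ _ [g ->]] := hx l; exists g.
- by exists 0; rewrite tofrac0.
- by exists (f + g); rewrite tofracD.
- by exists (- f); rewrite tofracN.
- by exists (f * g); rewrite tofracM.
Qed.

Lemma Ymon_useed B j : @Ymon n G (gy (useed G B) j).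
Proof. by rewrite ffunE; apply: Ymon_uY. Qed.

Lemma mon_tofracV (g : G) : exists f, (tofrac (mon g))^-1 = tofrac f.
Proof. by exists (mon g^-1%g); rewrite tofrac_monV. Qed.

(** Two mutations at [i] with normalizing factor 1 divide [X_i] by [Y_i], so
    that the two clusters have the same Laurent polynomials. *)
Lemma universal_laurent_back B d i ks : skew_by d B ->
  universally_laurent G B ks -> universally_laurent G B (i :: i :: ks).
Proof.
move=> sk uni l; set s0 := useed G B.
pose s1 := gmut i 1 s0; pose s2 := gmut i 1 s1.
have P1 := Pos1 G; have pP := Pos_positive G; have sU := Ymon_subgroup G.
have Ps0 := Pos_useed G B; have Ps1 : Pos_seed (@Pos G) s1 := Pos_gmut pP i Ps0 P1.
have Ps2 : Pos_seed (@Pos G) s2 := Pos_gmut pP i Ps1 P1.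
have U1 : @Ymon n G 1 by case: sU.
have e0 : gmut i (1 * gy s0 i) s1 = s0.
  apply: gmutK; [exact: useed_regular|exact: oner_neq0|exact: (Pos_hat1 pP)|].
  exact: skew_by_ii sk.
have eB : gB s2 = B by apply: mutate_matrixK.
apply: (@laurent_tofrac (gx s2)) => [k|]; last first.
  have Uy1 : forall k, @Ymon n G (gy s1 k) := subgroup_gmut sU i (Ymon_useed B) U1.
  have Uy2 : forall k, @Ymon n G (gy s2 k) := subgroup_gmut sU i Uy1 U1.
  have sk2 : skew_by d (gB s2) by rewrite eB.
  by apply: (laurent_unit_path (s := s2) pP sU sk2 Ps2 Uy2); rewrite eB.
have [->|ki] := eqVneq k i; last first.
  rewrite !gmut_xN // ffunE; exists (mon (lX G k)) => //; exact: mon_tofracV.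
have e1 : gx s0 i = (1 * gy s0 i) * gx s2 i :=
  etrans (congr1 (fun s => gx s i) (esym e0)) (gmut_scale s1 i _).
have eX : gx s0 i = uX G i by rewrite ffunE.
have eY : gy s0 i = uY G i by rewrite ffunE.
rewrite eX eY mul1r in e1.
have -> : gx s2 i = tofrac (mon ((mY G i)^-1 * lX G i)%g).
  by rewrite tofrac_monM tofrac_monV [tofrac (mon (lX G i))]e1 mulKf ?uY_neq0.
by eexists; [reflexivity|apply: mon_tofracV].
Qed.

(** The variables of this cluster are those of the universal seed, but for one,
    which is a monomial times [denom]. *)
Lemma bounded_denominator B i u :
    laurent (@Ymon n G) (gx (gmut i 1 (useed G B))) u ->
  power_denom (denom G B i) u.
Proof.
apply: laurent_sub.
- by move=> _ [b ->]; apply: power_denom_tofrac.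
- move=> k; have [->|ki] := eqVneq k i.
    have [c ->] := first_variable G B i.
    by apply: power_denomM; apply: power_denom_tofrac.
  by rewrite gmut_xN ?ffunE //; apply: power_denom_tofrac.
- move=> k; have [->|ki] := eqVneq k i.
    have [c ->] := first_variable G B i; have [g eg] := mon_tofracV (lmk G 1%g c).
    rewrite invfM; apply: power_denomM; last exact/power_denomV/denom_neq0.
    by rewrite eg; apply: power_denom_tofrac.
  rewrite gmut_xN ?ffunE //; have [g ->] := mon_tofracV (lX G k).
  exact: power_denom_tofrac.
- by rewrite -tofrac0; apply: power_denom_tofrac.
- exact: power_denomD.
- exact: power_denomN.
- exact: power_denomM.
Qed.

(** The variables of the cluster obtained by mutating at [i], [j] and again [i]
    are finite at the place where [denom] vanishes, and so are their inverses.
    *)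
Lemma defined_at_root B d i j u : skew_by d B -> i != j ->
    laurent (@Ymon n G) (gx (gmut i 1 (gmut j 1 (gmut i 1 (useed G B))))) u ->
  exists r, local_place (@tofrac A \o sigma G B i) u r.
Proof.
move=> sk ij; set R := local_place _.
have plR : place R := local_place_place _.
have [R1 RD RM RV R0] := plR.
have pP := Pos_positive G; have Ps0 := Pos_useed G B.
have Rt f : exists r, R (tofrac f) r by eexists; apply: local_place_tofrac.
have RX h : R (gx (useed G B) h) (gx (useed G B) h) by rewrite ffunE; apply: R_uX.
have RY h : h != i -> R (gy (useed G B) h) (gy (useed G B) h).
  by move=> hi; rewrite ffunE; apply: R_uY.
have RH : R (hat (useed G B) i) (-1) by apply: R_hat.
have H3 := @R_third_variable n _ _ R pP plR (useed G B) d i j sk Ps0 ij RX RY RH.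
have H2 := R_second_variable pP plR Ps0 ij RX RY RH.
have Rx3 k : exists2 r, r != 0 & R (gx (gmut i 1 (gmut j 1 (gmut i 1 (useed G B)))) k) r.
  have [->|ki] := eqVneq k i; first exact: H3.
  rewrite gmut_xN //; have [->|kj] := eqVneq k j.
    exact: H2.
  by rewrite !gmut_xN //; exists (gx (useed G B) k); [rewrite ffunE; apply: uX_neq0|].
apply: (@laurent_sub _ _ _ (fun v => exists r, R v r)).
- by move=> _ [b ->]; apply: Rt.
- by move=> k; have [r _ Rr] := Rx3 k; exists r.
- by move=> k; have [r r0 Rr] := Rx3 k; exists r^-1; apply: RV.
- by rewrite -tofrac0; apply: Rt.
- by move=> v w [r Rr] [t Rt']; exists (r + t); apply: RD.
- move=> v [r Rr]; rewrite -mulN1r -tofrac1 -tofracN.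
  by have [t Rt'] := Rt (-1); exists (t * r); apply: RM.
- by move=> v w [r Rr] [t Rt']; exists (r * t); apply: RM.
Qed.

(** Induction on the length of the path, which may be taken to start with two
    different directions [i] and [j]. The rest of the path, without its first
    step, starts at the mutation at [i] of the universal seed; expanding there
    leaves only powers of [denom] as denominators. The same final seed is
    reached from the mutation at [i], [j], [i] by a path of the same length;
    expanding there shows that the variable is finite where [denom] vanishes.
    Together, these leave no denominator. *)
Theorem universal_laurent ks B d : skew_by d B -> universally_laurent G B ks.
Proof.
have [m] := ubnP (size ks); elim: m ks B => // m IH [|i [|j ks]] B.
- by move=> _ _ l; rewrite ffunE; eexists.
- move=> _ sk l; rewrite -[gpath _ _]/(gmut i 1 (useed G B)).
  have [->|li] := eqVneq l i.
    by have [a ->] := first_variable G B i; rewrite -tofracM; eexists.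
  by rewrite gmut_xN // ffunE; eexists.
move=> sz sk; rewrite /= !ltnS in sz.
have [<-|ij] := eqVneq i j.
  by apply: (universal_laurent_back i sk); apply: IH => //; apply: ltnW.
move=> l; set s0 := useed G B; pose s1 := gmut i 1 s0.
pose s2 := gmut j 1 s1; pose s3 := gmut i 1 s2.
have P1 := Pos1 G; have pP := Pos_positive G; have sU := Ymon_subgroup G.
have U1 : @Ymon n G 1 by case: sU.
have Ps0 := Pos_useed G B; have Ps1 : Pos_seed (@Pos G) s1 := Pos_gmut pP i Ps0 P1.
have Ps2 : Pos_seed (@Pos G) s2 := Pos_gmut pP j Ps1 P1.
have Ps3 : Pos_seed (@Pos G) s3 := Pos_gmut pP i Ps2 P1.
have sk1 : skew_by d (gB s1) := skew_by_mutate i sk.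
have sk2 : skew_by d (gB s2) := skew_by_mutate j sk1.
have sk3 : skew_by d (gB s3) := skew_by_mutate i sk2.
have Uy0 : forall k, @Ymon n G (gy s0 k) := Ymon_useed B.
have Uy1 : forall k, @Ymon n G (gy s1 k) := subgroup_gmut sU i Uy0 U1.
have Uy2 : forall k, @Ymon n G (gy s2 k) := subgroup_gmut sU j Uy1 U1.
have Uy3 : forall k, @Ymon n G (gy s3 k) := subgroup_gmut sU i Uy2 U1.
have L1 := laurent_unit_path pP sU sk1 Ps1 Uy1 (IH (j :: ks) _ sz sk1) l.
have L3 := laurent_neighbour_path pP sU sk2 Ps2 Uy2 (IH (i :: ks) _ sz sk3) l.
rewrite -[gpath s0 _]/(gpath s2 (unit_path F ks)); set u := gx _ l.
rewrite -[gpath s1 _]/(gpath s2 (unit_path F ks)) -/u in L1; rewrite -/u in L3.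
move: u L1 L3 => u L1 L3.
have [r Rr] := defined_at_root sk ij L3.
exact: (no_denominator (denom_neq0 G B i) (sigma_denom G B i) (sigma_division B i) Rr
  (bounded_denominator L1)).
Qed.

End LaurentPhenomenon.

Theorem laurent_phenomenon n (K : fieldType) (U : K -> Prop) (s : gseed n K) d
    (ks : seq ('I_n * K)) :
    subgroup U -> skew_by d (gB s) -> (forall j, U (gy s j)) ->
    (forall kc, kc \in ks -> U kc.2) -> nzpath s ks ->
  forall l, laurent U (gx s) (gx (gpath s ks) l).
Proof.
move=> sU sk Uy Uc nz; apply: (@laurent_specialization n (lmon_group _ _) _ _ s d) => //.
exact: universal_laurent sk.
Qed.

(** * Algebraic independence over the group ring *)

Section Free.
Variables (P : semifieldType) (n : nat) (G : laurent_group P n).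
Variables (K : fieldType) (chi : character P K).
Local Notation A := (group_ring G).
Implicit Types (x : 'I_n -> K) (f g : A) (k : 'I_n).

Definition ev x : A -> K := gmap (lmon_char G chi x).
HB.instance Definition _ x := GRing.RMorphism.on (ev x).

(** Algebraic independence over [P], tested on Laurent polynomials. *)
Definition laurent_free x := (forall i, x i != 0) /\ forall f, ev x f = 0 -> f = 0.

Lemma ev_mon x (g : G) : (forall i, x i != 0) ->
  ev x (mon g) = chi (lcoef g) * zprod x (lexp g).
Proof. by move=> x0; rewrite /ev gmap_mon -trop_charE. Qed.

Lemma ev_lmk x p a : (forall i, x i != 0) ->
  ev x (mon (lmk G p a)) = chi p * zprod x a.
Proof. by move=> x0; rewrite ev_mon // lcoef_mk lexp_mk. Qed.

Lemma evM x : {morph ev x : f g / f * g}. Proof. exact: rmorphM. Qed.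
Lemma evD x : {morph ev x : f g / f + g}. Proof. exact: rmorphD. Qed.
Lemma evN x : {morph ev x : f / - f}. Proof. exact: rmorphN. Qed.
Lemma ev0 x : ev x 0 = 0. Proof. exact: rmorph0. Qed.
Lemma ev1 x : ev x 1 = 1. Proof. exact: rmorph1. Qed.
Lemma evX x m : {morph ev x : f / f ^+ m}. Proof. exact: rmorphXn. Qed.

Lemma char_neq0 p : chi p != 0.
Proof.
apply/eqP => e; have := char1 chi; rewrite -(monoid.mulgV p) charM e mul0r.
by move/eqP; rewrite eq_sym oner_eq0.
Qed.

Lemma charV p : chi p^-1%g = (chi p)^-1.
Proof.
apply: (mulfI (char_neq0 p)); rewrite divff ?char_neq0 // -charM.
by rewrite monoid.mulgV char1.
Qed.

Lemma ev_inj x : laurent_free x -> injective (ev x).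
Proof.
move=> [_ fx] f g e; apply/eqP; rewrite -subr_eq0; apply/eqP/fx.
by rewrite evD evN e subrr.
Qed.

Definition flip k (a : trop n) : trop n := [ffun l => if l == k then - a k else a l].

(** Laurent polynomials are not stable under the substitution of [q / x_k] for
    [x_k], but become so after multiplication by a large power of [q]. If [f]
    vanishes at [x'], the resulting [h] vanishes at [x] and thus is 0;
    evaluating it at [x'] gives back the value of [f] at [x]. *)
Lemma laurent_free_replace x x' k q : laurent_free x -> q != 0 ->
    (forall l, l != k -> x' l = x l) -> x k * x' k = ev x q ->
    ev x' q = ev x q ->
  laurent_free x'.
Proof.
move=> [x0 fx] q0 xx' exk eq; pose Q := ev x q.
have Q0 : Q != 0 by apply: contra_neq q0; apply: fx.
have x'0 l : x' l != 0.
  have [->|lk] := eqVneq l k; last by rewrite xx'.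
  by apply: contra_neq Q0 => e; rewrite /Q -exk e mulr0.
have zx' (a : trop n) : zprod x' a = zprod x a * (Q / x k / x k) ^ a k.
  rewrite /zprod (bigD1 k) // [in RHS](bigD1 k) //=.
  rewrite (eq_bigr (fun i => x i ^ a i)) => [|i ik]; last by rewrite xx'.
  have -> : x' k = x k * (Q / x k / x k) by rewrite /Q -exk; field; rewrite x0.
  by rewrite (expfzMl (x k)); apply: mulrAC.
have zflip (a : trop n) : zprod x (flip k a) = zprod x a * (x k ^ a k * x k ^ a k)^-1.
  rewrite /zprod (bigD1 k) // [in RHS](bigD1 k) //= ffunE eqxx -invr_expz.
  rewrite (eq_bigr (fun i => x i ^ a i)) => [|i ik]; last by rewrite ffunE (negPf ik).
  have: x k ^ a k != 0 by rewrite expfz_neq0.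
  by move: (x k ^ a k) (\prod_(i | _) _) => u v u0; field.
suff H f : exists N, forall M, (N <= M)%N ->
    exists h, ev x' f * Q ^+ M = ev x h /\ ev x' h = Q ^+ M * ev x f.
  split=> // f f0; have [N /(_ N (leqnn N)) [h [e1 e2]]] := H f.
  have h0 : h = 0 by apply: fx; rewrite -e1 f0 mul0r.
  apply: fx; apply/eqP; move/eqP: e2; rewrite h0 ev0 eq_sym mulf_eq0.
  by rewrite expf_eq0 (negPf Q0) andbF.
elim/group_ring_ind: f => [|f g [N Hf] [N' Hg]|f [N Hf]|g].
- by exists 0%N => M _; exists 0; rewrite !ev0 mul0r mulr0.
- exists (maxn N N') => M; rewrite geq_max => /andP[/Hf[h [e1 e2]] /Hg[h' [e1' e2']]].
  by exists (h + h'); rewrite !evD mulrDl mulrDr e1 e1' e2 e2'.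
- exists N => M /Hf[h [e1 e2]]; exists (- h).
  by rewrite !evN mulNr mulrN e1 e2.
pose z := lexp g k; exists `|z|%N => M zM.
have [m em] : exists m : nat, Posz m = M%:Z + z by exists (absz (M%:Z + z)%R); lia.
exists (mon (lmk G (lcoef g) (flip k (lexp g))) * q ^+ m).
have Qm : Q ^+ m = Q ^+ M * Q ^ z by rewrite [LHS]exprnP em expfzDr.
have xk0 : x k ^ z != 0 by rewrite expfz_neq0.
have Qz0 : Q ^ z != 0 by rewrite expfz_neq0.
rewrite !evM !evX eq -/Q Qm !ev_lmk // !ev_mon // !zx' !zflip ffunE eqxx -/z.
have zq : (Q / x k / x k) ^ z = Q ^ z / x k ^ z / x k ^ z.
  by rewrite !expfzMl !exprz_inv -!invr_expz.
rewrite -(invr_expz _ z) zq.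
move: (x k ^ z) (Q ^ z) (Q ^+ M) xk0 Qz0 => u v w u0 v0.
by split; field; rewrite ?u0 ?v0.
Qed.

(** The right-hand side of an exchange relation. *)
Definition binom (c y : P) (b : 'I_n -> int) : A :=
  mon (lmk G (c * y)%g [ffun l => pospart (b l)]) + mon (lmk G c [ffun l => pospart (- b l)]).

Lemma aug_binom c y b : aug (binom c y b) = 2.
Proof. by rewrite augD !aug_mon. Qed.

Lemma binom_neq0 c y b : binom c y b != 0.
Proof. by apply/eqP => e; have := aug_binom c y b; rewrite e aug0. Qed.

Lemma ev_binom x c y b : (forall i, x i != 0) ->
  ev x (binom c y b) =
    chi c * (chi y * zprod x (fun l => pospart (b l)) + zprod x (fun l => pospart (- b l))).
Proof.
move=> x0; rewrite evD !ev_lmk // charM mulrDr mulrA; congr (_ * _ + _ * _).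
  by apply: eq_zprod => // l; rewrite ffunE.
by apply: eq_zprod => // l; rewrite ffunE.
Qed.

Lemma ev_binom_eq x x' c y b : (forall i, x i != 0) -> (forall i, x' i != 0) ->
  (forall i, b i != 0 -> x i = x' i) -> ev x (binom c y b) = ev x' (binom c y b).
Proof.
move=> x0 x'0 e; rewrite !ev_binom //; congr (_ * (_ * _ + _));
  by apply: eq_zprod => // l; rewrite /pospart => bl; apply: e; lia.
Qed.

Lemma exchange_relation (s : gseed n K) k c y :
    (forall i, gx s i != 0) -> gy s k = chi y ->
  gx s k * gx (gmut k (chi c) s) k = ev (gx s) (binom c y (gB s k)).
Proof.
by move=> x0 ey; rewrite ffunE eqxx ev_binom // mulrC divfK // ey.
Qed.

Lemma laurent_free_gmut (s : gseed n K) k c y :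
    laurent_free (gx s) -> gB s k k = 0 -> gy s k = chi y ->
  laurent_free (gx (gmut k (chi c) s)).
Proof.
move=> fx Bkk ey; have x0 := fx.1; have eq := exchange_relation c x0 ey.
have q0 := binom_neq0 c y (gB s k).
have x'N l : l != k -> gx (gmut k (chi c) s) l = gx s l by move=> lk; rewrite gmut_xN.
have Q0 : ev (gx s) (binom c y (gB s k)) != 0 by apply: contra_neq q0; apply: fx.2.
apply: (laurent_free_replace fx q0 x'N eq); apply: ev_binom_eq => //.
  move=> l; have [->|lk] := eqVneq l k; last by rewrite x'N.
  by apply: contra_neq Q0 => e; rewrite -eq e mulr0.
by move=> l; have [->|lk _] := eqVneq l k; [rewrite Bkk|rewrite x'N].
Qed.

End Free.

(** * Seeds with coefficients in a semifield *)

Section CoefficientSeeds.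
Variables (n : nat) (P : semifieldType) (K : fieldType) (chi : character P K).
Implicit Types (k : 'I_n) (p q : P).

Lemma char_expgz p (a : int) : chi (expgz p a) = chi p ^ a.
Proof.
have nat_case m : chi (p ^+ m)%g = chi p ^+ m.
  elim: m => [|m IH]; first by rewrite monoid.expg0 char1.
  by rewrite monoid.expgS exprS charM IH.
case: a => m; first exact: nat_case.
by rewrite /= charV NegzE -invr_expz /= nat_case.
Qed.

(** The seeds of a cluster algebra, with the ambient field replaced by any
    field that receives the semifield through a character. *)
Record cseed := CSeed {
  cx : {ffun 'I_n -> K};
  cy : {ffun 'I_n -> P};
  cB : 'M[int]_n }.

Implicit Types T : cseed.

Definition fseed T : gseed n K := GSeed (cx T) [ffun j => chi (cy T j)] (cB T).

Definition gauge T k : P := (oplus (cy T k) 1%g)^-1%g.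

Definition cmut T k : cseed := CSeed
  (gx (gmut k (chi (gauge T k)) (fseed T)))
  [ffun j => (if j == k then (cy T k)^-1
    else if (0 < cB T j k)%R then
      cy T j * expgz (cy T k) (cB T j k) * expgz (oplus (cy T k) 1%g) (- cB T j k)
    else cy T j * expgz (oplus (cy T k) 1%g) (- cB T j k))%g]
  (mutate_matrix (cB T) k).

Lemma fseed_cmut T k : fseed (cmut T k) = gmut k (chi (gauge T k)) (fseed T).
Proof.
rewrite /fseed [LHS]/= /gmut; congr GSeed; apply/ffunP => i.
rewrite !ffunE /= ?ffunE.
case: eqP => [_|ik]; first by rewrite charV.
have e : chi (gauge T k) ^ cB T i k = chi (expgz (oplus (cy T k) 1%g) (- cB T i k)).
  by rewrite char_expgz charV exprz_inv.
rewrite e; case: ltP => b0; rewrite !charM; first by rewrite char_expgz (pospart_id (ltW b0)).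
by rewrite (pospart_le0 b0) expr0z mulr1.
Qed.

End CoefficientSeeds.

(** * Seeds of a cluster algebra *)

Section AmbientSeeds.
Variables (n : nat) (P : semifieldType) (G : laurent_group P n).
Import mpoly.
Local Notation K := (ambient n P).
Implicit Types (S : seed n P) (k : 'I_n) (p q : P).

Lemma of_coefM : {morph @of_coef n P : u v / u * v}.
Proof. by move=> u v; rewrite /of_coef mpolyCM tofracM. Qed.

Lemma of_coef1 : @of_coef n P 1 = 1.
Proof. by rewrite /of_coef; exact: tofrac1. Qed.

Lemma of_semifield1 : of_semifield n (1%g : P) = 1.
Proof. by rewrite -of_coef1; congr of_coef; exact: tofrac1. Qed.

Lemma of_semifieldM p q : of_semifield n (p * q)%g = of_semifield n p * of_semifield n q.
Proof.
rewrite -of_coefM; congr of_coef; apply: etrans (tofracM _ _); congr tofrac.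
exact: monM.
Qed.

Definition of_char : character P K := Character of_semifield1 of_semifieldM.

Definition cseed_of S : cseed n P K :=
  CSeed (cluster S) (coefficients S) (exchange_matrix S).

Lemma cseed_of_mutate S k : cseed_of (mutate S k) = cmut of_char (cseed_of S) k.
Proof.
rewrite /cseed_of /cmut; congr CSeed; apply/ffunP => i.
rewrite [LHS]ffunE [RHS]ffunE; case: eqP => // _.
rewrite [of_char _]/= of_semifieldM mulrDr !mulrA [gy _ _]ffunE.
congr ((_ * _ + _ * _) / _); first exact: mulrC.
  rewrite /pos_monomial /zprod /= big_mkcond; apply: eq_bigr => j _.
  by case: ltP => h; [rewrite pospart_id ?ltW|rewrite pospart_le0 ?expr0z].
rewrite /neg_monomial /zprod /= big_mkcond; apply: eq_bigr => j _.
by case: ltP => h; [rewrite pospart_id ?oppr_ge0 ?ltW|rewrite pospart_le0 ?oppr_le0 ?expr0z].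
Qed.

Lemma of_coef_nmod : nmod_morphism (@of_coef n P).
Proof. by split=> [|u v]; rewrite /of_coef ?mpolyC0 ?tofrac0 // mpolyCD tofracD. Qed.

Lemma of_coef_monoid : monoid_morphism (@of_coef n P).
Proof. by split; [exact: of_coef1|exact: of_coefM]. Qed.

HB.instance Definition _ :=
  GRing.isNmodMorphism.Build (coef_field P) K (@of_coef n P) of_coef_nmod.
HB.instance Definition _ :=
  GRing.isMonoidMorphism.Build (coef_field P) K (@of_coef n P) of_coef_monoid.

Lemma eval_atX (x : {ffun 'I_n -> K}) (m : 'X_{1..n}) (c : coef_field P) :
  eval_at x (c *: 'X_[m]) = of_coef n c * \prod_(i < n) x i ^+ m i.
Proof. by rewrite /eval_at mmapZ mmapX. Qed.

Lemma absz_shift_inj (N : nat) (u v : int) : (`|u| <= N)%N -> (`|v| <= N)%N ->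
  absz (u + N%:Z) = absz (v + N%:Z) -> u = v.
Proof. lia. Qed.

(** A large power of the product of the variables turns a Laurent polynomial
    over the group ring into a polynomial over the coefficient field; distinct
    Laurent monomials stay distinct. *)
Lemma laurent_free_cluster (x : {ffun 'I_n -> K}) :
  algebraically_independent x -> laurent_free G of_char x.
Proof.
move=> ai; have x0 i : x i != 0.
  apply/eqP => xi; have e : eval_at x (1 *: 'X_[U_(i)]) = 0.
    by rewrite eval_atX (bigD1 i) //= mnm1E eqxx expr1 xi mul0r mulr0.
  have /(congr1 (mcoeff U_(i))) := ai _ e; rewrite scale1r mcoeffX eqxx mcoeff0.
  by move/eqP; rewrite oner_eq0.
split=> // f f0; pose N := (\sum_(g <- monalg.msupp f) \sum_(i < n) `|lexp g i|)%N.
have leN g i : g \in monalg.msupp f -> (`|lexp g i| <= N)%N.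
  move=> gf; rewrite /N (big_fsetD1 g) //= (bigD1 i) //= -addnA; exact: leq_addr.
pose m (g : G) : 'X_{1..n} := [multinom `|(lexp g i + N%:Z)%R|%N | i < n].
pose c (g : G) : coef_field P := (monalg.mcoeff g f)%:~R * tofrac (mon (lcoef g)).
pose pf := \sum_(g <- monalg.msupp f) c g *: 'X_[m g].
have em g : g \in monalg.msupp f ->
    \prod_(i < n) x i ^+ m g i = zprod x (lexp g) * zprod x (fun=> N%:Z).
  move=> gf; rewrite -zprodDf //; apply: eq_bigr => i _; rewrite exprnP mnmE.
  by congr (_ ^ _); have := leN g i gf; lia.
have pf0 : pf = 0.
  apply: ai; rewrite /pf /eval_at raddf_sum /=.
  transitivity (ev of_char x f * zprod x (fun=> N%:Z)); last by rewrite f0 mul0r.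
  rewrite /ev /gmap mulr_suml; apply: eq_big_seq => g gf.
  rewrite -/(eval_at x _) eval_atX em // mulrA rmorphM rmorph_int -mulrA.
  have -> : lmon_char G of_char x g = of_char (lcoef g) * zprod x (lexp g).
    by rewrite -trop_charE.
  by rewrite !mulrA.
apply/eqP; rewrite -[f == 0]negbK; apply/negP => /msupp_neq0[g0 g0f].
have : mcoeff (m g0) pf = 0 by rewrite pf0 mcoeff0.
rewrite /pf raddf_sum /= (eq_bigr (fun g =>
  tofrac ((monalg.mcoeff g f * (m g == m g0))%:~R * mon (lcoef g)))).
  rewrite -raddf_sum /= => /eqP; rewrite tofrac_eq0 => /eqP.
  move/(congr1 (monalg.mcoeff (lcoef g0))).
  rewrite monalg.mcoeff0 mcoeff_sum (big_fsetD1 g0) //= eqxx mulr1 -mkmalgU_mon.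
  rewrite monalg.mcoeffUU big1_fset ?addr0 => [/eqP|g].
    by rewrite monalg.mcoeff_eq0 g0f.
  rewrite !inE => /andP[gg0 gf] _; rewrite -mkmalgU_mon monalg.mcoeffU.
  have [cg|//] := eqVneq (lcoef g) (lcoef g0).
  have [mg|] := eqVneq (m g) (m g0); last by rewrite mulr0.
  case/eqP: gg0; rewrite -(lmkK g) -(lmkK g0) cg; congr lmk; apply/ffunP => i.
  have : m g i = m g0 i by rewrite mg.
  rewrite /m !mnmE.
  exact: absz_shift_inj (leN g i gf) (leN g0 i g0f).
move=> g _; rewrite mcoeffZ mcoeffX tofracM !rmorph_int rmorphM /= mulrAC; congr (_ * _ * _).
Qed.

End AmbientSeeds.

(** * Laurent polynomials homogeneous in one variable *)

Section Homogeneous.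
Import monalg.
Variables (P : semifieldType) (n : nat) (G : laurent_group P n).
Variables (K : fieldType) (chi : character P K) (i : 'I_n).
Local Notation A := (group_ring G).
Local Notation ev := (ev (G := G) chi).
Implicit Types (x : 'I_n -> K) (f g : A) (m : int).

Definition homogeneous m f := forall h : G, h \in msupp f -> lexp h i = m.

Lemma homogeneous0 m : homogeneous m 0.
Proof. by move=> h; rewrite msupp0. Qed.

Lemma homogeneousD m f g : homogeneous m f -> homogeneous m g -> homogeneous m (f + g).
Proof.
move=> hf hg h /(fsubsetP (msuppD_le _ _)); rewrite inE => /orP[/hf|/hg] //.
Qed.

Lemma homogeneousU m (h : G) c : lexp h i = m -> homogeneous m (mkmalgU h c).
Proof. by move=> e k /(fsubsetP msuppU_le); rewrite inE => /eqP->. Qed.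

Lemma homogeneous_mon (h : G) : homogeneous (lexp h i) (mon h).
Proof. exact: homogeneousU. Qed.

Lemma homogeneousM m m' f g :
  homogeneous m f -> homogeneous m' g -> homogeneous (m + m') (f * g).
Proof.
move=> hf hg; rewrite [f * g](gr_mulw (fsubset_refl _) (fsubset_refl _)).
rewrite big_seq; apply: (big_ind (homogeneous (m + m'))).
- exact: homogeneous0.
- by move=> *; apply: homogeneousD.
move=> p pf; rewrite big_seq; apply: (big_ind (homogeneous (m + m'))).
- exact: homogeneous0.
- by move=> *; apply: homogeneousD.
by move=> q qg; apply: homogeneousU; rewrite lexpM tropE ffunE hf // hg.
Qed.

Lemma homogeneous1 : homogeneous 0 1.
Proof. by rewrite -mon1; move: (@homogeneous_mon 1%g); rewrite lexp1 tropE ffunE. Qed.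

Lemma homogeneousX m f k : homogeneous m f -> homogeneous (m * k%:Z) (f ^+ k).
Proof.
move=> hf; elim: k => [|k IH]; first by rewrite mulr0; apply: homogeneous1.
rewrite exprS (_ : m * k.+1%:Z = m + m * k%:Z); first exact: homogeneousM.
by rewrite intS mulrDr mulr1.
Qed.

Lemma homogeneous_degree m m' f :
  f != 0 -> homogeneous m f -> homogeneous m' f -> m = m'.
Proof. by move=> /msupp_neq0[h hf] hm hm'; rewrite -(hm h hf) (hm' h hf). Qed.

Lemma homogeneous_binom c y b : b i = 0 -> homogeneous 0 (binom G c y b).
Proof.
by move=> bi; apply: homogeneousD; apply: homogeneousU;
  rewrite lexp_mk ffunE bi ?oppr0.
Qed.

Lemma homogeneous_of_factor f g : f * g != 0 -> homogeneous 0 (f * g) ->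
  exists m, homogeneous m f.
Proof.
move=> fg0 h0; have dM (h h' : G) : lexp (h * h')%g i = lexp h i + lexp h' i.
  by rewrite lexpM tropE ffunE.
exact: (homogeneous_factor (delta := fun h : G => lexp h i) dM fg0 h0).
Qed.

Lemma ev_homogeneous0 x x' f : (forall l, x l != 0) -> (forall l, x' l != 0) ->
    (forall l, l != i -> x' l = x l) -> homogeneous 0 f ->
  ev x' f = ev x f.
Proof.
move=> x0 x'0 xx' hf; rewrite /ev /gmap; apply: eq_big_seq => h /hf h0.
congr (_ * (_ * _)); rewrite ![trop_char _ _]trop_charE //.
apply: eq_zprod => // l hl; apply: xx'.
by apply: contra_neq hl => ->.
Qed.

Definition vpow m : G := lmk G 1%g [ffun l => m * (l == i)%:Z].

Lemma ev_vpow x m : (forall l, x l != 0) -> ev x (mon (vpow m)) = x i ^ m.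
Proof.
move=> x0; rewrite ev_lmk // char1 mul1r /zprod (bigD1 i) //= ffunE eqxx mulr1.
by rewrite big1 ?mulr1 // => l /negPf li; rewrite ffunE li mulr0.
Qed.

Lemma homogeneous_split x m f : (forall l, x l != 0) -> homogeneous m f ->
  exists2 f0, homogeneous 0 f0 & ev x f = x i ^ m * ev x f0.
Proof.
move=> x0 hf; exists (mon (vpow (- m)) * f).
  rewrite -(addNr m); apply: homogeneousM => //.
  move: (@homogeneous_mon (vpow (- m))); rewrite lexp_mk ffunE eqxx mulr1; exact.
by rewrite evM ev_vpow // mulrA -expfzDr // addrN expr0z mul1r.
Qed.

End Homogeneous.

Section LaurentEvaluation.
Variables (P : semifieldType) (n : nat) (G : laurent_group P n).
Variables (K : fieldType) (chi : character P K).
Local Notation A := (group_ring G).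
Local Notation ev := (ev (G := G) chi).
Implicit Types (x : 'I_n -> K) (f g : A) (m : int).

Definition char_image (u : K) := exists p, u = chi p.

Lemma char_image_subgroup : subgroup char_image.
Proof.
split.
- by exists 1%g; rewrite char1.
- by move=> _ _ [p ->] [q ->]; exists (p * q)%g; rewrite charM.
- by move=> _ [p ->]; exists p^-1%g; rewrite charV.
- by move=> _ [p ->]; apply: char_neq0.
Qed.

Lemma ev_lX x i : (forall l, x l != 0) -> ev x (mon (lX G i)) = x i.
Proof. by move=> x0; rewrite ev_lmk // char1 mul1r zprod_unitv. Qed.

Lemma laurent_ev x u : (forall l, x l != 0) -> laurent char_image x u ->
  exists f, u = ev x f.
Proof.
move=> x0; apply: (@laurent_sub _ _ _ (fun u => exists f, u = ev x f)).
- move=> _ [p ->]; exists (mon (lmk G p 1%g)); rewrite ev_lmk //.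
  by rewrite [zprod _ _]big1 ?mulr1 // => l _; rewrite tropE ffunE expr0z.
- by move=> i; exists (mon (lX G i)); rewrite ev_lX.
- move=> i; exists (mon (lX G i)^-1%g).
  by rewrite /lX lmkV ev_lmk // charV char1 invr1 mul1r -[in LHS](zprod_unitv x i)
    -zprodN; apply: eq_zprod => // l; rewrite tropE !ffunE.
- by exists 0; rewrite ev0.
- by move=> _ _ [f ->] [g ->]; exists (f + g); rewrite evD.
- by move=> _ [f ->]; exists (- f); rewrite evN.
- by move=> _ _ [f ->] [g ->]; exists (f * g); rewrite evM.
Qed.

(** In the seed obtained by exchanging [x_i], a negative power of [x_i] is a
    negative power of a sum of two monomials, on which the augmentation takes
    the value 2, not a unit. *)
Lemma laurent_exponent_ge0 x z i q (e : 'I_n -> int) f :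
    (forall l, x l != 0) -> laurent_free G chi z -> (forall l, l != i -> z l = x l) ->
    x i * z i = ev z q -> aug q = 2 -> zprod x e = ev z f ->
  0 <= e i.
Proof.
move=> x0 fz zx ex q2 ef; have z0 := fz.1.
rewrite leNgt; apply/negP => ei.
have [k [k0 ek]] : exists k : nat, (0 < k)%N /\ e i = - k%:Z.
  by exists (absz (e i)); lia.
pose e' : trop n := [ffun l => if l == i then k%:Z else e l].
have E : ev z (f * q ^+ k) = ev z (mon (lmk G 1%g e')).
  rewrite evM evX -ef -ex ev_lmk // char1 mul1r /zprod (bigD1 i) //=.
  rewrite [in RHS](bigD1 i) //= ffunE eqxx ek -invr_expz -exprnP exprMn.
  rewrite mulrAC mulKf ?expf_neq0 //; congr (_ * _).
  by apply: eq_bigr => l li; rewrite ffunE (negPf li) zx.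
have := congr1 (@aug _) (ev_inj fz E).
rewrite augM aug_mon (_ : aug (q ^+ k) = 2 ^+ k); last first.
  by rewrite -q2; elim: (k) => [|k' IH]; rewrite ?expr0 ?aug1 // !exprS augM IH.
case: k k0 {ek e' E} => // k _; rewrite exprS mulrCA; lia.
Qed.

End LaurentEvaluation.

(** * Semifield values of subtraction-free expressions *)

Section SemifieldSums.
Variables (P : semifieldType) (n : nat) (G : laurent_group P n).
Implicit Types (p q : P) (g h : G) (s t : seq G).

Definition oadd (a b : option P) : option P :=
  match a, b with
  | Some p, Some q => Some (oplus p q)
  | Some p, None => Some p
  | None, _ => b
  end.

Arguments oadd !a !b.

Lemma oaddC : commutative oadd.
Proof. by case=> [p|] [q|] //=; rewrite oplusC. Qed.

Lemma oaddA : associative oadd.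
Proof. by case=> [p|] [q|] [r|] //=; rewrite oplusA. Qed.

(** There is no zero in [P] to serve as the value on the empty list. *)
Definition osum s : option P := foldr (fun g => oadd (Some (lcoef g))) None s.

Lemma osum_cat s t : osum (s ++ t) = oadd (osum s) (osum t).
Proof. by elim: s => [|g s /= ->] //; rewrite oaddA. Qed.

Lemma osum_perm s t : perm_eq s t -> osum s = osum t.
Proof.
apply: catCA_perm_subst => s1 s2 s3.
by rewrite !osum_cat !oaddA (oaddC (osum s1)).
Qed.

Lemma osum_map g s : osum [seq (g * h)%g | h <- s] = omap (monoid.mul (lcoef g)) (osum s).
Proof.
elim: s => //= h s ->; rewrite lcoefM; case: (osum s) => [q|] //=.
by rewrite !(semifield_mulC (lcoef g)) mulg_oplusl.
Qed.

Definition lprod s t : seq G := [seq (g * h)%g | g <- s, h <- t].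

Lemma osum_lprod s t q : osum t = Some q ->
  osum (lprod s t) = omap (fun p => p * q)%g (osum s).
Proof.
move=> et; elim: s => //= g s IH; rewrite osum_cat osum_map et IH.
by case: (osum s) => [p|] //=; rewrite mulg_oplusl.
Qed.

Definition lsum s : group_ring G := \sum_(g <- s) mon g.

Lemma lsum_cat s t : lsum (s ++ t) = lsum s + lsum t.
Proof. exact: big_cat. Qed.

Lemma lsum_map g s : lsum [seq (g * h)%g | h <- s] = mon g * lsum s.
Proof.
by rewrite /lsum big_map mulr_sumr; apply: eq_bigr => h _; rewrite monM.
Qed.

Lemma lsum_lprod s t : lsum (lprod s t) = lsum s * lsum t.
Proof.
elim: s => [|g s IH]; first by rewrite /lsum !big_nil mul0r.
by rewrite /lprod /= lsum_cat IH lsum_map /lsum big_cons mulrDl.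
Qed.

Lemma aug_lsum s : aug (lsum s) = size s.
Proof.
elim: s => [|g s IH]; first by rewrite /lsum big_nil aug0.
by rewrite /lsum big_cons augD aug_mon -/(lsum s) IH.
Qed.

Lemma mcoeff_lsum h s : monalg.mcoeff h (lsum s) = count_mem h s.
Proof.
rewrite mcoeff_sum; elim: s => [|g s IH]; first by rewrite big_nil.
by rewrite big_cons IH monalg.mcoeffU /=; case: eqP.
Qed.

Lemma lsum_perm s t : lsum s = lsum t -> perm_eq s t.
Proof.
move=> e; apply/allP => h _ /=; apply/eqP; have := congr1 (monalg.mcoeff h) e.
by rewrite !mcoeff_lsum => -[].
Qed.

End SemifieldSums.

Section SubtractionFree.
Variables (P : semifieldType) (n : nat) (G : laurent_group P n).
Variables (K : fieldType) (chi : character P K) (x : 'I_n -> K).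
Hypothesis fx : laurent_free G chi x.
Local Notation ev := (ev (G := G) chi x).
Implicit Types (s t : seq G) (p q r : P) (u v : K).

Let x0 : forall i, x i != 0. Proof. by case: fx. Qed.

(** [u] is a quotient of two subtraction-free Laurent polynomials and [r] is its
    value when the variables are set to 1 and sums are taken in [P]. *)
Definition sf_value u r := exists s t p q,
  [/\ u * ev (lsum t) = ev (lsum s), osum s = Some p, osum t = Some q & r = (p / q)%g].

Lemma lsum_neq0 s p : osum s = Some p -> ev (lsum s) != 0.
Proof.
move=> es; apply/eqP => /fx.2 e; have := aug_lsum s; rewrite e aug0.
by case: s es {e}.
Qed.

Lemma sf_value_char p : sf_value (chi p) p.
Proof.
exists [:: lmk G p 1%g], [:: 1%g], p, 1%g; split=> /=.
- rewrite /lsum !big_seq1 mon1 ev1 mulr1 ev_lmk // [zprod _ _]big1 ?mulr1 //.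
  by move=> i _; rewrite tropE ffunE expr0z.
- by rewrite lcoef_mk.
- by rewrite lcoef1.
- by rewrite monoid.invg1 monoid.mulg1.
Qed.

Lemma sf_value_var i : sf_value (x i) 1%g.
Proof.
exists [:: lX G i], [:: 1%g], 1%g, 1%g; split=> /=.
- by rewrite /lsum !big_seq1 mon1 ev1 mulr1 ev_lX.
- by rewrite lcoef_mk.
- by rewrite lcoef1.
- by rewrite monoid.invg1 monoid.mulg1.
Qed.

Lemma sf_valueM u v r r' : sf_value u r -> sf_value v r' -> sf_value (u * v) (r * r')%g.
Proof.
move=> [s [t [p [q [e es et ->]]]]] [s' [t' [p' [q' [e' es' et' ->]]]]].
exists (lprod s s'), (lprod t t'), (p * p')%g, (q * q')%g; split.
- by rewrite !lsum_lprod !evM -e -e' mulrACA.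
- by rewrite (osum_lprod _ es') es.
- by rewrite (osum_lprod _ et') et.
rewrite monoid.invgM -!monoid.mulgA; congr (_ * _)%g.
by rewrite !monoid.mulgA (semifield_mulC _ p') -!monoid.mulgA (semifield_mulC _ q^-1%g).
Qed.

Lemma sf_valueV u r : sf_value u r -> sf_value u^-1 r^-1%g.
Proof.
move=> [s [t [p [q [e es et ->]]]]]; exists t, s, q, p; split=> //.
  rewrite -e mulKf //; apply: contra_eq_neq e => ->.
  by rewrite mul0r eq_sym (lsum_neq0 es).
by rewrite monoid.invgF.
Qed.

Lemma sf_valueD u v r r' : sf_value u r -> sf_value v r' -> sf_value (u + v) (oplus r r').
Proof.
move=> [s [t [p [q [e es et ->]]]]] [s' [t' [p' [q' [e' es' et' ->]]]]].
exists (lprod s t' ++ lprod s' t), (lprod t t'), (oplus (p * q') (p' * q))%g, (q * q')%g.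
split.
- by rewrite lsum_cat !lsum_lprod evD !evM -e -e'; ring.
- by rewrite osum_cat (osum_lprod _ et') es (osum_lprod _ et) es'.
- by rewrite (osum_lprod _ et') et.
rewrite mulg_oplusl monoid.invgM; congr oplus.
  by rewrite -monoid.mulgA (monoid.mulgA q') monoid.mulgV monoid.mul1g.
by rewrite (semifield_mulC q'^-1%g) -monoid.mulgA (monoid.mulgA q) monoid.mulgV monoid.mul1g.
Qed.

Lemma sf_valueX u (a : int) : sf_value u 1%g -> sf_value (u ^ a) 1%g.
Proof.
move=> h; have nat_case k : sf_value (u ^+ k) 1%g.
  elim: k => [|k IH]; first by rewrite expr0 -(char1 chi); apply: sf_value_char.
  by rewrite exprS -(monoid.mulg1 1%g); apply: sf_valueM.
case: a => k; first exact: nat_case.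
by rewrite NegzE -invr_expz -monoid.invg1; apply: sf_valueV; exact: nat_case.
Qed.

Lemma sf_value_zprod (z : 'I_n -> K) a : (forall i, sf_value (z i) 1%g) ->
  sf_value (zprod z a) 1%g.
Proof.
move=> hz; apply: (big_ind (fun u => sf_value u 1%g)).
- by rewrite -(char1 chi); apply: sf_value_char.
- by move=> u v hu hv; rewrite -(monoid.mulg1 1%g); apply: sf_valueM.
- by move=> i _; apply: sf_valueX.
Qed.

(** Comparing augmentations, which are numbers of terms, excludes the sign. The
    remaining identity says that two lists of monomials are permutations of
    each other up to the factor [p], and [osum] does not see the order. *)
Lemma sf_value_sign u p r : u = chi p \/ u = - chi p -> sf_value u r ->
  u = chi p /\ r = p.
Proof.
move=> up [s [t [a [b [e es et ->]]]]].
have size0 : (0 < size t)%N by case: t et {e}.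
have em : ev (mon (lmk G p 1%g)) = chi p.
  rewrite ev_lmk // [zprod _ _]big1 ?mulr1 // => i _.
  by rewrite tropE ffunE expr0z.
case: up => eu; last first.
  move: e; rewrite eu mulNr -em -evM -evN => /(ev_inj fx)/(congr1 (@aug _)).
  rewrite aug_lsum (_ : aug (- _) = - aug (mon (lmk G p 1%g) * lsum t)).
    by rewrite augM aug_mon aug_lsum mul1r; lia.
  exact: raddfN.
split=> //; move: e; rewrite eu -em -evM -lsum_map => /(ev_inj fx)/lsum_perm/osum_perm.
rewrite es osum_map et /= lcoef_mk => -[<-].
by rewrite -monoid.mulgA monoid.mulgV monoid.mulg1.
Qed.

(** The normalizing factor of the exchange relation is the inverse of the value
    of what it multiplies. *)
Lemma sf_value_gmut (s : gseed n K) k y : (forall i, sf_value (gx s i) 1%g) ->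
    gy s k = chi y ->
  forall i, sf_value (gx (gmut k (chi (oplus y 1%g)^-1%g) s) i) 1%g.
Proof.
move=> hs ey i; have [->|ik] := eqVneq i k; last by rewrite gmut_xN.
have e : ((oplus y 1)^-1 * oplus (y * 1) 1 * 1^-1 = 1 :> P)%g.
  by rewrite monoid.invg1 !monoid.mulg1 monoid.mulVg.
rewrite -[X in sf_value _ X]e ffunE eqxx ey; apply: sf_valueM; last exact: sf_valueV.
apply: sf_valueM; first exact: sf_value_char.
apply: sf_valueD; last exact: sf_value_zprod.
by apply: sf_valueM; [exact: sf_value_char|exact: sf_value_zprod].
Qed.

End SubtractionFree.

(** * Two families differing in one variable *)

Section TwoFamilies.
Variables (P : semifieldType) (n : nat) (G : laurent_group P n).
Variables (K : fieldType) (chi : character P K) (i : 'I_n).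
Local Notation A := (group_ring G).
Local Notation ev := (ev (G := G) chi).
Local Notation hom := (@homogeneous P n G i).
Implicit Types (x : 'I_n -> K) (f g : A) (m : int).

Definition pure_in x (u : K) m := exists2 f, hom 0 f & u = x i ^ m * ev x f.

(** Factors of a homogeneous element are homogeneous. *)
Lemma pure_of_factor x u v q : laurent_free G chi x ->
    (exists f, u = ev x f) -> (exists g, v = ev x g) -> u * v = ev x q ->
    q != 0 -> hom 0 q ->
  exists m, pure_in x u m.
Proof.
move=> fx [f ->] [g ->]; rewrite -evM => /(ev_inj fx) <- fg0 hq.
have [m hf] := homogeneous_of_factor fg0 hq.
by have [f0 hf0 e] := homogeneous_split chi fx.1 hf; exists m, f0.
Qed.

Lemma pure_degree x m m' f g : laurent_free G chi x -> hom 0 f -> hom 0 g -> f != 0 ->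
  x i ^ m * ev x f = x i ^ m' * ev x g -> m = m'.
Proof.
move=> fx hf hg f0; rewrite -!(ev_vpow G chi i _ fx.1) -!evM => /(ev_inj fx) e.
have hv k h : hom 0 h -> hom k (mon (vpow G i k) * h).
  move=> hh; rewrite -(addr0 k); apply: homogeneousM => //; rewrite addr0.
  by move: (@homogeneous_mon _ _ G i (vpow G i k)); rewrite lexp_mk ffunE eqxx mulr1.
apply: (@homogeneous_degree _ _ G i _ _ (mon (vpow G i m) * f)).
- by rewrite mulf_neq0 ?mon_neq0.
- exact: hv.
- by rewrite e; apply: hv.
Qed.

Variables (x x' : 'I_n -> K).
Hypotheses (fx : laurent_free G chi x) (fx' : laurent_free G chi x').
Hypothesis xx' : forall l, l != i -> x' l = x l.

(** Substituting the first expression into the second compares the degree 1 in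
    [x i] with the degree [m * m']. *)
Lemma pure_inverse m m' : pure_in x (x' i) m -> pure_in x' (x i) m' -> m * m' = 1.
Proof.
move=> [f hf ef] [g hg eg].
rewrite (ev_homogeneous0 chi fx.1 fx'.1 xx' hg) in eg.
have x0 := fx.1 i; have x'0 := fx'.1 i.
have f0 : f != 0.
  by apply: contra_neq x'0 => f0; rewrite ef f0 ev0 mulr0.
have g0 : g != 0.
  by apply: contra_neq x0 => g0; rewrite eg g0 ev0 mulr0.
case: m' eg => k eg.
  have h : hom 0 (f ^+ k * g).
    by rewrite -(addr0 0) -{1}(mul0r k%:Z); apply: homogeneousM => //; apply: homogeneousX.
  apply/esym/(pure_degree fx (@homogeneous1 _ _ G i) h (oner_neq0 _)).
  by rewrite ev1 mulr1 expr1z {1}eg ef evM evX -exprz_exp -exprnP exprMn mulrA.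
(* For a negative exponent the power of [f] changes sides, since [f] is not
   known to be invertible. *)
have h : hom 0 (f ^+ k.+1).
  by rewrite -(mul0r k.+1%:Z); apply: homogeneousX.
have := @pure_degree x (1 + m * k.+1%:Z) 0 (f ^+ k.+1) g fx h hg.
rewrite expf_neq0 // NegzE => /(_ isT) H.
suff: 1 + m * k.+1%:Z = 0 by lia.
apply: H; rewrite expr0z mul1r expfzDr // expr1z -exprz_exp evX -mulrA -exprnP -exprMn.
by rewrite -ef {1}eg NegzE -invr_expz -exprnP mulrAC mulVf ?expf_neq0 // mul1r.
Qed.

(** Substituting one expression into the other shows that the two cofactors are
    inverse to each other, and a unit of the group ring is a monomial up to
    sign. *)
Lemma pure_unit : pure_in x (x' i) 1 -> pure_in x' (x i) 1 ->
  exists p, exists2 a : trop n, a i = 0 &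
    x' i = chi p * zprod x a * x i \/ x' i = - chi p * zprod x a * x i.
Proof.
move=> [f hf ef] [g hg eg]; rewrite (ev_homogeneous0 chi fx.1 fx'.1 xx' hg) in eg.
rewrite !expr1z in ef eg; have x0 := fx.1 i.
have fg1 : f * g = 1.
  apply: (ev_inj fx); rewrite ev1 evM; apply: (mulfI x0).
  by rewrite mulr1 mulrA -ef.
have [h [eh|eh]] := group_ring_unit fg1.
  exists (lcoef h), (lexp h); first by apply: hf; rewrite eh msupp_mon inE.
  by left; rewrite ef eh (ev_mon chi h fx.1); exact: mulrC.
exists (lcoef h), (lexp h).
  by apply: hf; rewrite eh [X in _ \in X]monalg.msuppN msupp_mon inE.
by right; rewrite ef eh evN (ev_mon chi h fx.1) mulrN mulrC !mulNr.
Qed.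

Lemma zprod_single (y : 'I_n -> K) (a : 'I_n -> int) : (forall l, l != i -> a l = 0) ->
  zprod y a = y i ^ a i.
Proof.
by move=> a0; rewrite /zprod (bigD1 i) //= big1 ?mulr1 // => l /a0->; rewrite expr0z.
Qed.

(** By [pure_unit], the two variables differ by a monomial factor. Values in [P]
    determine its coefficient, and [laurent_exponent_ge0], used in both
    directions, excludes all other variables from it. *)
Lemma pure_equal :
    pure_in x (x' i) 1 -> pure_in x' (x i) 1 -> sf_value G chi x (x' i) 1%g ->
    (forall j, j != i -> exists z q f, [/\ laurent_free G chi z,
       forall l, l != j -> z l = x l, x j * z j = ev z q, aug q = 2 & x' i = ev z f]) ->
    (forall j, j != i -> exists z q f, [/\ laurent_free G chi z,
       forall l, l != j -> z l = x' l, x' j * z j = ev z q, aug q = 2 & x i = ev z f]) ->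
  x' i = x i.
Proof.
move=> hx hx' sf nb nb'; have [x0 _] := fx; have [x'0 _] := fx'.
have [p [a ai e]] := pure_unit hx hx'.
have zx0 : zprod x a * x i != 0 by rewrite mulf_neq0 ?zprod_neq0.
have {}e : x' i = zprod x a * x i.
  pose u := x' i * (zprod x a * x i)^-1.
  have up : u = chi p \/ u = - chi p.
    rewrite /u; case: e => ->; rewrite -mulrA mulfK //; by [left|right].
  have su : sf_value G chi x u (1 * (1 * 1)^-1)%g.
    apply: sf_valueM => //; apply: sf_valueV => //.
    apply: sf_valueM; last exact: (sf_value_var fx).
    by apply: (sf_value_zprod fx); exact: (sf_value_var fx).
  have [eu p1] := sf_value_sign fx up su.
  have -> : x' i = u * (zprod x a * x i) by rewrite divfK.
  by rewrite eu -p1 !monoid.mulg1 monoid.invg1 monoid.mulg1 char1 mul1r.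
pose e1 l := a l + (trop_unit i : trop n) l.
pose e2 l := - a l + (trop_unit i : trop n) l.
have E1 : x' i = zprod x e1 by rewrite e zprodDf // zprod_unitv.
have E2 : x i = zprod x' e2.
  rewrite zprodDf // zprod_unitv zprodN e (_ : zprod x' a = zprod x a).
    by rewrite mulKf // zprod_neq0.
  by apply: eq_zprod => // l al; apply: xx'; apply: contra_neq al => ->.
have a0 l : l != i -> a l = 0.
  move=> li; apply/eqP; rewrite eq_le; apply/andP; split.
    have [z [q [f [fz zx ez q2 ef]]]] := nb' l li.
    have := laurent_exponent_ge0 fx'.1 fz zx ez q2 (etrans (esym E2) ef).
    by rewrite /e2 ffunE (negPf li) addr0 oppr_ge0.
  have [z [q [f [fz zx ez q2 ef]]]] := nb l li.
  have := laurent_exponent_ge0 fx.1 fz zx ez q2 (etrans (esym E1) ef).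
  by rewrite /e1 ffunE (negPf li) addr0.
by rewrite e zprod_single // ai expr0z mul1r.
Qed.

End TwoFamilies.

(** * Mutation classes *)

Section MutationClasses.
Variables (n : nat) (P : semifieldType) (G : laurent_group P n).
Variables (K : fieldType) (chi : character P K).
Local Notation seed := (cseed n P K).
Local Notation fseed := (fseed chi).
Local Notation cmut := (cmut chi).
Implicit Types (T : seed) (i j k l : 'I_n) (ks : seq 'I_n) (d : 'I_n -> rat).
Implicit Types (s : 'S_n).

Definition free_seed d T := laurent_free G chi (cx T) /\ skew_by d (cB T).

Lemma free_seed_regular d T : free_seed d T -> regular (fseed T).
Proof. by move=> [[x0 _] _]; split=> // i; rewrite ffunE; apply: char_neq0. Qed.

Lemma free_seed_mutate d T k : free_seed d T -> free_seed d (cmut T k).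
Proof.
move=> [fx sk]; split; last exact: skew_by_mutate.
apply: (@laurent_free_gmut _ _ G _ chi (fseed T) k _ (cy T k)) => //.
  exact: skew_by_ii sk.
by rewrite ffunE.
Qed.

Lemma free_seed_hat1 d T k : free_seed d T -> 1 + hat (fseed T) k != 0.
Proof.
move=> gT; apply: (@hat_neq0_of_gmut _ _ _ k (chi (gauge T k)) (free_seed_regular gT)).
by have [[x0 _] _] := free_seed_mutate k gT; apply: x0.
Qed.

Lemma char_inj d T : free_seed d T -> injective chi.
Proof.
move=> [fx _] p q e; have x0 := fx.1.
have em r : ev chi (cx T) (mon (lmk G r 1%g)) = chi r.
  rewrite ev_lmk // [zprod _ _]big1 ?mulr1 // => i _.
  by rewrite tropE ffunE expr0z.
have /(ev_inj fx)/mon_inj : ev chi (cx T) (mon (lmk G p 1%g)) =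
    ev chi (cx T) (mon (lmk G q 1%g)) by rewrite !em.
by move/(congr1 (@lcoef _ _ G)); rewrite !lcoef_mk.
Qed.

Lemma gauge_mutate T k : gauge (cmut T k) k = (gauge T k * cy T k)%g.
Proof.
rewrite /gauge /= ffunE eqxx; move: (cy T k) => y.
apply: monoid.invg_inj; rewrite monoid.invgK monoid.invgM monoid.invgK.
by rewrite semifield_mulC mulg_oplusl monoid.mulgV monoid.mul1g oplusC.
Qed.

Lemma fseed_inj : injective chi -> injective (fseed : seed -> gseed n K).
Proof.
move=> inj [x y B] [x' y' B'] [-> /ffunP ey ->]; congr CSeed; apply/ffunP => i.
by apply: inj; have := ey i; rewrite !ffunE.
Qed.

Lemma mutateK d T k : free_seed d T -> cmut (cmut T k) k = T.
Proof.
move=> gT; have rs := free_seed_regular gT; have [_ sk] := gT.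
apply: (fseed_inj (char_inj gT)); rewrite !fseed_cmut gauge_mutate charM.
have -> : chi (cy T k) = gy (fseed T) k by rewrite ffunE.
apply: gmutK => //; [exact: char_neq0|exact: free_seed_hat1 gT|].
exact: skew_by_ii sk.
Qed.

Lemma free_seed_foldl d T ks : free_seed d T -> free_seed d (foldl cmut T ks).
Proof. by elim: ks T => //= k ks IH T gT; apply/IH/free_seed_mutate. Qed.

Lemma foldl_mutateK d T ks : free_seed d T -> foldl cmut (foldl cmut T ks) (rev ks) = T.
Proof.
elim: ks T => //= k ks IH T gT; rewrite rev_cons foldl_rcons IH ?(mutateK k gT) //.
exact: free_seed_mutate.
Qed.

Lemma mutation_path d T ks : free_seed d T -> exists path,
  [/\ gpath (fseed T) path = fseed (foldl cmut T ks),
      forall kc, kc \in path -> char_image chi kc.2 & nzpath (fseed T) path].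
Proof.
elim: ks T => [|k ks IH] T gT; have [x0 _] := free_seed_regular gT; first by exists [::].
have [path [e Uc nz]] := IH _ (free_seed_mutate k gT).
exists ((k, chi (gauge T k)) :: path); split.
- by rewrite /= -fseed_cmut.
- by move=> kc; rewrite inE => /orP[/eqP->|/Uc //]; exists (gauge T k).
- by split=> //; rewrite -fseed_cmut.
Qed.

Lemma laurent_foldl d T ks l : free_seed d T ->
  exists f, cx (foldl cmut T ks) l = @ev _ _ G _ chi (cx T) f.
Proof.
move=> gT; have [[x0 _] sk] := gT; apply: laurent_ev => //.
have [path [e Uc nz]] := mutation_path ks gT.
rewrite -[cx (foldl _ _ _)]/(gx (fseed (foldl cmut T ks))) -e.
apply: (@laurent_phenomenon n K _ (fseed T) d path (char_image_subgroup chi) sk) => //.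
by move=> j; exists (cy T j); rewrite ffunE.
Qed.

Lemma sf_value_foldl d T ks l : free_seed d T ->
  sf_value G chi (cx T) (cx (foldl cmut T ks) l) 1%g.
Proof.
move=> [fx _]; elim/last_ind: ks l => [|ks k IH] l; first exact: sf_value_var.
rewrite foldl_rcons; apply: (sf_value_gmut (s := fseed _) fx) => //.
by rewrite ffunE.
Qed.

(** ** Relabelling *)

Definition perm_seed s T : seed := CSeed
  [ffun i => cx T (s i)] [ffun i => cy T (s i)] (\matrix_(i, j) cB T (s i) (s j)).

Lemma perm_seed1 T : perm_seed 1%g T = T.
Proof.
by case: T => x y B; congr CSeed; [apply/ffunP => i|apply/ffunP => i|apply/matrixP => i j];
  rewrite /= ?ffunE ?mxE !perm1.
Qed.

Lemma perm_seedM s t T : perm_seed s (perm_seed t T) = perm_seed (s * t)%g T.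
Proof.
by congr CSeed; [apply/ffunP => i|apply/ffunP => i|apply/matrixP => i j];
  rewrite ?ffunE ?mxE !permM.
Qed.

Lemma cmut_perm s T k : cmut (perm_seed s T) k = perm_seed s (cmut T (s k)).
Proof.
have eB i j : cB (perm_seed s T) i j = cB T (s i) (s j) by rewrite mxE.
have ez (a : 'I_n -> int) b : (forall l, a l = b (s l)) ->
    zprod (cx (perm_seed s T)) a = zprod (cx T) b.
  move=> ab; rewrite /zprod [RHS](reindex_inj (@perm_inj _ s)) /=.
  by apply: eq_bigr => l _; rewrite ffunE ab.
congr CSeed.
- apply/ffunP => i; rewrite [RHS]ffunE /= !ffunE (inj_eq perm_inj).
  case: eqP => // _; rewrite /gauge ffunE; congr (_ * (_ * _ + _) / _).
    by apply: ez => l; rewrite eB.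
  by apply: ez => l; rewrite eB.
- by apply/ffunP => i; rewrite !ffunE (inj_eq perm_inj) /= !eB.
by apply/matrixP => i j; rewrite !mxE !(inj_eq perm_inj).
Qed.

Lemma foldl_perm s T ks :
  foldl cmut (perm_seed s T) ks = perm_seed s (foldl cmut T (map s ks)).
Proof. by elim: ks T => //= k ks IH T; rewrite cmut_perm IH. Qed.

(** Permuting the family amounts to permuting the exponents, which is an
    automorphism of the group ring. *)
Lemma laurent_free_perm (x : {ffun 'I_n -> K}) s : laurent_free G chi x ->
  laurent_free G chi [ffun i => x (s i)].
Proof.
move=> [x0 fx]; have xs0 i : [ffun j => x (s j)] i != 0 by rewrite ffunE.
split=> //.
pose pg (t : 'S_n) (g : G) : G := lmk G (lcoef g) [ffun i => lexp g (t i)].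
have pg1 t : mon (pg t 1%g) = 1.
  rewrite /pg lcoef1 lexp1; have -> : [ffun i => (1%g : trop n) (t i)] = 1%g :> trop n.
    by apply/ffunP => i; rewrite tropE !ffunE.
  by rewrite lmk1.
have pgM t g h : mon (pg t (g * h)%g) = mon (pg t g) * mon (pg t h).
  rewrite -monM -lmkM /pg lcoefM lexpM; congr (mon (lmk _ _ _)).
  by apply/ffunP => i; rewrite !tropE !ffunE.
pose phi (t : 'S_n) : character G (group_ring G) := Character (pg1 t) (pgM t).
have phiK t (f : group_ring G) : gmap (phi t^-1%g) (gmap (phi t) f) = f.
  rewrite gmap_comp -[RHS]gmap_id; apply: eq_gmap => g.
  rewrite /= gmap_mon /= /pg lcoef_mk lexp_mk -[in RHS](lmkK g); congr (mon (lmk _ _ _)).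
  by apply/ffunP => i; rewrite !ffunE permKV.
have evp (f : group_ring G) : ev chi [ffun i => x (s i)] f = ev chi x (gmap (phi s^-1%g) f).
  rewrite /ev gmap_comp; apply: eq_gmap => g; rewrite [RHS]gmap_mon /= /lmon_fun.
  rewrite !trop_charE // /pg lcoef_mk lexp_mk; congr (_ * _).
  rewrite /zprod [RHS](reindex_inj (@perm_inj _ s)) /=; apply: eq_bigr => i _.
  by rewrite !ffunE permK.
move=> f; rewrite evp => /fx e.
by rewrite -(phiK s^-1%g f) e gmap0.
Qed.

Lemma free_seed_perm d T s : free_seed d T -> free_seed (fun i => d (s i)) (perm_seed s T).
Proof.
move=> [fx [d0 dB]]; split; first exact: laurent_free_perm.
by split=> [i|i j]; rewrite ?mxE.
Qed.

(** ** Seeds linked by mutations and relabelling *)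

(** Relabelling is needed since a shared variable may have different indices in
    two clusters. *)
Definition linked T T' := exists ks s, T' = perm_seed s (foldl cmut T ks).

Lemma linked_mutate T T' k : linked T T' -> linked T (cmut T' k).
Proof.
move=> [ks [s ->]]; exists (rcons ks (s k)), s.
by rewrite cmut_perm foldl_rcons.
Qed.

Lemma linked_from_mutate d T T' k : free_seed d T -> linked T T' -> linked (cmut T k) T'.
Proof.
by move=> gT [ks [s ->]]; exists (k :: ks), s; rewrite /= (mutateK k gT).
Qed.

Lemma linked_free_seed d T T' : free_seed d T -> linked T T' -> exists d', free_seed d' T'.
Proof.
move=> gT [ks [s ->]]; exists (fun i => d (s i)).
exact/free_seed_perm/free_seed_foldl.
Qed.

Lemma linked_sym d T T' : free_seed d T -> linked T T' -> linked T' T.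
Proof.
move=> gT [ks [s ->]]; exists (map s^-1%g (map s (map s^-1%g (rev ks)))), s^-1%g.
rewrite foldl_perm perm_seedM mulVg perm_seed1.
rewrite -[in LHS](foldl_mutateK ks gT); congr (foldl _ _ _).
by rewrite -!map_comp -[LHS]map_id; apply: eq_map => k /=; rewrite !permKV.
Qed.

Lemma linked_laurent d T T' l : free_seed d T -> linked T T' ->
  exists f, cx T' l = @ev _ _ G _ chi (cx T) f.
Proof. by move=> gT [ks [s ->]]; rewrite ffunE; apply: laurent_foldl gT. Qed.

Lemma linked_sf_value d T T' l : free_seed d T -> linked T T' ->
  sf_value G chi (cx T) (cx T' l) 1%g.
Proof. by move=> gT [ks [s ->]]; rewrite ffunE; apply: sf_value_foldl gT. Qed.

(** ** Linked seeds sharing all variables but one *)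

Lemma exchange_binom d T k : free_seed d T -> exists q,
  [/\ cx T k * cx (cmut T k) k = @ev _ _ G _ chi (cx T) q, aug q = 2, q != 0
    & homogeneous (G := G) k 0 q].
Proof.
move=> gT; have [[x0 _] sk] := gT.
exists (binom G (gauge T k) (cy T k) (cB T k)); split.
- by apply: (exchange_relation G (s := fseed T)) => //; rewrite ffunE.
- exact: aug_binom.
- exact: binom_neq0.
by apply: homogeneous_binom; apply: skew_by_ii sk.
Qed.

Lemma cmut_xN T k l : l != k -> cx (cmut T k) l = cx T l.
Proof. exact: gmut_xN. Qed.

(** The neighbour in direction [j] serves as the family that [pure_equal] uses
    to bound the exponent of the variable of index [j]. *)
Lemma exchange_neighbour d T T' j u : free_seed d T -> linked T T' ->
    (exists l, u = cx T' l) -> exists z q f,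
  [/\ laurent_free G chi z, forall l, l != j -> z l = cx T l,
      cx T j * z j = @ev _ _ G _ chi z q, aug q = 2 & u = @ev _ _ G _ chi z f].
Proof.
move=> gT TT' [l ->]; have gT' := free_seed_mutate j gT.
have [q [e q2 _ hq]] := exchange_binom j gT.
have [f ef] := linked_laurent l gT' (linked_from_mutate j gT TT').
exists (cx (cmut T j)), q, f; split=> //; [exact: gT'.1|exact: cmut_xN|].
by rewrite e; apply/esym/(ev_homogeneous0 chi gT.1.1 gT'.1.1 (@cmut_xN T j) hq).
Qed.

(** The product of [cx T' i] and the variable exchanged with it is a binomial
    in the shared variables, and both factors are Laurent polynomials in the
    cluster of [T]. *)
Lemma linked_pure d d' T T' i : free_seed d T -> free_seed d' T' -> linked T T' ->
    (forall l, l != i -> cx T' l = cx T l) ->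
  exists m, pure_in G chi i (cx T) (cx T' i) m.
Proof.
move=> gT gT' TT' xx'; have [q [e _ q0 hq]] := exchange_binom i gT'.
apply: (pure_of_factor gT.1 _ _ _ q0 hq (v := cx (cmut T' i) i)).
- exact: linked_laurent gT TT'.
- exact: linked_laurent gT (linked_mutate i TT').
by rewrite e; apply: (ev_homogeneous0 chi gT.1.1 gT'.1.1 xx' hq).
Qed.

(** The exponents that [linked_pure] provides in the two directions multiply to
    1 and are integers; if they are 1, [pure_equal] applies. *)
Lemma linked_pure_pm1 d T T' i : free_seed d T -> linked T T' ->
    (forall l, l != i -> cx T' l = cx T l) ->
  pure_in G chi i (cx T) (cx T' i) (-1) \/ cx T' i = cx T i.
Proof.
move=> gT TT' xx'; have [d' gT'] := linked_free_seed gT TT'.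
have x'x l : l != i -> cx T l = cx T' l by move=> li; rewrite xx'.
have T'T := linked_sym gT TT'.
have [m hm] := linked_pure gT gT' TT' xx'.
have [m' hm'] := linked_pure gT' gT T'T x'x.
have mm' := pure_inverse gT.1 gT'.1 xx' hm hm'.
have [m1|m1] : m = 1 /\ m' = 1 \/ m = -1.
  have : (`|m| * `|m'|)%N = 1%N by rewrite -abszM mm'.
  by move/eqP; rewrite muln_eq1 => /andP[/eqP a /eqP b]; move: mm'; nia.
  right; case: m1 => m1 m'1; rewrite m1 in hm; rewrite m'1 in hm'.
  apply: (pure_equal gT.1 gT'.1 xx' hm hm').
  - exact: linked_sf_value gT TT'.
  - by move=> j _; apply: (exchange_neighbour j gT TT'); exists i.
  - by move=> j _; apply: (exchange_neighbour j gT' T'T); exists i.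
by left; rewrite -m1.
Qed.

(** If both equalities fail, [linked_pure_pm1] applied to [T] and to its
    mutation [Z] at [i] gives [cx T i * cx T' i = f] and [cx Z i * cx T' i = g]
    with [f] and [g] of degree 0 in [cx T i]. The exchange relation [cx T i *
    cx Z i = q] has degree 0 as well, and [f * q = (cx T i)^2 * g] compares the
    degrees 0 and 2. *)
Theorem shared_variables d T T' i : free_seed d T -> linked T T' ->
    (forall l, l != i -> cx T' l = cx T l) ->
  cx T' i = cx T i \/ cx T' i = cx (cmut T i) i.
Proof.
move=> gT TT' xx'; have gT1 := free_seed_mutate i gT.
have [[f hf ef]|] := linked_pure_pm1 gT TT' xx'; last by left.
have xx1 l : l != i -> cx T' l = cx (cmut T i) l by move=> li; rewrite cmut_xN // xx'.
have [[g hg eg]|] := linked_pure_pm1 gT1 (linked_from_mutate i gT TT') xx1; last by right.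
have [q [e _ q0 hq]] := exchange_binom i gT.
rewrite (ev_homogeneous0 chi gT.1.1 gT1.1.1 (@cmut_xN T i) hg) in eg.
have x0 := gT.1.1 i; have x10 := gT1.1.1 i.
have f0 : f != 0.
  have := (linked_free_seed gT TT'); case=> d' [[x'0 _] _].
  by apply: contra_neq (x'0 i) => f0; rewrite ef f0 ev0 mulr0.
have hfq : homogeneous (G := G) i 0 (f * q).
  by rewrite -(addr0 0); apply: homogeneousM.
suff /(pure_degree gT.1 hfq hg) : (cx T i) ^ 0 * ev chi (cx T) (f * q) =
    (cx T i) ^ 2 * ev chi (cx T) g by rewrite mulf_neq0 // => /(_ isT).
rewrite expr0z mul1r evM -e.
have <- : cx T i * cx T' i = ev chi (cx T) f by rewrite ef exprN1 mulVKf.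
have <- : cx (cmut T i) i * cx T' i = ev chi (cx T) g.
  by rewrite eg exprN1 mulVKf.
by rewrite -exprnP expr2; ring.
Qed.

End MutationClasses.

(** * Clusters as sets *)

Section SetsOfVariables.
Variables (n : nat) (K : choiceType).
Implicit Types (x y : 'I_n -> K).

Definition values x : {fset K} := [fset x i | i in 'I_n].

Lemma values_in x i : x i \in values x.
Proof. by apply/imfsetP; exists i. Qed.

Lemma valuesP x u : reflect (exists i, u = x i) (u \in values x).
Proof. by apply: (iffP (imfsetP _ _ _ _)) => -[i]; [exists i|move->; exists i]. Qed.

Lemma card_values x : injective x -> #|` values x| = n.
Proof.
by move=> inj; rewrite card_imfset //= -cardE card_ord.
Qed.

Lemma card_values_exchanged x y k : injective x -> injective y ->
    (forall i, i != k -> y i = x i) -> y k != x k ->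
  (#|` values x `&` values y|).+1 = n.
Proof.
move=> xinj yinj yx yk.
have -> : values x `&` values y = values x `\ x k.
  apply/fsetP => u; rewrite !inE andbC; apply/andP/andP => -[a ux]; split=> //.
    apply/eqP => uk; move: a; rewrite uk => /valuesP[i xi].
    have [ik|ik] := eqVneq i k; first by rewrite -ik -xi ik eqxx in yk.
    by move: xi; rewrite yx // => /xinj ki; rewrite ki eqxx in ik.
  have /valuesP[i ui] := ux; rewrite ui -yx ?values_in //.
  by apply: contra_neq a => <-.
by rewrite -[RHS](card_values xinj) [in RHS](cardfsD1 (x k)) values_in.
Qed.

(** Each of the two families has exactly one value that the other one misses;
    the permutation matches the indices of these values, and all others by
    equality of values. *)
Lemma match_shared x y : injective x -> injective y ->
    (#|` values x `&` values y|).+1 = n ->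
  exists (s : 'S_n) i, (forall l, l != i -> y (s l) = x l) /\ y (s i) <> x i.
Proof.
have missing x1 x2 : injective x1 -> (#|` values x1 `&` values x2|).+1 = n ->
    exists2 i, x1 i \notin values x2 & forall l, l != i -> x1 l \in values x2.
  move=> inj e.
  have [i xi] : exists i, x1 i \notin values x2.
    apply: contrapT => /forallNP no.
    have /fsetIidPl s : values x1 `<=` values x2.
      by apply/fsubsetP => _ /valuesP[i ->]; have /negP := no i; rewrite negbK.
    by move: e; rewrite s card_values // => /eqP; rewrite (gtn_eqF (ltnSn n)).
  exists i => // l li.
  have /fsetP/(_ (x1 l)) : values x1 `&` values x2 = values x1 `\ x1 i.
    apply/eqP; rewrite eqEfcard; apply/andP; split.
      apply/fsubsetP => u; rewrite !inE => /andP[-> u2]; rewrite andbT.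
      by apply: contraNneq xi => <-.
    rewrite -ltnS -[X in (_ < X)%N]/(_.+1) e -(card_values inj).
    by rewrite [in X in (_ <= X)%N](cardfsD1 (x1 i)) values_in.
  by rewrite !inE values_in /= andbT => ->; apply: contra_neq li => /inj.
move=> xinj yinj e; have [i xi xl] := missing x y xinj e.
have [|j yj _] := missing y x yinj; first by rewrite fsetIC.
have pre l : exists j', l != i -> y j' = x l.
  have [->|/xl/valuesP[j' ->]] := eqVneq l i; last by exists j'.
  by exists j.
have [g pos_monomial] := choice pre.
pose f l := if l == i then j else g l.
have fP l : l != i -> y (f l) = x l by move=> li; rewrite /f (negPf li) pos_monomial.
have finj : injective f.
  move=> l l'; have [->|li] := eqVneq l i; have [->|l'i] := eqVneq l' i => // e'.
  - by move: yj; rewrite (_ : j = f l') ?fP ?values_in // -e' /f eqxx.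
  - by move: yj; rewrite (_ : j = f l) ?fP ?values_in // e' /f eqxx.
  - by apply: xinj; rewrite -!fP // e'.
exists (perm finj), i; split=> [l li|]; rewrite permE; first exact: fP.
by rewrite /f eqxx => yx; move: yj; rewrite yx values_in.
Qed.

End SetsOfVariables.

(** * Clusters sharing all but one variable *)

Section SharedVariables.
Variables (n : nat) (P : semifieldType) (G : laurent_group P n).
Variables (K : fieldType) (chi : character P K).
Local Notation seed := (cseed n P K).
Local Notation cmut := (cmut chi).
Local Notation free_seed := (free_seed G chi).
Implicit Types (T : seed) (k l : 'I_n) (ks : seq 'I_n) (d : 'I_n -> rat).

Lemma cluster_injective d T : free_seed d T -> injective (cx T).
Proof.
move=> [fx _] i j; rewrite -!(ev_lX G chi _ fx.1) => /(ev_inj fx)/mon_inj.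
move=> /(congr1 (fun g => lexp g i)); rewrite !lexp_mk !ffunE eqxx.
by case: eqP.
Qed.

(** The product of the two variables has degree 0 in the old one, whose square
    has degree 2. *)
Lemma new_variable d T k : free_seed d T -> cx (cmut T k) k != cx T k.
Proof.
move=> gT; have [q [e _ q0 hq]] := exchange_binom k gT.
apply/eqP => e1; rewrite e1 in e.
suff : 0 = 2 :> int by [].
apply: (pure_degree gT.1 hq (@homogeneous1 _ _ G k) q0).
by rewrite expr0z mul1r -e ev1 mulr1 -exprnP expr2.
Qed.

(** Once the shared variables are matched, [shared_variables] identifies the
    remaining one; it is not the old one, which the other cluster misses. *)
Theorem shared_iff_mutation d T ks ks' : free_seed d T ->
  let T1 := foldl cmut T ks in let T2 := foldl cmut T ks' in
  (#|` values (cx T1) `&` values (cx T2)|).+1 = n <->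
  exists k, values (cx T2) = values (cx (cmut T1 k)).
Proof.
move=> gT T1 T2; have gT1 : free_seed d T1 by apply: free_seed_foldl.
have gT2 : free_seed d T2 by apply: free_seed_foldl.
have inj := cluster_injective.
split=> [e|[k ->]]; last first.
  apply: (@card_values_exchanged _ _ _ _ k).
  - exact: inj gT1.
  - exact: inj (free_seed_mutate k gT1).
  - by move=> i; apply: cmut_xN.
  - exact: new_variable gT1.
have [s [i [xs xi]]] := match_shared (inj _ _ gT1) (inj _ _ gT2) e.
exists i; have TT : linked chi T1 (perm_seed s T2).
  by exists (rev ks ++ ks'), s; rewrite foldl_cat (foldl_mutateK _ gT).
have xs' l : l != i -> cx (perm_seed s T2) l = cx T1 l by move=> li; rewrite ffunE xs.
have [|x'i] := shared_variables gT1 TT xs'; first by rewrite ffunE => /xi.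
apply/fsetP => u; apply/valuesP/valuesP => -[l ->].
  exists (s^-1 l)%g; have [li|li] := eqVneq (s^-1 l)%g i.
    by rewrite li -x'i ffunE -li permKV.
  by rewrite cmut_xN // -xs' // ffunE permKV.
exists (s l); have [->|li] := eqVneq l i; first by rewrite -x'i ffunE.
by rewrite cmut_xN // -xs' // ffunE.
Qed.

End SharedVariables.

(** * The exchange graph *)

Lemma skew_symmetrizable_by n (B : 'M[int]_n) :
  skew_symmetrizable B -> exists d, skew_by d B.
Proof.
move=> [d [d0 /= e]]; exists (fun i => d 0 i); split=> // i j.
move/matrixP/(_ j i): e; rewrite mul_diag_mx !mxE; exact.
Qed.

Section ExchangeGraphOfSeed.
Variables (n : nat) (P : semifieldType).
Local Notation G := (lmon_group P n).
Local Notation chi := (@of_char n P).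
Implicit Types (S : seed n P) (k : 'I_n) (ks : seq 'I_n).

Lemma is_seed_free S : is_seed S -> exists d, free_seed G chi d (cseed_of S).
Proof.
move=> [[ai _] /skew_symmetrizable_by[d sk]]; exists d; split=> //.
exact: laurent_free_cluster.
Qed.

Lemma cseed_of_inj S S' : cseed_of S = cseed_of S' -> S = S'.
Proof. by case: S S' => [x y B] [x' y' B'] [-> -> ->]. Qed.

Lemma cseed_of_foldl S ks :
  cseed_of (foldl (@mutate n P) S ks) = foldl (cmut chi) (cseed_of S) ks.
Proof. by elim: ks S => [//|k ks IH] S /=; rewrite IH cseed_of_mutate. Qed.

Lemma mutate_involutive S ks k : is_seed S ->
  let S1 := foldl (@mutate n P) S ks in mutate (mutate S1 k) k = S1.
Proof.
move=> /is_seed_free[d gS] S1; apply: cseed_of_inj; rewrite !cseed_of_mutate.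
by rewrite cseed_of_foldl (mutateK k (free_seed_foldl ks gS)).
Qed.

Lemma unordered_clusterE S : unordered_cluster S = values (cx (cseed_of S)).
Proof. by []. Qed.

Lemma shared_iff_mutate S ks ks' : is_seed S ->
  let S1 := foldl (@mutate n P) S ks in let S2 := foldl (@mutate n P) S ks' in
  (#|` unordered_cluster S1 `&` unordered_cluster S2|).+1 = n <->
  exists k, unordered_cluster S2 = unordered_cluster (mutate S1 k).
Proof.
move=> /is_seed_free[d gS] S1 S2; rewrite !unordered_clusterE.
have := shared_iff_mutation ks ks' gS.
rewrite -!cseed_of_foldl -/S1 -/S2 => -[a b]; split.
  by move/a => [k e]; exists k; rewrite unordered_clusterE cseed_of_mutate.
by move=> [k e]; apply: b; exists k; rewrite -cseed_of_mutate.
Qed.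

Local Notation reduced := (sorted (fun i j : 'I_n => i != j)).

Lemma reduced_rcons ks k l :
  reduced (rcons (rcons ks k) l) = reduced (rcons ks k) && (k != l).
Proof. by case: ks => [|i ks] /=; rewrite ?andbT // !rcons_path last_rcons. Qed.

(** Either [k] lengthens the reduced word, or it cancels its last letter. *)
Lemma neighbour_vertex S (v : regular_tree n) k : is_seed S ->
  exists2 w : regular_tree n, tree_edge k v w & seed_at S w = mutate (seed_at S v) k.
Proof.
move=> hS; rewrite /seed_at /tree_edge; case: v => w sw /=.
case/lastP: w sw => [|w l] sw.
  by exists (exist _ [:: k] isT); [left|].
have [lk|lk] := eqVneq l k; last first.
  have sw' : reduced (rcons (rcons w l) k) by rewrite reduced_rcons lk andbT.
  by exists (exist _ (rcons (rcons w l) k) sw'); [left|rewrite /= !foldl_rcons].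
have sw' : reduced w.
  case/lastP: w sw => // w l'.
  by rewrite reduced_rcons => /andP[].
exists (exist _ w sw'); first by right; rewrite /= lk.
by rewrite /= foldl_rcons lk mutate_involutive.
Qed.

(** A sequence of mutations may go back along an edge, but it never leaves the
    seeds at the vertices of the tree. *)
Lemma reachable_vertex S ks : is_seed S ->
  exists v : regular_tree n, seed_at S v = foldl (@mutate n P) S ks.
Proof.
move=> hS; elim/last_ind: ks => [|ks k [v IH]]; first by exists (exist _ [::] isT).
have [w _ e] := neighbour_vertex v k hS.
by exists w; rewrite e IH foldl_rcons.
Qed.

Theorem clusters_adjacentP S C C' : is_seed S ->
  is_cluster S C -> is_cluster S C' ->
  clusters_adjacent S C C' <-> (#|` C `&` C'|).+1 = n.
Proof.
move=> hS [_ [[ks ->] eC]] [_ [[ks' ->] eC']]; split.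
  move=> [a [b [aC bC' [k [v [w [av bw vw]]]]]]].
  move: aC bC'; rewrite av bw !vertex_cluster_pi => <- <-.
  apply/(shared_iff_mutate _ _ hS); exists k.
  case: vw => e; rewrite /seed_at e foldl_rcons //.
  by rewrite mutate_involutive.
rewrite eC eC' => /(shared_iff_mutate _ _ hS)[k e].
have [v ev] := reachable_vertex ks hS.
have [w vw ew] := neighbour_vertex v k hS.
exists (\pi v), (\pi w); rewrite !vertex_cluster_pi ew ev e; split=> //.
by exists k, v, w.
Qed.

End ExchangeGraphOfSeed.

Theorem theorem5 (n : nat) :
  (forall (P : semifieldType) (S : seed n P),
     is_seed S -> seeds_defined_by_clusters S ->
     forall C C' : {fset ambient n P}, is_cluster S C -> is_cluster S C' ->
       (clusters_adjacent S C C' <-> (#|` C `&` C'|).+1 = n))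
  /\
  (forall B : 'M[int]_n, skew_symmetrizable B ->
   forall (P : semifieldType) (S : seed n P),
     is_seed S -> exchange_matrix S = B ->
     (tropical P \/ \det B != 0) ->
     forall C C' : {fset ambient n P}, is_cluster S C -> is_cluster S C' ->
       (clusters_adjacent S C C' <-> (#|` C `&` C'|).+1 = n)).
Proof.
by split=> [P S hS _|B _ P S hS _ _] C C' hC hC'; apply: clusters_adjacentP.
Qed.
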